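(* Let $P(X)$ and $P(Y)$ be two regular path complexes over finite sets $X$ and $Y$, let $R$ be a principal ideal domain, and let $P(Z)=P(X)\boxplus P(Y)$ be their Cartesian product, a path complex over $Z=X\times Y$. Then for each $n$ there is a natural splitting short exact sequence (Künneth formula) $$0\rightarrow\bigoplus_{i}\big(H_{i}(X)\otimes_{R}H_{n-i}(Y)\big)\rightarrow H_{n}(Z)\rightarrow\bigoplus_{i}\mathrm{Tor}_1^{R}\big(H_{i}(X),H_{n-i-1}(Y)\big)\rightarrow 0.$$
   Context: Let $V$ be a non-empty finite set. For $n\ge 0$, an elementary $n$-path on $V$ is an ordered sequence $i_0\cdots i_n$ of $n+1$ (not necessarily distinct) elements of $V$; it is regular if $i_{k-1}\neq i_k$ for all $1\le k\le n$. A path complex over $V$ is a non-empty collection $P=P(V)$ of elementary paths on $V$ such that whenever $i_0\cdots i_n\in P$, the truncated paths $i_0\cdots i_{n-1}$ and $i_1\cdots i_n$ are also in $P$ (for $n=0$ the truncated path is the empty path, which plays no role here). $P_n(V)$ denotes the set of elementary $n$-paths in $P$. $P$ is regular if all its paths are regular. Let $\mathcal R_n(V)$ be the free $R$-module with basis the symbols $e_{i_0\cdots i_n}$, one for each regular elementary $n$-path on $V$. The boundary operator $\partial:\mathcal R_n(V)\to\mathcal R_{n-1}(V)$ ($n\ge1$) is $\partial e_{i_0\cdots i_n}=\sum_{q=0}^n(-1)^q e_{i_0\cdots\widehat{i_q}\cdots i_n}$, where terms indexed by non-regular paths are replaced by $0$; $\partial=0$ on $\mathcal R_0(V)$. $\mathcal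 A_n(V)\subseteq\mathcal R_n(V)$ is the submodule spanned by the $e_{\mathbf i}$ with $\mathbf i\in P_n(V)$, and $\Omega_n(V)=\{p\in\mathcal A_n(V):\partial p\in\mathcal A_{n-1}(V)\}$ (with $\mathcal A_{-1}(V)=0$); these form a chain complex $\Omega_\ast(V)$ ending in $\Omega_0(V)\to0$, and $H_n(V):=H_n(\Omega_\ast(V))$ is the path homology of $P(V)$ with coefficients in $R$. Cartesian product. For an elementary $m$-path $i_0\cdots i_m$ on $X$ and an elementary $n$-path $j_0\cdots j_n$ on $Y$, consider all step-like lattice paths $\sigma$ from $(0,0)$ to $(m,n)$ in the $m\times n$ rectangular grid, consisting of $m+n$ unit edges, each going horizontally to the right or vertically up. If $\sigma$ has successive vertices $(a_k,b_k)$, $0\le k\le m+n$, let $e_\sigma$ be the elementary $(m+n)$-path on $Z=X\times Y$ with successive vertices $(i_{a_k},j_{b_k})$. $P(Z)=P(X)\boxplus P(Y)$ is the path complex over $Z$ whose elementary $k$-paths are all the $e_\sigma$ arising in this way from some elementary $s$-path in $P_s(X)$ and some elementary $(k-s)$-path in $P_{k-s}(Y)$, $0\le s\le k$. *)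

(* Defs.v *)
From HB Require Import structures.
From mathcomp Require Import all_boot all_order all_algebra.
From mathcomp Require Import boolp classical_sets.
From mathcomp Require Import freeg.

Set Implicit Arguments.
Unset Strict Implicit.
Unset Printing Implicit Defensive.

Import GRing.Theory.
Local Open Scope classical_set_scope.
Local Open Scope ring_scope.
Local Open Scope quotient_scope.

Definition principal_ideal_domain (R : idomainType) : Prop :=
  forall I : set R,
    I 0 -> (forall a x y, I x -> I y -> I (a * x + y)) ->
  exists a, I = [set b * a | b in [set: R]].

Section Submodules.
Variables (R : comNzRingType) (U V : lmodType R).

Definition kerp (f : {linear U -> V}) : {pred U} := [pred x | f x == 0].

Lemma kerp_closed (f : {linear U -> V}) : submod_closed (kerp f).
Proof.
split=> [|a x y]; rewrite !inE ?linear0 // => /eqP fx /eqP fy.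
by rewrite linearP fx fy scaler0 addr0.
Qed.
HB.instance Definition _ f :=
  GRing.isSubmodClosed.Build R U (kerp f) (kerp_closed f).

Definition imgp (f : {linear U -> V}) : {pred V} :=
  [pred y | `[< exists x, f x = y >]].

Lemma imgpP (f : {linear U -> V}) y :
  reflect (exists x, f x = y) (y \in imgp f).
Proof. exact: asboolP. Qed.

Lemma imgp_closed (f : {linear U -> V}) : submod_closed (imgp f).
Proof.
split=> [|a x y]; first by apply/imgpP; exists 0; rewrite linear0.
move=> /imgpP[u <-] /imgpP[v <-]; apply/imgpP.
by exists (a *: u + v); rewrite linearP.
Qed.
HB.instance Definition _ f :=
  GRing.isSubmodClosed.Build R V (imgp f) (imgp_closed f).

Definition preimp (f : {linear U -> V}) (W : submodClosed V) : {pred U} :=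
  [pred x | f x \in W].

Lemma preimp_closed f W : submod_closed (preimp f W).
Proof.
split=> [|a x y]; rewrite !inE ?linear0 ?rpred0 // => fx fy.
by rewrite linearP rpredD ?rpredZ.
Qed.
HB.instance Definition _ f W :=
  GRing.isSubmodClosed.Build R U (preimp f W) (preimp_closed f W).

Definition spanp (S : set U) : {pred U} :=
  [pred x | `[< forall W : submodClosed U,
                  (forall y, S y -> y \in W) -> x \in W >]].

Lemma spanp_closed S : submod_closed (spanp S).
Proof.
split=> [|a x y]; first by apply/asboolP => W _; rewrite rpred0.
move=> /asboolP Sx /asboolP Sy; apply/asboolP => W SW.
by rewrite rpredD ?rpredZ ?Sx ?Sy.
Qed.
HB.instance Definition _ S :=
  GRing.isSubmodClosed.Build R U (spanp S) (spanp_closed S).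

Lemma mem_spanp (S : set U) x : S x -> x \in spanp S.
Proof. by move=> Sx; apply/asboolP => W; apply. Qed.

End Submodules.

Lemma spanp_sub (R : comNzRingType) (U V : lmodType R) (f : {linear U -> V})
    (S : set U) (W : submodClosed V) :
  (forall x, S x -> f x \in W) -> forall x, x \in spanp S -> f x \in W.
Proof. by move=> SW x /asboolP/(_ (preimp f W)); apply=> y /SW. Qed.

Lemma spanp_ker (R : comNzRingType) (U V : lmodType R) (f : {linear U -> V})
    (S : set U) :
  (forall x, S x -> f x = 0) -> forall x, x \in spanp S -> f x = 0.
Proof.
by move=> SW x /asboolP/(_ (kerp f)) H; apply/eqP; apply: H => y /SW/eqP.
Qed.

Definition subm (R : comNzRingType) (V : lmodType R) (S : submodClosed V) : Type :=
  {x : V | x \in S}.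

Section SubmoduleType.
Variables (R : comNzRingType) (V : lmodType R) (S : submodClosed V).
HB.instance Definition _ := SubChoice.on (subm S).
HB.instance Definition _ := [SubChoice_isSubLmodule of subm S by <:].
End SubmoduleType.

Section SubmoduleMap.
Variables (R : comNzRingType) (U V : lmodType R).
Variables (S : submodClosed U) (T : submodClosed V) (f : {linear U -> V}).
Hypothesis fST : forall x, x \in S -> f x \in T.

Definition subm_map (x : subm S) : subm T := Sub (f (val x)) (fST (valP x)).

Lemma subm_map_linear : linear subm_map.
Proof. by move=> a x y; apply: val_inj; rewrite /= linearP. Qed.
HB.instance Definition _ :=
  GRing.isLinear.Build R (subm S) (subm T) *:%R subm_map subm_map_linear.

End SubmoduleMap.

Lemma submod_zmod_closed (R : comNzRingType) (V : lmodType R)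
  (S : submodClosed V) : zmod_closed S.
Proof.
split=> [|x y Sx Sy]; first exact: rpred0.
by rewrite -[- y]scaleN1r rpredD ?rpredZ.
Qed.

Definition submod_zmod (R : comNzRingType) (V : lmodType R)
  (S : submodClosed V) : zmodClosed V :=
  HB.pack (S : {pred V})
    (GRing.isZmodClosed.Build V (S : {pred V}) (submod_zmod_closed S)).

Definition qmod (R : comNzRingType) (V : lmodType R) (S : submodClosed V) : Type :=
  Quotient.quot (submod_zmod S).

Section QuotientType.
Variables (R : comNzRingType) (V : lmodType R) (S : submodClosed V).
HB.instance Definition _ := GRing.Zmodule.on (qmod S).

Definition qpi (x : V) : qmod S := \pi_(Quotient.quot (submod_zmod S)) x.
Definition qrepr (x : qmod S) : V := repr (x : Quotient.quot (submod_zmod S)).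

Lemma qreprK : cancel qrepr qpi.
Proof. exact: reprK. Qed.

Lemma qpi_eq x y : (qpi x = qpi y) <-> (x - y \in S).
Proof.
have -> : (x - y \in S) = (x - y \in submod_zmod S) by [].
by rewrite Quotient.idealrBE; split=> [/eqP|/eqP].
Qed.

Lemma qpiB : {morph qpi : x y / x - y}.
Proof. by move=> x y; rewrite /qpi raddfB. Qed.
Lemma qpiD : {morph qpi : x y / x + y}.
Proof. by move=> x y; rewrite /qpi raddfD. Qed.

Definition qscale (a : R) (x : qmod S) : qmod S := qpi (a *: qrepr x).

Lemma qscaleE a x : qscale a (qpi x) = qpi (a *: x).
Proof.
by apply/qpi_eq; rewrite -scalerBr rpredZ //; apply/qpi_eq; rewrite qreprK.
Qed.

Lemma qscaleA a b x : qscale a (qscale b x) = qscale (a * b) x.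
Proof. by rewrite -[x]qreprK !qscaleE scalerA. Qed.
Lemma qscale1 : left_id 1 qscale.
Proof. by move=> x; rewrite -[x]qreprK qscaleE scale1r. Qed.
Lemma qscaleDr : right_distributive qscale +%R.
Proof.
by move=> a x y; rewrite -[x]qreprK -[y]qreprK -qpiD !qscaleE -qpiD scalerDr.
Qed.
Lemma qscaleDl x : {morph qscale^~ x : a b / a + b}.
Proof. by move=> a b; rewrite -[x]qreprK !qscaleE -qpiD scalerDl. Qed.
HB.instance Definition _ := GRing.Zmodule_isLmodule.Build R (qmod S)
  qscaleA qscale1 qscaleDr qscaleDl.

Lemma qpi_linear : linear qpi.
Proof. by move=> a x y; rewrite qpiD -qscaleE. Qed.
HB.instance Definition _ :=
  GRing.isLinear.Build R V (qmod S) *:%R qpi qpi_linear.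

End QuotientType.
Arguments qpi {R V} S x.

Section QuotientLift.
Variables (R : comNzRingType) (V W : lmodType R) (S : submodClosed V).
Variables (f : {linear V -> W}) (fS : forall x, x \in S -> f x = 0).

Definition qlift of (forall x, x \in S -> f x = 0) :=
  fun x : qmod S => f (qrepr x).

Lemma qliftE x : qlift fS (qpi S x) = f x.
Proof.
by apply/subr0_eq; rewrite -linearB fS //; apply/qpi_eq; rewrite qreprK.
Qed.

Lemma qlift_linear : linear (qlift fS).
Proof.
move=> a x y; rewrite -[x]qreprK -[y]qreprK -linearP !qliftE.
exact: linearP.
Qed.
HB.instance Definition _ :=
  GRing.isLinear.Build R (qmod S) W *:%R (qlift fS) qlift_linear.

End QuotientLift.

Section Homology.
Variables (R : comNzRingType) (A B C : lmodType R).
Variables (f : {linear A -> B}) (g : {linear B -> C}).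

Definition boundaryp : {pred subm (kerp g)} := [pred z | val z \in imgp f].

Lemma boundaryp_closed : submod_closed boundaryp.
Proof.
split=> [|a x y fx fy]; first exact: (rpred0 (imgp f)).
have -> : (a *: x + y \in boundaryp) = (a *: val x + val y \in imgp f) by [].
by rewrite rpredD ?rpredZ.
Qed.
HB.instance Definition _ := GRing.isSubmodClosed.Build R _
  boundaryp boundaryp_closed.

Definition homology : lmodType R := qmod boundaryp.

Definition hclass : {linear subm (kerp g) -> homology} := qpi boundaryp.

End Homology.
Arguments boundaryp {R A B C} f g.

Section HomologyMap.
Variables (R : comNzRingType) (A B C A' B' C' : lmodType R).
Variables (f : {linear A -> B}) (g : {linear B -> C}).
Variables (f' : {linear A' -> B'}) (g' : {linear B' -> C'}).
Variables (a : {linear A -> A'}) (b : {linear B -> B'}) (c : {linear C -> C'}).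
Hypothesis abf : forall x, b (f x) = f' (a x).
Hypothesis bcg : forall x, c (g x) = g' (b x).

Lemma cycle_mapP x : x \in kerp g -> b x \in kerp g'.
Proof. by rewrite !inE -bcg => /eqP ->; rewrite linear0. Qed.

Definition cycle_map : {linear subm (kerp g) -> subm (kerp g')} :=
  subm_map cycle_mapP.

Lemma homology_mapP z : z \in boundaryp f g -> (hclass f' g' \o cycle_map) z = 0.
Proof.
move=> /imgpP[x fx]; rewrite -(linear0 (hclass f' g')); apply/qpi_eq.
by rewrite subr0; apply/imgpP; exists (a x); rewrite -abf fx.
Qed.

Definition homology_map : {linear homology f g -> homology f' g'} :=
  qlift homology_mapP.

Lemma homology_mapE z : homology_map (hclass f g z) = hclass f' g' (cycle_map z).
Proof. exact: qliftE. Qed.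

End HomologyMap.

Section FreeModule.
Variable R : comNzRingType.

Section Lift.
Variables (K : choiceType) (M : lmodType R) (f : K -> M).

Lemma fglift_linear : linear (fglift f : {freeg K / R} -> M).
Proof.
move=> a D E; set D' := a *: D; have -> : D' + E = D' - (- E) by rewrite opprK.
rewrite lift_is_additive -[- E]add0r lift_is_additive.
have -> : fglift f 0 = 0 by rewrite -[0 in LHS](subrr 0) lift_is_additive subrr.
rewrite add0r opprK; congr (_ + _).
have addf := lift_is_additive f.
pose L : {additive {freeg K / R} -> M} :=
  HB.pack (fglift f) (GRing.isZmodMorphism.Build _ _ _ addf).
have fsum (c : K -> R) (s : seq K) :
    fglift f (\sum_(x <- s) << c x *g x >>) = \sum_(x <- s) c x *: f x.
  rewrite -[LHS]/(L _) raddf_sum; apply: eq_bigr => x _.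
  by rewrite -[LHS]/(fglift f _) liftU.
rewrite /D' -[a *: D]/(fgscale a D) /fgscale fsum -[D in RHS]freeg_sumE fsum.
by rewrite scaler_sumr; apply: eq_bigr => x _; rewrite scalerA.
Qed.
HB.instance Definition _ := GRing.isLinear.Build R {freeg K / R} M *:%R
  (fglift f : {freeg K / R} -> M) fglift_linear.

Definition free_lift : {linear {freeg K / R} -> M} := fglift f.

End Lift.

Definition fgen (K : choiceType) (x : K) : {freeg K / R} := << x >>.

Lemma free_liftE (K : choiceType) (M : lmodType R) (f : K -> M) x :
  free_lift f (fgen x) = f x.
Proof. by rewrite /free_lift /= liftU scale1r. Qed.

Lemma free_ext (K : choiceType) (M : lmodType R)
    (f g : {linear {freeg K / R} -> M}) :
  (forall x, f (fgen x) = g (fgen x)) -> f =1 g.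
Proof.
move=> fg D; rewrite -[D]freeg_sumE !linear_sum; apply: eq_bigr => x _.
suff -> : << coeff x D *g x >> = coeff x D *: fgen x by rewrite !linearZ fg.
by apply/eqP/freeg_eqP => y; rewrite coeffZ !coeffU mul1r.
Qed.

Definition free_map (K L : choiceType) (f : K -> L) :
  {linear {freeg K / R} -> {freeg L / R}} := free_lift (fun x => fgen (f x)).

End FreeModule.
Arguments fgen {R K} x.

Section Tensor.
Variable R : comNzRingType.

Definition tensor_rel (M N : lmodType R) : set {freeg (M * N)%type / R} :=
  [set r | (exists a x x' y,
      r = fgen (a *: x + x', y) - (a *: fgen (x, y) + fgen (x', y))) \/
           (exists a x y y',
      r = fgen (x, a *: y + y') - (a *: fgen (x, y) + fgen (x, y')))].

Definition tensor (M N : lmodType R) : lmodType R :=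
  qmod (spanp (@tensor_rel M N)).

Definition tpure (M N : lmodType R) (x : M) (y : N) : tensor M N :=
  qpi (spanp (@tensor_rel M N)) (fgen (x, y)).

Lemma tpure_linearl (M N : lmodType R) (y : N) :
  linear (fun x : M => tpure x y).
Proof.
move=> a x x'; rewrite /tpure -linearP; apply/qpi_eq/mem_spanp.
by left; exists a, x, x', y.
Qed.

Lemma tpure_linearr (M N : lmodType R) (x : M) : linear (@tpure M N x).
Proof.
move=> a y y'; rewrite /tpure -linearP; apply/qpi_eq/mem_spanp.
by right; exists a, x, y, y'.
Qed.

Section Map.
Variables (M N M' N' : lmodType R).
Variables (f : {linear M -> M'}) (g : {linear N -> N'}).

Definition tensor_map_pre : {linear {freeg (M * N)%type / R} -> tensor M' N'} :=
  free_lift (fun p : M * N => tpure (f p.1) (g p.2)).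

Lemma tensor_map_preP r : r \in spanp (@tensor_rel M N) -> tensor_map_pre r = 0.
Proof.
apply: spanp_ker => {}r [[a [x [x' [y ->]]]]|[a [x [y [y' ->]]]]];
  rewrite linearB linearP !free_liftE /= linearP.
  by rewrite tpure_linearl subrr.
by rewrite tpure_linearr subrr.
Qed.

Definition tensor_map : {linear tensor M N -> tensor M' N'} :=
  qlift tensor_map_preP.

Lemma tensor_mapE x y : tensor_map (tpure x y) = tpure (f x) (g y).
Proof. by apply: etrans (qliftE _ _) _; rewrite free_liftE. Qed.

End Map.

Lemma tensor_ext (M N : lmodType R) (P : lmodType R)
    (f g : {linear tensor M N -> P}) :
  (forall x y, f (tpure x y) = g (tpure x y)) -> f =1 g.
Proof.
move=> fg t; rewrite -[t]qreprK; move: (qrepr t).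
by apply: (@free_ext _ _ _ (f \o qpi _) (g \o qpi _)) => -[x y]; apply: fg.
Qed.

End Tensor.

(** The beginning P2 -> P1 -> P0 -> M of the functorial free resolution of M
    in which each term is free on the set of elements of the kernel of the
    preceding map. *)
Section Resolution.
Variable R : comNzRingType.
Section Objects.
Variable M : lmodType R.
Definition res0 : lmodType R := {freeg M / R}.
Definition res_aug : {linear res0 -> M} := free_lift id.
Definition res1 : lmodType R := {freeg (subm (kerp res_aug)) / R}.
Definition res_d1 : {linear res1 -> res0} :=
  free_lift (val : subm (kerp res_aug) -> res0).
Definition res2 : lmodType R := {freeg (subm (kerp res_d1)) / R}.
Definition res_d2 : {linear res2 -> res1} :=
  free_lift (val : subm (kerp res_d1) -> res1).
End Objects.

Section Maps.
Variables (M N : lmodType R) (f : {linear M -> N}).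

Definition res_map0 : {linear res0 M -> res0 N} := free_map R f.

Lemma res_map0P x : f (res_aug M x) = res_aug N (res_map0 x).
Proof.
apply: (@free_ext _ _ _ (f \o res_aug M) (res_aug N \o res_map0)) => {}x /=.
by rewrite !free_liftE.
Qed.

Definition res_map1 : {linear res1 M -> res1 N} :=
  free_map R (cycle_map res_map0P).

Lemma res_map1P x : res_map0 (res_d1 M x) = res_d1 N (res_map1 x).
Proof.
apply: (@free_ext _ _ _ (res_map0 \o res_d1 M) (res_d1 N \o res_map1)) => {}x /=.
by rewrite !free_liftE.
Qed.

Definition res_map2 : {linear res2 M -> res2 N} :=
  free_map R (cycle_map res_map1P).

Lemma res_map2P x : res_map1 (res_d2 M x) = res_d2 N (res_map2 x).
Proof.
apply: (@free_ext _ _ _ (res_map1 \o res_d2 M) (res_d2 N \o res_map2)) => {}x /=.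
by rewrite !free_liftE.
Qed.
End Maps.
End Resolution.

Section Tor.
Variable R : comNzRingType.

(** H_1 of P * N (tensor product), for P the resolution above. *)
Definition tor1 (M N : lmodType R) : lmodType R :=
  homology (tensor_map (res_d2 M) (idfun : {linear N -> N}))
           (tensor_map (res_d1 M) (idfun : {linear N -> N})).

Variables (M N M' N' : lmodType R).
Variables (f : {linear M -> M'}) (g : {linear N -> N'}).

Lemma tor1_map2P x :
  tensor_map (res_map1 f) g (tensor_map (res_d2 M) idfun x) =
  tensor_map (res_d2 M') idfun (tensor_map (res_map2 f) g x).
Proof.
apply: (@tensor_ext _ _ _ _ (tensor_map (res_map1 f) g \o tensor_map (res_d2 M) idfun)
  (tensor_map (res_d2 M') idfun \o tensor_map (res_map2 f) g)) => {}x y.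
rewrite -[LHS]/(tensor_map (res_map1 f) g (tensor_map (res_d2 M) idfun _)).
rewrite -[RHS]/(tensor_map (res_d2 M') idfun (tensor_map (res_map2 f) g _)).
by rewrite !tensor_mapE res_map2P.
Qed.

Lemma tor1_map1P x :
  tensor_map (res_map0 f) g (tensor_map (res_d1 M) idfun x) =
  tensor_map (res_d1 M') idfun (tensor_map (res_map1 f) g x).
Proof.
apply: (@tensor_ext _ _ _ _ (tensor_map (res_map0 f) g \o tensor_map (res_d1 M) idfun)
  (tensor_map (res_d1 M') idfun \o tensor_map (res_map1 f) g)) => {}x y.
rewrite -[LHS]/(tensor_map (res_map0 f) g (tensor_map (res_d1 M) idfun _)).
rewrite -[RHS]/(tensor_map (res_d1 M') idfun (tensor_map (res_map1 f) g _)).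
by rewrite !tensor_mapE res_map1P.
Qed.

Definition tor1_map : {linear tor1 M N -> tor1 M' N'} :=
  homology_map tor1_map2P tor1_map1P.

End Tor.

Definition dsum (R : comNzRingType) (I : finType) (M : I -> lmodType R) : Type :=
  {dffun forall i : I, M i}.

Section DirectSum.
Variables (R : comNzRingType) (I : finType) (M : I -> lmodType R).
Implicit Types x y z : dsum M.

HB.instance Definition _ := Choice.on (dsum M).

Definition dsum0 : dsum M := [ffun i => 0 : M i].
Definition dsumD x y : dsum M := [ffun i => x i + y i].
Definition dsumN x : dsum M := [ffun i => - x i].
Definition dsumZ (a : R) x : dsum M := [ffun i => a *: x i].

Lemma dsumDA : associative dsumD.
Proof. by move=> x y z; apply/ffunP => i; rewrite !ffunE addrA. Qed.
Lemma dsumDC : commutative dsumD.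
Proof. by move=> x y; apply/ffunP => i; rewrite !ffunE addrC. Qed.
Lemma dsum0D : left_id dsum0 dsumD.
Proof. by move=> x; apply/ffunP => i; rewrite !ffunE add0r. Qed.
Lemma dsumND : left_inverse dsum0 dsumN dsumD.
Proof. by move=> x; apply/ffunP => i; rewrite !ffunE addNr. Qed.
HB.instance Definition _ :=
  GRing.isZmodule.Build (dsum M) dsumDA dsumDC dsum0D dsumND.

Lemma dsumZA a b x : dsumZ a (dsumZ b x) = dsumZ (a * b) x.
Proof. by apply/ffunP => i; rewrite !ffunE scalerA. Qed.
Lemma dsumZ1 : left_id 1 dsumZ.
Proof. by move=> x; apply/ffunP => i; rewrite !ffunE scale1r. Qed.
Lemma dsumZDr : right_distributive dsumZ +%R.
Proof. by move=> a x y; apply/ffunP => i; rewrite !ffunE scalerDr. Qed.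
Lemma dsumZDl x : {morph dsumZ^~ x : a b / a + b}.
Proof. by move=> a b; apply/ffunP => i; rewrite !ffunE scalerDl. Qed.
HB.instance Definition _ := GRing.Zmodule_isLmodule.Build R (dsum M)
  dsumZA dsumZ1 dsumZDr dsumZDl.

End DirectSum.

Section DirectSumMap.
Variables (R : comNzRingType) (I : finType) (M N : I -> lmodType R).
Variable f : forall i, {linear M i -> N i}.

Definition dsum_map (x : dsum M) : dsum N := [ffun i => f i (x i)].

Lemma dsum_map_linear : linear dsum_map.
Proof. by move=> a x y; apply/ffunP => i; rewrite !ffunE linearP. Qed.
HB.instance Definition _ :=
  GRing.isLinear.Build R (dsum M) (dsum N) *:%R dsum_map dsum_map_linear.

End DirectSumMap.

(** Degree -1 is the zero module, encoded as [chain_d 0 = 0] since 0.-1 = 0. *)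
Record chain_complex (R : comNzRingType) := ChainComplex {
  chain :> nat -> lmodType R;
  chain_d : forall n, {linear chain n -> chain n.-1};
  chain_d0 : forall x, chain_d 0 x = 0;
  chain_dd : forall n x, chain_d n (chain_d n.+1 x) = 0 }.

Definition chain_homology (R : comNzRingType) (C : chain_complex R) (n : nat) :
  lmodType R := @homology R (C n.+1) (C n) (C n.-1) (chain_d C n.+1) (chain_d C n).

Record chain_map (R : comNzRingType) (C D : chain_complex R) := ChainMap {
  chain_fun :> forall n, {linear C n -> D n};
  chain_comm : forall n x,
    chain_fun n.-1 (chain_d C n x) = chain_d D n (chain_fun n x) }.

Definition chain_homology_map (R : comNzRingType) (C D : chain_complex R)
    (f : chain_map C D) (n : nat) :
    {linear chain_homology C n -> chain_homology D n} :=
  homology_map (@chain_comm R C D f n.+1) (@chain_comm R C D f n).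

(** [pc_neq0] and [pc_nil] together force the vertex set to be non-empty. *)
Record path_complex := PathComplex {
  vertex :> finType;
  pc_path : set (seq vertex);
  pc_nil : ~ pc_path [::];
  pc_neq0 : pc_path !=set0;
  pc_trunc : forall x s y, pc_path (x :: rcons s y) ->
    pc_path (x :: s) /\ pc_path (rcons s y) }.
Arguments pc_path : clear implicits.

Definition regular_seq (V : eqType) (s : seq V) : bool :=
  sorted [rel x y | x != y] s.

Definition regular_complex (P : path_complex) : Prop :=
  forall s, pc_path P s -> regular_seq s.

Lemma regularPn (V : eqType) (s : seq V) :
  ~~ regular_seq s -> exists u x w, s = u ++ [:: x, x & w].
Proof.
elim: s => // x [//|y s] IH; rewrite /regular_seq /= negb_and negbK.
case: eqVneq => [<- _|_ /IH[u [z [w ->]]]]; first by exists [::], x, s.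
by exists (x :: u), z, w.
Qed.

Lemma regular_catxx (V : eqType) (u w : seq V) x :
  regular_seq (u ++ [:: x, x & w]) = false.
Proof.
elim: u => [|y [|z u] IH]; rewrite /regular_seq /= ?eqxx ?andbF //.
by move: IH; rewrite /regular_seq /= => ->; rewrite andbF.
Qed.

Lemma regular_map (V W : eqType) (f : V -> W) s :
  regular_seq (map f s) -> regular_seq s.
Proof.
move=> fs; case: (boolP (regular_seq s)) => // /regularPn[u [x [w es]]].
by move: fs; rewrite es map_cat /= regular_catxx.
Qed.

Definition del (T : Type) (q : nat) (s : seq T) := take q s ++ drop q.+1 s.

Lemma size_del (T : Type) q (s : seq T) :
  (q < size s)%N -> size (del q s) = (size s).-1.
Proof.
move=> qs; rewrite size_cat size_drop size_take qs.
by case: (size s) qs => // k qk; rewrite subSS subnKC.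
Qed.

Lemma map_del (T T' : Type) (f : T -> T') q s :
  map f (del q s) = del q (map f s).
Proof. by rewrite /del map_cat map_take map_drop. Qed.

Lemma del_cons0 (T : Type) (x : T) s : del 0 (x :: s) = s.
Proof. by rewrite /del /= drop0. Qed.

Lemma del_consS (T : Type) (x : T) q s : del q.+1 (x :: s) = x :: del q s.
Proof. by []. Qed.

Lemma del_del (T : Type) (s : seq T) q r :
  (q <= r)%N -> del r (del q s) = del q (del r.+1 s).
Proof.
elim: s q r => [|x s IH] [|q] [|r] //.
- by rewrite del_cons0 del_consS del_cons0.
- by rewrite del_cons0 del_consS del_cons0.
by rewrite ltnS => qr; rewrite !del_consS IH.
Qed.

Lemma del_catl (T : Type) q (u v : seq T) :
  (q < size u)%N -> del q (u ++ v) = del q u ++ v.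
Proof.
elim: u q => [|x u IH] [|q] //; first by rewrite cat_cons !del_cons0.
by rewrite ltnS => /IH; rewrite cat_cons !del_consS => ->.
Qed.

Lemma del_catr (T : Type) k (u v : seq T) :
  del (size u + k) (u ++ v) = u ++ del k v.
Proof. by elim: u => //= x u IH; rewrite addSn del_consS IH. Qed.

Lemma alternating_sum0 (M : zmodType) N (F : nat -> nat -> M) :
  (forall q r, (q <= r)%N -> F q r = - F r.+1 q) ->
  \sum_(q < N.+1) \sum_(r < N) F q r = 0.
Proof.
move=> FE; under eq_bigr => q _ do
  rewrite (bigID (fun r : 'I_N => (q <= r)%N)) /=.
rewrite big_split /= big_ord_recr /= [X in _ + X + _]big1 => [|r]; last first.
  by rewrite leqNgt ltn_ord.
rewrite addr0 [X in _ + X]big_ord_recl /= [X in _ + (X + _)]big1 // add0r.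
rewrite (exchange_big_dep xpredT) //= -big_split big1 //= => r _.
apply/eqP; rewrite addr_eq0 -sumrN; apply/eqP/eq_big => [q|q /FE -> //].
by rewrite /bump add1n -ltnNge ltnS.
Qed.

Section Chains.
Variables (R : comNzRingType) (V : finType).

Definition rpath (n : nat) :=
  {s : seq V | (size s == n.+1) && regular_seq s}.

Definition rchain (n : nat) : lmodType R := {freeg (rpath n) / R}.

(** e_s, read as 0 when s is not a regular n-path *)
Definition rgen (n : nat) (s : seq V) : rchain n :=
  if insub s is Some t then fgen (t : rpath n) else 0.

Lemma rgen_val n (t : rpath n) : rgen n (val t) = fgen t.
Proof. by rewrite /rgen valK. Qed.

Lemma rgen_irregular n (s : seq V) : ~~ regular_seq s -> rgen n s = 0.
Proof. by move=> rs; rewrite /rgen insubF // (negbTE rs) andbF. Qed.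

Definition bd_gen (n : nat) (s : seq V) : rchain n.-1 :=
  if n is 0 then 0 else \sum_(q < n.+1) (-1) ^+ q *: rgen n.-1 (del q s).

Definition bd (n : nat) : {linear rchain n -> rchain n.-1} :=
  free_lift (fun t : rpath n => bd_gen n (val t)).

Lemma bd0 x : bd 0 x = 0.
Proof.
by move: x; apply: (@free_ext _ _ _ (bd 0) \0) => t; rewrite free_liftE.
Qed.

Lemma bd_gen_irregular n (s : seq V) :
  size s = n.+1 -> ~~ regular_seq s -> bd_gen n s = 0.
Proof.
case: n => // n ss /regularPn[u [x [w es]]]; rewrite /bd_gen.
have ltu : (size u < n.+2)%N.
  by rewrite -ss es size_cat /= -addSnnS ltn_addr.
have ltu1 : ((size u).+1 < n.+2)%N.
  by rewrite -ss es size_cat /= !addnS !ltnS leq_addr.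
rewrite (bigD1 (Ordinal ltu)) //= (bigD1 (Ordinal ltu1)) /=; last first.
  by rewrite -val_eqE /= gtn_eqF.
have du : del (size u) s = u ++ x :: w by rewrite es -[X in del X]addn0 del_catr del_cons0.
have du1 : del (size u).+1 s = u ++ x :: w.
  by rewrite es -addn1 del_catr del_consS del_cons0.
rewrite du du1 exprS mulN1r scaleNr addrA subrr add0r big1 // => q.
rewrite -!val_eqE /= => /andP[qu qu1]; rewrite rgen_irregular ?scaler0 //.
have [ltq|gtq|eqq] := ltngtP q (size u); last by rewrite eqq eqxx in qu.
  by rewrite es del_catl // regular_catxx.
have {}gtq : ((size u).+2 <= q)%N by rewrite ltn_neqAle eq_sym qu1.
have -> : nat_of_ord q = (size u + (q - (size u).+2).+2)%N.
  by rewrite !addnS -!addSn subnKC.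
by rewrite es del_catr !del_consS regular_catxx.
Qed.

Lemma bd_rgen n (s : seq V) : size s = n.+1 -> bd n (rgen n s) = bd_gen n s.
Proof.
move=> ss; case: (boolP (regular_seq s)) => rs; last first.
  by rewrite rgen_irregular // linear0 bd_gen_irregular.
have ps : (size s == n.+1) && regular_seq s by rewrite ss eqxx.
by rewrite (rgen_val (exist _ s ps)) free_liftE.
Qed.

Lemma bd_bd n x : bd n (bd n.+1 x) = 0.
Proof.
move: x; apply: (@free_ext _ _ _ (bd n \o bd n.+1) \0) => -[s /= ps].
have [/eqP ss rs] := andP ps; rewrite free_liftE linear_sum /=.
case: n s ps ss rs => [|n] s ps ss rs.
  by apply: big1 => q _; rewrite linearZ /= bd_rgen ?scaler0 // size_del ?ss.
under eq_bigr => q _.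
  rewrite linearZ /= bd_rgen ?size_del ?ss // /bd_gen scaler_sumr.
  under eq_bigr => r _ do rewrite scalerA -exprD.
  over.
pose F q r : rchain n := (-1) ^+ (q + r) *: rgen n (del r (del q s)).
have FE q r : (q <= r)%N -> F q r = - F r.+1 q.
  by move=> qr; rewrite /F del_del // addSn exprS mulN1r scaleNr opprK addnC.
exact: (alternating_sum0 n.+2 FE).
Qed.
End Chains.

Section PathHomology.
Variables (R : comNzRingType) (P : path_complex).

Definition allowed (n : nat) : {pred rchain R P n} :=
  spanp [set fgen t | t in [set t : rpath P n | pc_path P (val t)]].
Arguments allowed : clear implicits.
HB.instance Definition _ n := GRing.SubmodClosed.on (allowed n).

(** At n = 0 the condition on the boundary is void, as [bd 0] is zero. *)
Definition omega (n : nat) : {pred rchain R P n} :=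
  [pred p | (p \in allowed n) && (bd R P n p \in allowed n.-1)].

Arguments omega : clear implicits.

Lemma omega_closed n : submod_closed (omega n).
Proof.
split=> [|a x y].
  by apply/andP; rewrite linear0; split; apply: rpred0.
move=> /andP[x1 x2] /andP[y1 y2]; apply/andP.
by rewrite linearP; split; apply: rpredD => //; apply: rpredZ.
Qed.
HB.instance Definition _ n :=
  GRing.isSubmodClosed.Build R _ (omega n) (omega_closed n).

Lemma bd_omega n x : x \in omega n -> bd R P n x \in omega n.-1.
Proof.
case: n x => [|n] x /andP[x1 x2]; apply/andP; split=> //.
  by rewrite /= bd0 rpred0.
by rewrite /= bd_bd rpred0.
Qed.

Definition omega_d (n : nat) : {linear subm (omega n) -> subm (omega n.-1)} :=
  subm_map (@bd_omega n).

Lemma omega_d0 x : omega_d 0 x = 0.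
Proof. by apply: val_inj; rewrite /= bd0. Qed.

Lemma omega_dd n x : omega_d n (omega_d n.+1 x) = 0.
Proof. by apply: val_inj; rewrite /= bd_bd. Qed.

Definition omega_complex : chain_complex R :=
  @ChainComplex R (fun n => subm (omega n)) omega_d omega_d0 omega_dd.

Definition path_homology (n : nat) : lmodType R :=
  chain_homology omega_complex n.

End PathHomology.
Arguments allowed : clear implicits.
Arguments omega : clear implicits.
Arguments omega_d {R P} n.

(** A morphism of path complexes may collapse an allowed path to an irregular
    one, which then represents 0 in the regular chains. *)
Record pc_morphism (P Q : path_complex) := PCMorphism {
  pc_fun :> P -> Q;
  pc_funP : forall s, pc_path P s ->
    pc_path Q (map pc_fun s) \/ ~~ regular_seq (map pc_fun s) }.

Section InducedMap.
Variables (R : comNzRingType) (P Q : path_complex) (f : pc_morphism P Q).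

Definition rchain_map (n : nat) : {linear rchain R P n -> rchain R Q n} :=
  free_lift (fun t : rpath P n => rgen R n (map f (val t))).

Lemma rchain_map_rgen n s : rchain_map n (rgen R n s) = rgen R n (map f s).
Proof.
case: (boolP ((size s == n.+1) && regular_seq s)) => ps.
  by rewrite (rgen_val R (exist _ s ps)) free_liftE.
rewrite {1}/rgen insubN // linear0 /rgen insubN // size_map.
by apply: contra ps => /andP[-> /regular_map].
Qed.

Lemma rchain_map_bd n x :
  rchain_map n.-1 (bd R P n x) = bd R Q n (rchain_map n x).
Proof.
move: x; apply: (@free_ext _ _ _ (rchain_map n.-1 \o bd R P n)
                                 (bd R Q n \o rchain_map n)) => -[s ps] /=.
have [/eqP ss rs] := andP ps.
rewrite !free_liftE /= bd_rgen ?size_map //.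
case: n {ps} ss => [|n] ss; first by rewrite linear0.
rewrite /bd_gen linear_sum; apply: eq_bigr => q _.
by rewrite linearZ /= rchain_map_rgen map_del.
Qed.

Lemma rchain_map_allowed n x :
  x \in allowed R P n -> rchain_map n x \in allowed R Q n.
Proof.
move: x; apply: spanp_sub => _ [[s ps] /= Ps <-]; rewrite free_liftE /=.
have [Qfs|/rgen_irregular ->] := pc_funP f Ps; last exact: rpred0.
have [qs|qs] := boolP ((size (map f s) == n.+1) && regular_seq (map f s)).
  pose t : rpath Q n := Sub (map f s) qs.
  by rewrite (rgen_val R t); apply: mem_spanp; exists t.
by rewrite /rgen insubN // rpred0.
Qed.

Lemma rchain_map_omega n x : x \in omega R P n -> rchain_map n x \in omega R Q n.
Proof.
move=> /andP[x1 x2]; apply/andP; split; first exact: rchain_map_allowed.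
by rewrite /= -rchain_map_bd rchain_map_allowed.
Qed.

Definition omega_map (n : nat) :
    {linear subm (omega R P n) -> subm (omega R Q n)} :=
  subm_map (@rchain_map_omega n).

Lemma omega_map_d n x :
  omega_map n.-1 (omega_d n x) = omega_d n (omega_map n x).
Proof. by apply: val_inj; rewrite /= rchain_map_bd. Qed.

Definition omega_chain_map :
    chain_map (omega_complex R P) (omega_complex R Q) :=
  @ChainMap R (omega_complex R P) (omega_complex R Q) omega_map omega_map_d.

Definition path_homology_map (n : nat) :
    {linear path_homology R P n -> path_homology R Q n} :=
  chain_homology_map omega_chain_map n.

End InducedMap.

Definition unit_step : rel (nat * nat) :=
  [rel p q | (q == (p.1.+1, p.2)) || (q == (p.1, p.2.+1))].

(** [(0, 0) :: sigma] lists the vertices of a lattice path to [(m, n)]. *)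
Definition lattice_path (m n : nat) (sigma : seq (nat * nat)) : bool :=
  path unit_step (0, 0)%N sigma && (last (0, 0)%N sigma == (m, n)).

(** The path e_sigma for the paths [x :: s] and [y :: t]. *)
Definition stair (X Y : Type) (x : X) (s : seq X) (y : Y) (t : seq Y)
    (sigma : seq (nat * nat)) : seq (X * Y) :=
  [seq (nth x (x :: s) p.1, nth y (y :: t) p.2) | p <- (0, 0)%N :: sigma].

Lemma unit_step_le p sigma q : path unit_step p sigma -> q \in p :: sigma ->
  [&& p.1 <= q.1, q.1 <= (last p sigma).1, p.2 <= q.2 &
      q.2 <= (last p sigma).2]%N.
Proof.
elim: sigma p q => [|r sigma IH] p q /=.
  by rewrite inE => _ /eqP ->; rewrite !leqnn.
move=> /andP[pr prs]; have pler : (p.1 <= r.1)%N && (p.2 <= r.2)%N.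
  by case/orP: pr => /eqP -> /=; rewrite leqnn leqnSn.
case/andP: pler => pr1 pr2; rewrite inE => /orP[/eqP ->|qs]; last first.
  have /and4P[a b c d] := IH r q prs qs.
  by rewrite b d (leq_trans pr1 a) (leq_trans pr2 c).
have /and4P[_ b _ d] := IH r r prs (mem_head _ _).
by rewrite !leqnn (leq_trans pr1 b) (leq_trans pr2 d).
Qed.

Section Product.
Variables P Q : path_complex.

Definition prod_path : set (seq (P * Q)) :=
  [set w | exists x s y t sigma,
     [/\ pc_path P (x :: s), pc_path Q (y :: t),
         lattice_path (size s) (size t) sigma & w = stair x s y t sigma]].

Lemma prod_path_nil : ~ prod_path [::].
Proof. by move=> [x [s [y [t [sigma [_ _ _]]]]]]; rewrite /stair. Qed.

Lemma pc_head (K : path_complex) (x : K) s : pc_path K (x :: s) -> pc_path K [:: x].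
Proof. by elim/last_ind: s => // s y IH /pc_trunc[/IH]. Qed.

Lemma pc_behead (K : path_complex) (x y : K) s :
  pc_path K [:: x, y & s] -> pc_path K (y :: s).
Proof. by rewrite (lastI y s) => /pc_trunc[]. Qed.

Lemma pc_vertex (K : path_complex) : exists x : K, pc_path K [:: x].
Proof.
have [[|x s] Kx] := pc_neq0 K; first by have := pc_nil Kx.
by exists x; apply: pc_head Kx.
Qed.

Lemma prod_path_neq0 : prod_path !=set0.
Proof.
have [x Px] := pc_vertex P; have [y Qy] := pc_vertex Q.
by exists [:: (x, y)], x, [::], y, [::], [::].
Qed.

Lemma prod_path_trunc x s y : prod_path (x :: rcons s y) ->
  prod_path (x :: s) /\ prod_path (rcons s y).
Proof.
move=> [x0 [u [y0 [v [sigma [Pu Qv /andP[ps /eqP ls] ew]]]]]].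
case: ew => -> ew; split.
  case/lastP: sigma ps ls ew => [|sigma [m n]] ps ls ew; first by case: s ew.
  move: ew; rewrite map_rcons => /rcons_inj[-> _].
  move: ls ps; rewrite last_rcons rcons_path => -[-> ->] /andP[ps].
  have le := unit_step_le ps.
  case ls: (last _ _) le => [a b] le.
  case/orP => /eqP[sa sb].
    case/lastP: u sa Pu => // u z; rewrite size_rcons => -[sa] /pc_trunc[Pu _].
    exists x0, u, y0, v, sigma; split=> //.
      by rewrite /lattice_path ps ls sa sb eqxx.
    rewrite -[LHS]/(map _ ((0, 0)%N :: sigma)); apply/eq_in_map => q /le.
    case/and4P=> _ q1 _ _; congr (_, _).
    by rewrite -rcons_cons nth_rcons /= ltnS sa q1.
  case/lastP: v sb Qv => // v z; rewrite size_rcons => -[sb] /pc_trunc[Qv _].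
  exists x0, u, y0, v, sigma; split=> //.
    by rewrite /lattice_path ps ls sa sb eqxx.
  rewrite -[LHS]/(map _ ((0, 0)%N :: sigma)); apply/eq_in_map => q /le.
  case/and4P=> _ _ _ q2; congr (_, _).
  by rewrite -rcons_cons nth_rcons /= ltnS sb q2.
case: sigma ps ls ew => [|p sigma] ps ls ew; first by case: s ew.
rewrite ew; case/andP: ps => sp ps; have le := unit_step_le ps.
rewrite [last _ _]/= in ls; rewrite ls in le.
have shift (g : nat * nat -> nat * nat) :
    (forall q q', q \in p :: sigma -> unit_step q q' -> unit_step (g q) (g q')) ->
    path unit_step (g p) (map g sigma).
  move=> gP; elim: sigma p {ls le ew sp} ps gP => //= q sigma IH p.
  move=> /andP[pq ps] gP; rewrite gP ?mem_head //= IH // => r r' rs.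
  by apply: gP; rewrite inE rs orbT.
case/orP: sp => /eqP ep.
  have p1 q : q \in p :: sigma -> (0 < q.1)%N.
    by move=> /le/and4P[]; rewrite ep.
  case: u Pu ls le ew => [|x1 u] Pu ls le ew.
    by have := le p (mem_head _ _); rewrite ep.
  pose g (q : nat * nat) := (q.1.-1, q.2).
  exists x1, u, y0, v, (map g sigma); split=> //; first exact: pc_behead Pu.
    apply/andP; split; last by rewrite (_ : (0, 0)%N = g p) ?ep// last_map -ep ls.
    rewrite (_ : (0, 0)%N = g p) ?ep// -ep; apply: shift => -[a b] q' /p1 /= a0.
    by case/orP => /eqP -> /=; rewrite /unit_step /= ?eqxx ?orbT// prednK ?eqxx.
  rewrite /stair (_ : (0, 0)%N = g p) ?ep// -ep -map_cons -map_comp.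
  apply/eq_in_map => q qs /=; congr (_, _).
  move: (p1 q qs) (le q qs) => q0 /and4P[_ /= q1 _ _].
  case: q q0 q1 {qs} => [[|a] b] //= _ q1.
  exact: set_nth_default.
have p2 q : q \in p :: sigma -> (0 < q.2)%N.
  by move=> /le/and4P[]; rewrite ep.
case: v Qv ls le ew => [|y1 v] Qv ls le ew.
  by have := le p (mem_head _ _); rewrite ep /= ?andbF.
pose g (q : nat * nat) := (q.1, q.2.-1).
exists x0, u, y1, v, (map g sigma); split=> //; first exact: pc_behead Qv.
  apply/andP; split; last by rewrite (_ : (0, 0)%N = g p) ?ep// last_map -ep ls.
  rewrite (_ : (0, 0)%N = g p) ?ep// -ep; apply: shift => -[a b] q' /p2 /= b0.
  by case/orP => /eqP -> /=; rewrite /unit_step /= ?eqxx ?orbT// prednK ?eqxx ?orbT.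
rewrite /stair (_ : (0, 0)%N = g p) ?ep// -ep -map_cons -map_comp.
apply/eq_in_map => q qs /=; congr (_, _).
move: (p2 q qs) (le q qs) => q0 /and4P[_ _ _ /= q2].
case: q q0 q2 {qs} => [a [|b]] //= _ q2.
exact: set_nth_default.
Qed.

Definition pc_prod : path_complex :=
  @PathComplex (P * Q)%type prod_path prod_path_nil prod_path_neq0
    prod_path_trunc.

End Product.

Lemma lattice_step1 p sigma k : path unit_step p sigma ->
  (p.1 <= k < (last p sigma).1)%N ->
  exists b u w, p :: sigma = u ++ [:: (k, b), (k.+1, b) & w].
Proof.
elim: sigma p => [|q sigma IH] p /=.
  by rewrite ltnNge => _ /andP[-> /negP].
move=> /andP[pq qs] /andP[pk kl]; have [qk|kq] := leqP q.1 k.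
  have [|b [u [w ->]]] := IH q qs; first by rewrite qk.
  by exists b, (p :: u), w.
case/orP: pq kq kl qs => /eqP -> /=; last by rewrite ltnNge pk.
rewrite ltnS => kp _ _; exists p.2, [::], sigma.
by case: p pk kp => a b /= ak ka; have -> : k = a by apply/anti_leq/andP.
Qed.

Lemma lattice_step2 p sigma k : path unit_step p sigma ->
  (p.2 <= k < (last p sigma).2)%N ->
  exists a u w, p :: sigma = u ++ [:: (a, k), (a, k.+1) & w].
Proof.
elim: sigma p => [|q sigma IH] p /=.
  by rewrite ltnNge => _ /andP[-> /negP].
move=> /andP[pq qs] /andP[pk kl]; have [qk|kq] := leqP q.2 k.
  have [|b [u [w ->]]] := IH q qs; first by rewrite qk.
  by exists b, (p :: u), w.
case/orP: pq kq kl qs => /eqP -> /=; first by rewrite ltnNge pk.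
rewrite ltnS => kp _ _; exists p.1, [::], sigma.
by case: p pk kp => a b /= ak ka; have -> : k = b by apply/anti_leq/andP.
Qed.

Lemma irregular_nth (V : eqType) (x : V) s : ~~ regular_seq (x :: s) ->
  exists2 k, (k < size s)%N & nth x (x :: s) k = nth x (x :: s) k.+1.
Proof.
move=> /regularPn[u [z [w es]]]; exists (size u).
  by rewrite -ltnS -[(size s).+1]/(size (x :: s)) es size_cat /= !addnS !ltnS leq_addr.
by rewrite es !nth_cat ltnn subnn ltnNge leqnSn /= subSnn.
Qed.

Lemma stair_irregular (X Y : eqType) (x : X) s (y : Y) t sigma :
  lattice_path (size s) (size t) sigma ->
  ~~ regular_seq (x :: s) || ~~ regular_seq (y :: t) ->
  ~~ regular_seq (stair x s y t sigma).
Proof.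
move=> /andP[ps /eqP ls] /orP[]/irregular_nth[k ks ek].
  have [|b [u [w es]]] := lattice_step1 (k := k) ps; first by rewrite ls.
  by rewrite /stair es map_cat !map_cons -[(k.+1, b).1]/k.+1 -ek regular_catxx.
have [|a [u [w es]]] := lattice_step2 (k := k) ps; first by rewrite ls.
by rewrite /stair es map_cat !map_cons -[(a, k.+1).2]/k.+1 -ek regular_catxx.
Qed.

Section ProductMap.
Variables (P Q P' Q' : path_complex) (f : pc_morphism P P') (g : pc_morphism Q Q').

Definition pc_prod_fun (z : pc_prod P Q) : pc_prod P' Q' := (f z.1, g z.2).

Lemma map_stair x s y t sigma : lattice_path (size s) (size t) sigma ->
  map pc_prod_fun (stair x s y t sigma) =
  stair (f x) (map f s) (g y) (map g t) sigma.
Proof.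
move=> /andP[ps /eqP ls]; rewrite /stair -map_comp; apply/eq_in_map => q.
move=> /(unit_step_le ps); rewrite ls => /and4P[_ q1 _ q2].
by rewrite /= /pc_prod_fun /= -!map_cons !(nth_map x, nth_map y).
Qed.

Lemma pc_prod_funP w : pc_path (pc_prod P Q) w ->
  pc_path (pc_prod P' Q') (map pc_prod_fun w) \/
  ~~ regular_seq (map pc_prod_fun w).
Proof.
move=> [x [s [y [t [sigma [Ps Qt lst ->]]]]]]; rewrite map_stair //.
have lst' : lattice_path (size (map f s)) (size (map g t)) sigma.
  by rewrite !size_map.
have [Pfs|fs] := pc_funP f Ps; last first.
  by right; apply: stair_irregular => //; rewrite fs.
have [Qgt|gt] := pc_funP g Qt; last first.
  by right; apply: stair_irregular => //; rewrite gt orbT.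
by left; exists (f x), (map f s), (g y), (map g t), sigma.
Qed.

Definition pc_prod_map : pc_morphism (pc_prod P Q) (pc_prod P' Q') :=
  PCMorphism pc_prod_funP.

End ProductMap.

Section Kuenneth.
Variable R : comNzRingType.

Definition kuenneth_tensor (X Y : path_complex) (n : nat) : lmodType R :=
  dsum (fun i : 'I_n.+1 =>
    tensor (path_homology R X i) (path_homology R Y (n - i))).

Definition kuenneth_tor (X Y : path_complex) (n : nat) : lmodType R :=
  dsum (fun i : 'I_n =>
    tor1 (path_homology R X i) (path_homology R Y (n - i - 1))).

Section Maps.
Variables (X Y X' Y' : path_complex).
Variables (f : pc_morphism X X') (g : pc_morphism Y Y').

Definition kuenneth_tensor_map (n : nat) :
    {linear kuenneth_tensor X Y n -> kuenneth_tensor X' Y' n} :=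
  dsum_map (fun i : 'I_n.+1 =>
    tensor_map (path_homology_map R f i) (path_homology_map R g (n - i))).

Definition kuenneth_tor_map (n : nat) :
    {linear kuenneth_tor X Y n -> kuenneth_tor X' Y' n} :=
  dsum_map (fun i : 'I_n =>
    tor1_map (path_homology_map R f i) (path_homology_map R g (n - i - 1))).

End Maps.
End Kuenneth.

Definition split_short_exact (R : comNzRingType) (A B C : lmodType R)
    (a : {linear A -> B}) (b : {linear B -> C}) : Prop :=
  [/\ injective a,
      forall y, b y = 0 <-> exists x, a x = y,
      forall z, exists y, b y = z
    & exists s : {linear C -> B}, forall z, b (s z) = z].

(* Main.v *)
(** The cross product e_x x e_y is the signed sum of the stair paths e_sigma,
    i.e. the shuffle product, so the cross product satisfies the Leibniz rule.
    A boundary condition on w in Omega(X x Y) says that a path with one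
    diagonal step has coefficient 0 in dw; as only the two stair paths around
    that corner have it as a face, the coefficients of w alternate in sign under
    corner flips.  Hence w is determined by its coefficients on the L-shaped
    stairs (first horizontal, then vertical), which form a tensor c with
    w = cross c.  The remaining boundary conditions put each slot of c
    separately in Omega; over a principal ideal domain Omega is a direct
    summand of the regular chains, so c lies in Omega(X) (tensor) Omega(Y).

    The Kuenneth theorem for complexes of free modules is proved elementwise.
    With e an idempotent endomorphism of C having the cycles as kernel, psi the
    resulting extension of the class map to all chains and phi a comparison map
    from C_(i+1) to the resolution of H_i, the map to Tor sends a cycle w to the
    class of (phi (tensor) psi) w_(i+1,j), and psi (tensor) psi is a retraction
    of the map from the tensor product of the homologies. *)

Require Import Defs.
From HB Require Import structures.
From mathcomp Require Import all_boot all_order all_algebra.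
From mathcomp Require Import boolp classical_sets.
From mathcomp Require Import freeg.
From mathcomp Require Import zify.

Set Implicit Arguments.
Unset Strict Implicit.
Unset Printing Implicit Defensive.

Import GRing.Theory.
Local Open Scope ring_scope.

(** * Tensor products and free modules *)

(** Omega of a product is not a tensor product by construction, and a total complex would force
    transports between the degrees i + (n - i) and n. The product complex is therefore described
    from inside: maps [pr_mu] obeying the Leibniz rule, with components [pr_pi] that resum to the
    identity.

    Tor is fixed as homology of the functorial resolution, which is free on all elements of each
    kernel and so unrelated to the resolution of homology by boundaries and cycles. Comparison maps
    in both directions bridge the two.

    Splittings are chosen, hence not natural. The map from the tensor sum does not involve them; the
    map to Tor does. Errors caused by the choices vanish on the components of a cycle for one of two
    reasons: one factor passes through the boundary while the other kills boundaries
    ([pi_cycle_cross]), or both factors pass through [sp_e] ([pi_cycle_ee]).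

    Membership conditions are encoded as kernels of linear maps, so that flatness of summands of
    finite free modules can treat the two slots of a tensor separately. The principal ideal domain
    enters only through [pid_splitting]. *)

Section FreeCoefficients.
Variable R : comNzRingType.

Definition fcoef (K : choiceType) (k : K) : {linear {freeg K / R} -> R^o} :=
  free_lift (fun y => (y == k)%:R : R^o).

Lemma fcoef_gen (K : choiceType) (k l : K) :
  fcoef k (fgen l) = (l == k)%:R :> R.
Proof. by rewrite /fcoef free_liftE. Qed.

Lemma fcoef_ext (K : choiceType) (D E : {freeg K / R}) :
  (forall k, fcoef k D = fcoef k E) -> D = E.
Proof. by move=> DE; apply/eqP/freeg_eqP => k; apply: DE. Qed.

Lemma free_sumE (K : finType) (D : {freeg K / R}) :
  D = \sum_k (fcoef k D : R) *: fgen k.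
Proof.
apply: fcoef_ext => k; rewrite linear_sum (bigD1 k) //= linearZ /= fcoef_gen eqxx.
rewrite big1 ?addr0 => [|l lk]; last by rewrite linearZ /= fcoef_gen (negPf lk) scaler0.
by rewrite [RHS]mulr1.
Qed.

Lemma free_lifting (K : choiceType) (A B : lmodType R) (g : {linear A -> B})
    (f : {linear {freeg K / R} -> B}) :
  (forall k, exists a, g a = f (fgen k)) ->
  exists h : {linear {freeg K / R} -> A}, forall x, g (h x) = f x.
Proof.
move=> gf; exists (free_lift (fun k => projT1 (cid (gf k)))).
apply: (@free_ext _ _ _ (g \o free_lift _) f) => k /=.
by rewrite free_liftE; case: (cid _).
Qed.

End FreeCoefficients.

Arguments fcoef {R K} k.

Section TensorTheory.
Variable R : comNzRingType.
Implicit Types M N P : lmodType R.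

Section Lift.
Variables (M N P : lmodType R) (f : M -> N -> P).
Hypotheses (fl : forall y, linear (f^~ y)) (fr : forall x, linear (f x)).

Lemma tensor_liftP r : r \in spanp (@tensor_rel R M N) ->
  free_lift (fun p : M * N => f p.1 p.2) r = 0.
Proof.
apply: spanp_ker => {}r [[a [x [x' [y ->]]]]|[a [x [y [y' ->]]]]];
  rewrite linearB linearP !free_liftE /=.
  by rewrite fl subrr.
by rewrite fr subrr.
Qed.

Definition tensor_lift_ of (forall y, linear (f^~ y)) & (forall x, linear (f x)) :
  {linear tensor M N -> P} := qlift tensor_liftP.
Definition tensor_lift := tensor_lift_ fl fr.

Lemma tensor_liftE x y : tensor_lift (tpure x y) = f x y.
Proof. by apply: etrans (qliftE _ _) _; rewrite free_liftE. Qed.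
End Lift.

(** Serves where the claim is not an equality of two linear maps, so that [tensor_ext] does not
    apply. *)
Lemma tensor_ind M N (Q : tensor M N -> Prop) :
  Q 0 -> (forall x y, Q (tpure x y)) ->
  (forall a u v, Q u -> Q v -> Q (a *: u + v)) -> forall x, Q x.
Proof.
move=> Q0 Qp Ql x; rewrite -[x]qreprK; move: (qrepr x) => D.
rewrite -[D]freeg_sumE; elim: (dom D) => [|k s IH].
  by rewrite big_nil linear0.
rewrite big_cons linearD /=.
suff -> : << coeff k D *g k >> = coeff k D *: fgen k.
  by rewrite linearZ; apply: Ql => //; case: k => x1 y1; apply: Qp.
by apply/eqP/freeg_eqP => y; rewrite coeffZ !coeffU mul1r.
Qed.

Lemma tpure0l M N (y : N) : tpure (0 : M) y = 0.
Proof. by have := tpure_linearl y (-1) (0 : M) 0; rewrite scaler0 addr0 scaleN1r addNr => ->. Qed.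

Lemma tpure0r M N (x : M) : tpure x (0 : N) = 0.
Proof. by have := tpure_linearr x (-1) (0 : N) 0; rewrite scaler0 addr0 scaleN1r addNr => ->. Qed.

Lemma tpureD M N (x : M) (y y' : N) : tpure x (y + y') = tpure x y + tpure x y'.
Proof. by have := tpure_linearr x 1 y y'; rewrite !scale1r. Qed.

Lemma tpureDl M N (x x' : M) (y : N) : tpure (x + x') y = tpure x y + tpure x' y.
Proof. by have := tpure_linearl y 1 x x'; rewrite !scale1r. Qed.

Lemma tpureZ M N a (x : M) (y : N) : tpure x (a *: y) = a *: tpure x y.
Proof. by have := tpure_linearr x a y 0; rewrite !addr0 tpure0r addr0. Qed.

Lemma tpureZl M N a (x : M) (y : N) : tpure (a *: x) y = a *: tpure x y.
Proof. by have := tpure_linearl y a x 0; rewrite !addr0 tpure0l addr0. Qed.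

Section Map.
Variables (M N M' N' M'' N'' : lmodType R).

(** The composites enter as [F] and [G] up to pointwise equality: a vanishing composite can be named
    [\0], and read backwards the lemma factors a map, all without extensionality of linear maps. *)
Lemma tensor_map_comp (f : {linear M -> M'}) (g : {linear N -> N'})
   (f' : {linear M' -> M''}) (g' : {linear N' -> N''})
   (F : {linear M -> M''}) (G : {linear N -> N''}) x :
  (forall c, f' (f c) = F c) -> (forall c, g' (g c) = G c) ->
  tensor_map f' g' (tensor_map f g x) = tensor_map F G x.
Proof.
move=> fF gG; move: x.
apply: (@tensor_ext _ _ _ _ (tensor_map f' g' \o tensor_map f g)) => x y.
by rewrite -[LHS]/(tensor_map _ _ (tensor_map _ _ _)) !tensor_mapE fF gG.
Qed.

Lemma tensor_map_id (f : {linear M -> M}) (g : {linear N -> N}) x :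
  f =1 id -> g =1 id -> tensor_map f g x = x.
Proof.
move=> fi gi; move: x.
apply: (@tensor_ext _ _ _ _ (tensor_map f g) idfun) => x y.
by rewrite tensor_mapE fi gi.
Qed.

Lemma tensor_mapDl (f f1 f2 : {linear M -> M'}) (g : {linear N -> N'}) x :
  (forall c, f c = f1 c + f2 c) ->
  tensor_map f g x = tensor_map f1 g x + tensor_map f2 g x.
Proof.
move=> fD; move: x.
apply: (@tensor_ext _ _ _ _ (tensor_map f g) (tensor_map f1 g \+ tensor_map f2 g)).
move=> x y; rewrite -[RHS]/(tensor_map f1 g _ + tensor_map f2 g _).
by rewrite !tensor_mapE fD tpureDl.
Qed.

Lemma tensor_mapDr (f : {linear M -> M'}) (g g1 g2 : {linear N -> N'}) x :
  (forall c, g c = g1 c + g2 c) ->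
  tensor_map f g x = tensor_map f g1 x + tensor_map f g2 x.
Proof.
move=> fD; move: x.
apply: (@tensor_ext _ _ _ _ (tensor_map f g) (tensor_map f g1 \+ tensor_map f g2)).
move=> x y; rewrite -[RHS]/(tensor_map f g1 _ + tensor_map f g2 _).
by rewrite !tensor_mapE fD tpureD.
Qed.

Lemma tensor_map0l (f : {linear M -> M'}) (g : {linear N -> N'}) x :
  (forall c, f c = 0) -> tensor_map f g x = 0.
Proof.
move=> f0; move: x; apply: (@tensor_ext _ _ _ _ (tensor_map f g) \0) => x y.
by rewrite tensor_mapE f0 tpure0l.
Qed.

Lemma tensor_map0r (f : {linear M -> M'}) (g : {linear N -> N'}) x :
  (forall c, g c = 0) -> tensor_map f g x = 0.
Proof.
move=> f0; move: x; apply: (@tensor_ext _ _ _ _ (tensor_map f g) \0) => x y.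
by rewrite tensor_mapE f0 tpure0r.
Qed.
End Map.

Lemma tensor_map_surj (M N N' : lmodType R) (g : {linear N -> N'}) :
  (forall y, exists x, g x = y) ->
  forall t : tensor M N', exists u, tensor_map idfun g u = t.
Proof.
move=> gs; apply: tensor_ind => [|x y|a _ _ [u <-] [v <-]].
- by exists 0; rewrite linear0.
- by have [z <-] := gs y; exists (tpure x z); rewrite tensor_mapE.
- by exists (a *: u + v); rewrite linearP.
Qed.

(** Right exactness with a twist [q]. In the applications [g] is the class map extended to all
    chains; an element of its kernel need not be a boundary, but its projection to the cycles is. *)
Lemma tensor_right_exact (M A B B' N : lmodType R) (f : {linear A -> B'}) (q : {linear B -> B'})
    (g : {linear B -> N}) :
  (forall y, exists b, g b = y) -> (forall b, g b = 0 -> exists a, f a = q b) ->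
  forall x : tensor M B, tensor_map idfun g x = 0 ->
  exists u : tensor M A, tensor_map idfun f u = tensor_map idfun q x.
Proof.
move=> gs gf x gx.
pose S := imgp (tensor_map (idfun : {linear M -> M}) f).
(* A section of sets suffices: modulo the image [S] the tensor of [m] with [q (sec n)] does not
   depend on the choice of preimage, hence is bilinear in [m] and [n]. *)
pose sec y := projT1 (cid (gs y)).
have secK y : g (sec y) = y by rewrite /sec; case: cid.
have wd m b b' : g b = g b' -> qpi S (tpure m (q b)) = qpi S (tpure m (q b')).
  move=> gb; apply/qpi_eq; have [a fa] : exists a, f a = q (b - b').
    by apply: gf; rewrite linearB gb subrr.
  apply/imgpP; exists (tpure m a); rewrite tensor_mapE fa linearB.
  by rewrite -[- q b']scaleN1r tpureD tpureZ scaleN1r.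
pose F m n : qmod S := qpi S (tpure m (q (sec n))).
have Fl n : linear (F^~ n) by move=> a m m'; rewrite /F tpureDl tpureZl linearP.
have Fr m : linear (F m).
  move=> a n n'; have <- : qpi S (tpure m (q (a *: sec n + sec n'))) =
    a *: F m n + F m n' by rewrite linearP tpureD tpureZ linearP.
  apply: wd.
  by rewrite linearP !secK.
have FE t : tensor_lift Fl Fr (tensor_map idfun g t) = qpi S (tensor_map idfun q t).
  move: t; apply: (@tensor_ext _ _ _ _ (tensor_lift Fl Fr \o tensor_map idfun g)
     (qpi S \o tensor_map idfun q)) => m b.
  rewrite -[LHS]/(tensor_lift Fl Fr (tensor_map idfun g _)).
  rewrite -[RHS]/(qpi S (tensor_map idfun q _)) !tensor_mapE tensor_liftE.
  by apply: wd; rewrite secK.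
have := FE x; rewrite gx linear0 -(linear0 (qpi S)) => /esym/qpi_eq.
by rewrite subr0 => /imgpP.
Qed.

(** Finitely generated projective modules, given by the data from which lifting and flatness are
    read off. *)
Definition finite_retract (M : lmodType R) := exists (K : finType)
  (i : {linear M -> {freeg K / R}}) (r : {linear {freeg K / R} -> M}),
  forall x, r (i x) = x.

Lemma finite_retract_proj (M A B : lmodType R) (g : {linear A -> B}) (f : {linear M -> B}) :
  finite_retract M -> (forall x, exists a, g a = f x) ->
  exists h : {linear M -> A}, forall x, g (h x) = f x.
Proof.
move=> [K [i [r ri]]] gf.
have [|h hP] := @free_lifting _ K _ _ g (f \o r); first by move=> k; apply: gf.
by exists (h \o i) => x /=; rewrite hP /= ri.
Qed.

(** The coordinate maps {freeg K / R} (tensor) N -> N reduce the claim to N. *)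
Lemma finite_retract_flat (M N N1 N2 : lmodType R) (g1 : {linear N -> N1}) (g2 : {linear N -> N2}) :
  finite_retract M -> (forall y, g1 y = 0 -> g2 y = 0) ->
  forall x : tensor M N, tensor_map idfun g1 x = 0 -> tensor_map idfun g2 x = 0.
Proof.
move=> [K [i [r ri]]] g12 x x0.
pose k0 (L : lmodType R) (k : K) (D : {freeg K / R}) (y : L) : L := (fcoef k D : R) *: y.
have k0l L k y : linear ((k0 L k)^~ y).
  by move=> a D D'; rewrite /k0 linearP scalerDl scalerA.
have k0r L k D : linear (k0 L k D).
  by move=> a y y'; rewrite /k0 scalerDr !scalerA mulrC.
pose kk L k := tensor_lift (k0l L k) (k0r L k).
have kkE L k D y : kk L k (tpure D y) = (fcoef k D : R) *: y by exact: tensor_liftE.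
have kkn (L L' : lmodType R) (g : {linear L -> L'}) k t :
    kk L' k (tensor_map idfun g t) = g (kk L k t).
  move: t; apply: (@tensor_ext _ _ _ _ (kk L' k \o tensor_map idfun g)
    (g \o kk L k)) => D y.
  rewrite -[LHS]/(kk L' k (tensor_map idfun g _)) -[RHS]/(g (kk L k _)).
  by rewrite tensor_mapE !kkE linearZ.
have kks (L : lmodType R) (t : tensor {freeg K / R} L) : t = \sum_k tpure (fgen k) (kk L k t).
  elim/tensor_ind: t => [|D y|a u v {1}-> {1}->].
  - by rewrite big1 // => k _; rewrite linear0 tpure0r.
  - rewrite {1}[D]free_sumE; under [RHS]eq_bigr => k _ do rewrite kkE tpureZ -tpureZl.
    by apply: (big_morph (fun D => tpure D y)) => [D1 D2|]; rewrite ?tpureDl ?tpure0l.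
  - rewrite scaler_sumr -big_split; apply: eq_bigr => k _.
    by rewrite linearP tpureD tpureZ.
pose y := tensor_map i (idfun : {linear N -> N}) x.
have y0 : tensor_map idfun g2 y = 0.
  rewrite [LHS]kks big1 // => k _; rewrite kkn g12 ?tpure0r // -kkn.
  rewrite (tensor_map_comp (F := i) (G := g1)) //.
  rewrite -(tensor_map_comp (f := idfun : {linear M -> M}) (g := g1) (f' := i)
    (g' := idfun : {linear N1 -> N1})) //.
  by rewrite x0 !linear0.
have := congr1 (tensor_map r (idfun : {linear N2 -> N2})) y0; rewrite linear0 => <-.
rewrite (tensor_map_comp (F := idfun \o i) (G := g2)) //.
by rewrite (tensor_map_comp (F := idfun : {linear M -> M}) (G := g2)) //= => c; apply: ri.
Qed.

End TensorTheory.

(** * Splittings over a principal ideal domain *)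

Section PrincipalIdealDomain.
Variables (R : idomainType) (hR : principal_ideal_domain R).

(** The image of [g] is an ideal generated by some [a]; dividing [g u] by [a] and multiplying a
    fixed preimage [u0] of [a] gives [e]. *)
Lemma pid_functional_splitting (U : lmodType R) (g : {linear U -> R^o}) :
  exists e : {linear U -> U},
    (forall u, g (e u) = g u) /\ (forall u, g u = 0 -> e u = 0).
Proof.
have [|a x y [u <-] [v <-]|a Ia] := hR (I := [set r : R | exists u, g u = r]%classic).
- by exists 0; rewrite linear0.
- by exists (a *: u + v); rewrite linearP.
have gI u : exists b : R, g u = b * a.
  have : [set r : R | exists u, g u = r]%classic (g u) by exists u.
  by rewrite Ia => -[b _ <-]; exists b.
have [u0 gu0] : exists u, g u = a.
  suff : [set r : R | exists u, g u = r]%classic a by [].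
  by rewrite Ia; exists 1 => //; rewrite mul1r.
(* A zero generator cannot be cancelled, but then [g] vanishes and [e] can be zero. *)
have [a0|a0] := eqVneq a 0.
  exists \0; split=> u //=; rewrite linear0.
  by have [b ->] := gI u; rewrite a0 mulr0.
pose c u := projT1 (cid (gI u)).
have cP u : g u = c u * a by rewrite /c; case: cid.
have cL : linear (fun u => c u *: u0).
  move=> k u v; rewrite scalerA -scalerDl; congr (_ *: _).
  by apply: (mulIf a0); rewrite mulrDl -mulrA -!cP linearP.
pose e : {linear U -> U} :=
  HB.pack (fun u => c u *: u0) (GRing.isLinear.Build R U U *:%R _ cL).
exists e; split=> u; rewrite -[e u]/(c u *: u0).
  by rewrite linearZ gu0 cP.
rewrite cP => /eqP; rewrite mulf_eq0 (negPf a0) orbF => /eqP ->.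
by rewrite scale0r.
Qed.

(** A submodule of a finite free module is projective, so that a map into
    such a module splits onto its image. *)
Lemma pid_splitting (U : lmodType R) (K : finType) (f : {linear U -> {freeg K / R}}) :
  exists e : {linear U -> U},
    (forall u, f (e u) = f u) /\ (forall u, f u = 0 -> e u = 0).
Proof.
suff [e [e1 e2]] : exists e : {linear U -> U},
    (forall k, k \in enum K -> forall u, fcoef k (f (e u)) = fcoef k (f u)) /\
    (forall u, (forall k, k \in enum K -> fcoef k (f u) = 0) -> e u = 0).
  exists e; split=> u; first by apply: fcoef_ext => k; rewrite e1 ?mem_enum.
  by move=> u0; apply: e2 => k _; rewrite u0 linear0.
elim: (enum K) => [|k s [e [e1 e2]]]; first by exists \0; split.
pose p : {linear U -> U} := idfun \- e.
have pE u : p u = u - e u by [].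
have [e' [e'1 e'2]] := pid_functional_splitting (fcoef k \o f \o p).
(* The coordinates treated so far vanish on the image of [p], so the correction [p \o e'] repairs
   coordinate [k] without disturbing them. *)
pose e1' : {linear U -> U} := e \+ (p \o e').
have e1'E u : e1' u = e u + p (e' u) by [].
exists e1'; split=> [l|u u0]; rewrite ?e1'E; last first.
  have eu : e u = 0 by apply: e2 => l ls; apply: u0; rewrite inE ls orbT.
  rewrite eu add0r e'2 ?linear0 //=.
  by rewrite eu subr0 u0 ?mem_head.
rewrite inE => /predU1P[->|ls] u; rewrite e1'E.
  have ek : fcoef k (f (p (e' u))) = fcoef k (f (p u)) := e'1 u.
  by rewrite 2!linearD ek pE 2!linearB addrC subrK.
by rewrite 2!linearD pE 2!linearB !e1 // subrr addr0.
Qed.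

End PrincipalIdealDomain.

(** * Exactness of the functorial resolution and homology classes *)

Section ResolutionTheory.
Variable R : comNzRingType.

Lemma res_augE (M : lmodType R) (m : M) : res_aug M (fgen m) = m.
Proof. exact: free_liftE. Qed.

Lemma res_aug_exact (M : lmodType R) x :
  res_aug M x = 0 -> exists y, res_d1 M y = x.
Proof.
move=> /eqP x0; exists (fgen (Sub x x0 : subm (kerp (res_aug M)))).
by rewrite free_liftE.
Qed.

Lemma res_d1_exact (M : lmodType R) x :
  res_d1 M x = 0 -> exists y, res_d2 M y = x.
Proof.
move=> /eqP x0; exists (fgen (Sub x x0 : subm (kerp (res_d1 M)))).
by rewrite free_liftE.
Qed.

Lemma res_aug_d1 (M : lmodType R) x : res_aug M (res_d1 M x) = 0.
Proof.
move: x; apply: (@free_ext _ _ _ (res_aug M \o res_d1 M) \0) => k /=.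
by rewrite free_liftE; apply/eqP/(valP k).
Qed.

Lemma res_d1_d2 (M : lmodType R) x : res_d1 M (res_d2 M x) = 0.
Proof.
move: x; apply: (@free_ext _ _ _ (res_d1 M \o res_d2 M) \0) => k /=.
by rewrite free_liftE; apply/eqP/(valP k).
Qed.

End ResolutionTheory.

Section HomologyTheory.
Variables (R : comNzRingType) (A B C : lmodType R).
Variables (f : {linear A -> B}) (g : {linear B -> C}).

(** A cycle is carried as a chain together with an equation, which keeps the kernel subtype out of
    later statements. *)
Definition cyc (x : B) (gx : g x = 0) : subm (kerp g) := Sub x (introT eqP gx).

Lemma homology_ind (Q : homology f g -> Prop) :
  (forall x (gx : g x = 0), Q (hclass f g (cyc gx))) -> forall h, Q h.
Proof.
move=> Qx h; rewrite -[h]qreprK; have /eqP gx := valP (qrepr h).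
by have := Qx _ gx; congr (Q (qpi _ _)); apply: val_inj.
Qed.

Lemma hclass_eq0 z : hclass f g z = 0 <-> exists a, f a = val z.
Proof.
rewrite -(linear0 (hclass f g)) qpi_eq subr0; split=> [/imgpP|] //.
by move=> fz; apply/imgpP.
Qed.

End HomologyTheory.

(** From a preimage y of z, the element y - a (r y) is the unique preimage killed by [r]; uniqueness
    makes this section linear although the preimages are chosen arbitrarily. *)
Lemma split_short_exactP (R : comNzRingType) (A B C : lmodType R)
    (a : {linear A -> B}) (b : {linear B -> C}) (r : {linear B -> A}) :
  (forall x, r (a x) = x) -> (forall y, b y = 0 <-> exists x, a x = y) ->
  (forall z, exists y, b y = z) -> split_short_exact a b.
Proof.
move=> ra ex bs; split=> //; first exact: can_inj ra.
pose s z := projT1 (cid (bs z)) - a (r (projT1 (cid (bs z)))).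
have bs_ z : b (s z) = z.
  rewrite /s; case: cid => y /= by_; rewrite linearB by_.
  have /ex -> : exists x, a x = a (r y) by exists (r y).
  by rewrite subr0.
have rs z : r (s z) = 0 by rewrite /s linearB ra subrr.
have sL : linear s.
  move=> k u v; apply/subr0_eq.
  have /ex[x ax] : b (s (k *: u + v) - (k *: s u + s v)) = 0.
    by rewrite linearB linearP !bs_ subrr.
  rewrite -ax; suff -> : x = 0 by rewrite linear0.
  by rewrite -[x]ra ax linearB linearP !rs scaler0 addr0 subrr.
pose sl : {linear C -> B} := HB.pack s (GRing.isLinear.Build R C B *:%R _ sL).
by exists sl.
Qed.

(** * The Kuenneth theorem for chain complexes *)

Section HomologyMapTheory.
Variables (R : comNzRingType) (A B C A' B' C' : lmodType R).
Variables (f : {linear A -> B}) (g : {linear B -> C}).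
Variables (f' : {linear A' -> B'}) (g' : {linear B' -> C'}).
Variables (a : {linear A -> A'}) (b : {linear B -> B'}) (c : {linear C -> C'}).
Hypothesis abf : forall x, b (f x) = f' (a x).
Hypothesis bcg : forall x, c (g x) = g' (b x).

Lemma homology_map_cyc x (gx : g x = 0) (gbx : g' (b x) = 0) :
  homology_map abf bcg (hclass f g (cyc gx)) = hclass f' g' (cyc gbx).
Proof. by rewrite homology_mapE; congr (hclass _ _ _); apply: val_inj. Qed.
End HomologyMapTheory.

Section HclassLinear.
Variables (R : comNzRingType) (A B C : lmodType R).
Variables (f : {linear A -> B}) (g : {linear B -> C}).

Lemma hclass_eq x y (gx : g x = 0) (gy : g y = 0) :
  (exists a, f a = x - y) -> hclass f g (cyc gx) = hclass f g (cyc gy).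
Proof. by move=> fa; apply/subr0_eq; rewrite -linearB; apply/hclass_eq0. Qed.

Lemma hclass_lin k x y (gx : g x = 0) (gy : g y = 0) (gz : g (k *: x + y) = 0) :
  hclass f g (cyc gz) = k *: hclass f g (cyc gx) + hclass f g (cyc gy).
Proof. by rewrite -linearP; congr (hclass _ _ _); apply: val_inj. Qed.

End HclassLinear.

Section Splitting.
Variable R : comNzRingType.

(** [sp_e] is idempotent with kernel the cycles, and ([sp_phi], [sp_lam]) is a
    comparison map from C_(i+1) -> C_i to the functorial resolution of H_i. *)
Record splitting (C : chain_complex R) := Splitting {
  sp_e : forall i, {linear C i -> C i};
  sp_psi : forall i, {linear C i -> chain_homology C i};
  sp_lam : forall i, {linear C i -> res0 (chain_homology C i)};
  sp_phi : forall i, {linear C i.+1 -> res1 (chain_homology C i)};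
  sp_de : forall i c, chain_d C i (sp_e i c) = chain_d C i c;
  sp_e0 : forall i c, chain_d C i c = 0 -> sp_e i c = 0;
  sp_psiE : forall i c (dc : chain_d C i c = 0), sp_psi i c = hclass _ _ (cyc dc);
  sp_psi_e : forall i c, sp_psi i (sp_e i c) = 0;
  sp_lamP : forall i c, res_aug _ (sp_lam i c) = sp_psi i c;
  sp_phiP : forall i c, res_d1 _ (sp_phi i c) = sp_lam i (chain_d C i.+1 c);
  sp_phi_e : forall i c, sp_phi i (sp_e i.+1 c) = sp_phi i c }.

Section Theory.
Variables (C : chain_complex R) (s : splitting C).

(** The projection onto the cycles along the image of [sp_e]. *)
Definition sp_q i : {linear C i -> C i} := idfun \- sp_e s i.

Lemma sp_qE i c : sp_q i c = c - sp_e s i c. Proof. by []. Qed.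

Lemma sp_dq i c : chain_d C i (sp_q i c) = 0.
Proof. by rewrite sp_qE linearB sp_de subrr. Qed.

Lemma sp_q_cycle i c : chain_d C i c = 0 -> sp_q i c = c.
Proof. by move=> /(sp_e0 s); rewrite sp_qE => ->; rewrite subr0. Qed.

Lemma chain_dd' n x : chain_d C n.-1 (chain_d C n x) = 0.
Proof. by case: n x => [|n] x; rewrite ?chain_dd ?chain_d0. Qed.

Lemma sp_ed n c : sp_e s n.-1 (chain_d C n c) = 0.
Proof. by rewrite sp_e0 // chain_dd'. Qed.

Lemma sp_psi_d i c : sp_psi s i (chain_d C i.+1 c) = 0.
Proof. by rewrite (sp_psiE s (chain_dd c)); apply/hclass_eq0; exists c. Qed.

Lemma sp_psi_q i c : sp_psi s i (sp_q i c) = sp_psi s i c.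
Proof. by rewrite sp_qE linearB sp_psi_e subr0. Qed.

Lemma sp_psi_surj i h : exists c, sp_psi s i c = h.
Proof.
elim/homology_ind: h => c dc; exists c; exact: sp_psiE.
Qed.

Lemma sp_psi_eq0 i c : sp_psi s i c = 0 -> exists b, chain_d C i.+1 b = sp_q i c.
Proof. by rewrite -sp_psi_q (sp_psiE s (sp_dq c)) hclass_eq0. Qed.

Lemma sp_phi_cycle i c : chain_d C i.+1 c = 0 -> sp_phi s i c = 0.
Proof. by move=> dc; rewrite -sp_phi_e sp_e0 // linear0. Qed.

Lemma sp_e_idem i c : sp_e s i (sp_e s i c) = sp_e s i c.
Proof.
by apply/subr0_eq; rewrite -linearB; apply: sp_e0; rewrite linearB sp_de subrr.
Qed.

End Theory.
End Splitting.

(** Only [e] needs the principal ideal domain. The maps [lam] and [phi] are lifts by projectivity,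
    the second one existing because [psi] vanishes on boundaries. *)
Lemma splitting_exists (R : idomainType) (C : chain_complex R) :
  principal_ideal_domain R -> (forall i, finite_retract (C i)) ->
  inhabited (splitting C).
Proof.
move=> hR fC.
have /cid[e eP] : exists e : forall i, {linear C i -> C i}, forall i,
    (forall c, chain_d C i (e i c) = chain_d C i c) /\
    (forall c, chain_d C i c = 0 -> e i c = 0).
  suff eP i : exists e : {linear C i -> C i},
      (forall c, chain_d C i (e c) = chain_d C i c) /\
      (forall c, chain_d C i c = 0 -> e c = 0).
    by exists (fun i => sval (cid (eP i))) => i; apply: (svalP (cid (eP i))).
  have [K [f [r rf]]] := fC i.-1.
  (* Since [f] has the retraction [r] it is injective, and splitting [f \o chain_d C i] splits the
     boundary itself. *)
  have [e [e1 e2]] := pid_splitting hR (f \o chain_d C i).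
  exists e; split=> c; first by rewrite -[LHS]rf -[RHS]rf; congr (r _); apply: e1.
  by move=> dc; apply: e2; rewrite /= dc linear0.
pose q i : {linear C i -> C i} := idfun \- e i.
have dq i c : chain_d C i (q i c) = 0 by rewrite linearB /= (eP i).1 subrr.
pose psi_ i c : chain_homology C i := hclass _ _ (cyc (dq i c)).
have psiL i : linear (psi_ i).
  move=> a c c'; rewrite /psi_ -linearP; congr (hclass _ _ _).
  by apply: val_inj; apply: (linearP (q i)).
pose psi i : {linear C i -> chain_homology C i} :=
  HB.pack (psi_ i) (GRing.isLinear.Build R _ _ *:%R _ (psiL i)).
have psiE i c (dc : chain_d C i c = 0) : psi i c = hclass _ _ (cyc dc).
  rewrite -[LHS]/(psi_ i c) /psi_; congr (hclass _ _ _); apply: val_inj => /=.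
  by rewrite (eP i).2 ?subr0.
have psi_e i c : psi i (e i c) = 0.
  rewrite -[LHS]/(psi_ i _); apply/hclass_eq0; exists 0; rewrite linear0.
  rewrite -[RHS]/(e i c - e i (e i c)) -linearB; apply/esym.
  by apply: (eP i).2; rewrite linearB (eP i).1 subrr.
have /cid[lam lamP] : exists lam : forall i, {linear C i -> res0 (chain_homology C i)},
    forall i c, res_aug _ (lam i c) = psi i c.
  suff lamP i : exists lam : {linear C i -> res0 (chain_homology C i)},
      forall c, res_aug _ (lam c) = psi i c.
    by exists (fun i => sval (cid (lamP i))) => i; apply: (svalP (cid (lamP i))).
  by apply: finite_retract_proj (fC i) _ => c; exists (fgen (psi i c)); apply: res_augE.
have /cid[phi phiP] : exists phi : forall i, {linear C i.+1 -> res1 (chain_homology C i)},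
    forall i c, res_d1 _ (phi i c) = lam i (chain_d C i.+1 c).
  suff phiP i : exists phi : {linear C i.+1 -> res1 (chain_homology C i)},
      forall c, res_d1 _ (phi c) = lam i (chain_d C i.+1 c).
    by exists (fun i => sval (cid (phiP i))) => i; apply: (svalP (cid (phiP i))).
  apply: (@finite_retract_proj _ _ _ _ _ (lam i \o chain_d C i.+1)) (fC i.+1) _ => c /=.
  apply: res_aug_exact; rewrite lamP (psiE _ _ (chain_dd c)).
  by apply/hclass_eq0; exists c.
(* Precomposing [phi] with [e] preserves its equation, as [e] does not change boundaries, and makes
   it vanish on cycles. *)
constructor; apply: (@Splitting R C e psi lam (fun i => phi i \o e i.+1)) => //.
- by move=> i c; apply: (eP i).1.
- by move=> i c; apply: (eP i).2.
- by move=> i c /=; rewrite phiP (eP i.+1).1.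
- move=> i c /=; congr (phi i _); apply/subr0_eq; rewrite -linearB.
  by apply: (eP i.+1).2; rewrite linearB (eP i.+1).1 subrr.
Qed.

(** The degree [n] is a free index, constrained to [i + j = n] only in the
    axioms, so that no transport between degrees is ever needed. *)
Record product_pairing (R : comNzRingType) (C D E : chain_complex R) := ProductPairing {
  pr_mu : forall n i j, {linear tensor (C i) (D j) -> E n};
  pr_pi : forall n i j, {linear E n -> tensor (C i) (D j)};
  pr_leib : forall n i j x, (i + j)%N = n ->
    chain_d E n (pr_mu n i j x) =
    pr_mu n.-1 i.-1 j (tensor_map (chain_d C i) idfun x) +
    (-1) ^+ i *: pr_mu n.-1 i j.-1 (tensor_map idfun (chain_d D j) x);
  pr_pi_mu : forall n i j x, (i + j)%N = n -> pr_pi n i j (pr_mu n i j x) = x;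
  pr_pi_mu0 : forall n i j a b x, (a + b)%N = n -> i != a ->
    pr_pi n i j (pr_mu n a b x) = 0 }.

(** Kept apart from [product_pairing] because all regular chains on a product vertex set form only a
    pairing, whereas the invariant chains satisfy the resummation as well. *)
Record product_datum (R : comNzRingType) (C D E : chain_complex R) := ProductDatum {
  pr_pairing :> product_pairing C D E;
  pr_mu_pi : forall n w, \sum_(i < n.+1)
    pr_mu pr_pairing n i (n - i) (pr_pi pr_pairing n i (n - i) w) = w }.

(** The Leibniz rule read in component (i, j): only products in bidegree (i+1, j) or (i, j+1)
    contribute. It is stated for a mere pairing so that it also applies to regular chains. *)
Lemma pr_pi_d_mu (R : comNzRingType) (C D E : chain_complex R)
    (pr : product_pairing C D E) n i j a b x : (i + j).+1 = n -> (a + b)%N = n ->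
  pr_pi pr n.-1 i j (chain_d E n (pr_mu pr n a b x)) =
  tensor_map (chain_d C i.+1) idfun (pr_pi pr n i.+1 j (pr_mu pr n a b x)) +
  (-1) ^+ i *: tensor_map idfun (chain_d D j.+1) (pr_pi pr n i j.+1 (pr_mu pr n a b x)).
Proof.
move=> ijn abn; rewrite pr_leib // linearD linearZ_LR.
have [ai|ai] := eqVneq i.+1 a.
  move: abn x; rewrite -{}ai => abn x; have ej : b = j by lia.
  move: abn x; rewrite {}ej => abn x.
  rewrite [in LHS]pr_pi_mu; last by lia.
  rewrite [in RHS]pr_pi_mu // [in RHS]pr_pi_mu0 //; last by lia.
  rewrite linear0 scaler0; congr (_ + _).
  (* For [j = 0] the truncated predecessor breaks the degree condition of [pr_pi_mu0]; the term
     vanishes instead because the boundary out of degree 0 is zero. *)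
  case: j ijn abn x => [|j] ijn abn x.
    by rewrite tensor_map0r ?linear0 ?scaler0 //; apply: chain_d0.
  by rewrite pr_pi_mu0 ?scaler0 //; lia.
rewrite (pr_pi_mu0 pr j x abn ai) linear0 add0r.
rewrite [X in X + _](_ : _ = 0) ?add0r; last first.
  case: a abn ai x => [|a] abn ai x.
    by rewrite tensor_map0l ?linear0 //; apply: chain_d0.
  by rewrite pr_pi_mu0 //; lia.
have [ia|ia] := eqVneq i a.
  move: abn ai x; rewrite -ia => abn ai x; have ej : b = j.+1 by lia.
  move: abn x; rewrite {}ej => abn x.
  by rewrite !pr_pi_mu //; lia.
rewrite (pr_pi_mu0 pr _ x abn ia) linear0.
case: b abn x => [|b] abn x.
  by rewrite [X in pr_pi _ _ _ _ (pr_mu _ _ _ _ X)]tensor_map0r ?linear0 //; apply: chain_d0.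
by rewrite pr_pi_mu0 ?scaler0 //; lia.
Qed.

Section Kuenneth.
Variables (R : comNzRingType) (C D E : chain_complex R).
Variables (pr : product_datum C D E).
Local Notation mu := (pr_mu pr).
Local Notation pi := (pr_pi pr).

Lemma pr_ext n (M : lmodType R) (f g : {linear E n -> M}) :
  (forall i j x, (i + j)%N = n -> f (mu n i j x) = g (mu n i j x)) -> f =1 g.
Proof.
move=> fg w; rewrite -(pr_mu_pi pr w) !linear_sum; apply: eq_bigr => i _.
by apply: fg; rewrite subnKC // -ltnS.
Qed.

Lemma pr_pi_d n i j (w : E n) : (i + j).+1 = n ->
  pi n.-1 i j (chain_d E n w) =
  tensor_map (chain_d C i.+1) idfun (pi n i.+1 j w) +
  (-1) ^+ i *: tensor_map idfun (chain_d D j.+1) (pi n i j.+1 w).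
Proof.
move=> ijn; move: w; pose L : {linear E n -> tensor (C i) (D j)} :=
  (tensor_map (chain_d C i.+1) idfun \o pi n i.+1 j) \+
  ((-1) ^+ i \*: (tensor_map idfun (chain_d D j.+1) \o pi n i j.+1)).
apply: (@pr_ext _ _ (pi n.-1 i j \o chain_d E n) L) => a b x abn.
exact: pr_pi_d_mu.
Qed.
End Kuenneth.

Section FlatLeft.
Variable R : comNzRingType.

Definition tensor_swap (M N : lmodType R) : {linear tensor M N -> tensor N M} :=
  tensor_lift (fun y : N => @tpure_linearr R N M y)
              (fun x : M => @tpure_linearl R N M x).

Lemma tensor_swapE (M N : lmodType R) (x : M) (y : N) :
  tensor_swap M N (tpure x y) = tpure y x.
Proof. exact: tensor_liftE. Qed.

Lemma tensor_swapK (M N : lmodType R) (x : tensor M N) :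
  tensor_swap N M (tensor_swap M N x) = x.
Proof.
move: x; apply: (@tensor_ext _ _ _ _ (tensor_swap N M \o tensor_swap M N) idfun).
move=> x y; rewrite -[LHS]/(tensor_swap N M (tensor_swap M N _)).
by rewrite !tensor_swapE.
Qed.

Lemma tensor_swap_map (M N M' N' : lmodType R) (f : {linear M -> M'})
    (g : {linear N -> N'}) x :
  tensor_swap M' N' (tensor_map f g x) = tensor_map g f (tensor_swap M N x).
Proof.
move: x; apply: (@tensor_ext _ _ _ _ (tensor_swap M' N' \o tensor_map f g)
  (tensor_map g f \o tensor_swap M N)) => x y.
rewrite -[LHS]/(tensor_swap _ _ (tensor_map _ _ _)).
rewrite -[RHS]/(tensor_map _ _ (tensor_swap _ _ _)).
by rewrite tensor_mapE !tensor_swapE tensor_mapE.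
Qed.

Lemma finite_retract_flat_l (M N N1 N2 : lmodType R) (g1 : {linear N -> N1})
    (g2 : {linear N -> N2}) :
  finite_retract M -> (forall y, g1 y = 0 -> g2 y = 0) ->
  forall x : tensor N M, tensor_map g1 idfun x = 0 -> tensor_map g2 idfun x = 0.
Proof.
move=> fM g12 x x0; rewrite -[LHS]tensor_swapK tensor_swap_map.
rewrite (finite_retract_flat fM g12) ?linear0 //.
by rewrite -tensor_swap_map x0 linear0.
Qed.

Lemma signrZK (V : lmodType R) i : involutive (fun v : V => (-1) ^+ i *: v).
Proof. by move=> v; rewrite scalerA -expr2 sqrr_sign scale1r. Qed.

End FlatLeft.

(** * The maps between the homology of the product, the tensor products and Tor *)

Section KuennethMaps.
Variables (R : comNzRingType) (C D E : chain_complex R).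
Variables (pr : product_datum C D E) (sC : splitting C) (sD : splitting D).
Local Notation mu := (pr_mu pr).
Local Notation pi := (pr_pi pr).

Lemma pi_boundary n i j (w : E n.+1) : (i + j)%N = n ->
  pi n i j (chain_d E n.+1 w) =
  tensor_map (chain_d C i.+1) idfun (pi n.+1 i.+1 j w) +
  (-1) ^+ i *: tensor_map idfun (chain_d D j.+1) (pi n.+1 i j.+1 w).
Proof. by move=> ijn; apply: (@pr_pi_d _ _ _ _ pr n.+1); rewrite ijn. Qed.

Lemma mu_cycle n i j c c' : (i + j)%N = n ->
  chain_d C i c = 0 -> chain_d D j c' = 0 -> chain_d E n (mu n i j (tpure c c')) = 0.
Proof.
move=> ijn dc dc'; rewrite pr_leib // !tensor_mapE dc dc' tpure0l tpure0r.
by rewrite !linear0 addr0.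
Qed.

Lemma pi_cycle n i j (w : E n) : chain_d E n w = 0 -> (i + j).+1 = n ->
  tensor_map (chain_d C i.+1) idfun (pi n i.+1 j w) =
  - ((-1) ^+ i *: tensor_map idfun (chain_d D j.+1) (pi n i j.+1 w)).
Proof.
move=> dw ijn; have := pr_pi_d pr w ijn; rewrite dw linear0.
by move=> /esym/eqP; rewrite addr_eq0 => /eqP.
Qed.

(** On a cycle, a boundary in the left slot can be traded by [pi_cycle] for one in the right slot of
    the neighbouring component, where [G] kills it. This disposes of homotopy terms. *)
Lemma pi_cycle_cross n i j (w : E n) (M N : lmodType R) (F : {linear C i -> M})
    (G : {linear D j -> N}) (F' : {linear C i.+1 -> M}) :
  chain_d E n w = 0 -> (i + j).+1 = n -> (forall c, G (chain_d D j.+1 c) = 0) ->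
  (forall c, F' c = F (chain_d C i.+1 c)) ->
  tensor_map F' G (pi n i.+1 j w) = 0.
Proof.
move=> dw ijn Gd F'E.
rewrite -(tensor_map_comp (f := chain_d C i.+1) (g := idfun) (f' := F) (g' := G)) //.
rewrite pi_cycle // linearN linearZ_LR.
rewrite (tensor_map_comp (f := idfun) (g := chain_d D j.+1) (f' := F) (g' := G) (F := F)
  (G := \0)) //.
by rewrite tensor_map0r ?scaler0 ?oppr0.
Qed.

Hypotheses (fC : forall i, finite_retract (C i)) (fD : forall i, finite_retract (D i)).

(** Applying the left boundary to [pi_cycle] shows that both boundaries together kill the component.
    The kernel of the boundary lies in that of [sp_e], so flatness replaces one by the other, one
    slot at a time. *)
Lemma pi_cycle_ee n a b (w : E n) : chain_d E n w = 0 -> (a + b)%N = n ->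
  tensor_map (sp_e sC a) (sp_e sD b) (pi n a b w) = 0.
Proof.
move=> dw; case: a => [|i]; first by rewrite tensor_map0l // => c; rewrite sp_e0 ?chain_d0.
case: b => [|j] abn; first by rewrite tensor_map0r // => c; rewrite sp_e0 ?chain_d0.
set x := pi n i.+1 j.+1 w.
have dd0 : tensor_map (chain_d C i.+1) (chain_d D j.+1) x = 0.
  have ijn : (i.+1 + j).+1 = n by lia.
  have := congr1 (tensor_map (chain_d C i.+1) idfun) (pi_cycle dw ijn).
  rewrite (tensor_map_comp (F := \0) (G := idfun)) //; last exact: chain_dd.
  rewrite tensor_map0l // linearN linearZ_LR.
  rewrite (tensor_map_comp (F := chain_d C i.+1) (G := chain_d D j.+1)) //.
  move=> /esym/eqP; rewrite oppr_eq0 => /eqP x0.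
  by rewrite -[LHS](signrZK i.+1) x0 scaler0.
rewrite -(tensor_map_comp (f := idfun) (g := sp_e sD j.+1) (f' := sp_e sC i.+1)
  (g' := idfun)) //.
apply: (finite_retract_flat_l (g1 := chain_d C i.+1) (fD _)); first exact: sp_e0.
rewrite (tensor_map_comp (F := chain_d C i.+1) (G := sp_e sD j.+1)) //.
rewrite -(tensor_map_comp (f := chain_d C i.+1) (g := idfun) (f' := idfun)
  (g' := sp_e sD j.+1)) //.
apply: (finite_retract_flat (g1 := chain_d D j.+1) (fC _)); first exact: sp_e0.
by rewrite (tensor_map_comp (F := chain_d C i.+1) (G := chain_d D j.+1)).
Qed.

Section Alpha.
Variables (n i j : nat) (ijn : (i + j)%N = n).

Lemma qrepr_cycle (F : chain_complex R) k (h : chain_homology F k) :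
  chain_d F k (val (qrepr h)) = 0.
Proof. exact/eqP/(valP (qrepr h)). Qed.

(** Uses chosen representatives but no splitting; [alpha_funE] then allows any representatives. *)
Definition alpha_fun (h : chain_homology C i) (h' : chain_homology D j) :
    chain_homology E n :=
  hclass _ _ (cyc (mu_cycle ijn (qrepr_cycle h) (qrepr_cycle h'))).

Lemma alpha_funE c c' (dc : chain_d C i c = 0) (dc' : chain_d D j c' = 0) :
  alpha_fun (hclass _ _ (cyc dc)) (hclass _ _ (cyc dc')) =
  hclass _ _ (cyc (mu_cycle ijn dc dc')).
Proof.
have rep (F : chain_complex R) k x (dx : chain_d F k x = 0) :
    exists a, chain_d F k.+1 a = val (qrepr (hclass (chain_d F k.+1) _ (cyc dx))) - x.
  rewrite -[X in _ - X]/(val (cyc dx)) -linearB; apply/hclass_eq0.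
  by rewrite linearB /= qreprK subrr.
have [a da] := rep C i c dc; have [b db] := rep D j c' dc'.
apply: hclass_eq; move: da db.
set c1 := val (qrepr _); set c1' := val (qrepr _) => da db.
have dc1 : chain_d C i c1 = 0 by apply: qrepr_cycle.
have dc1' : chain_d D j c1' = 0 by apply: qrepr_cycle.
(* The representatives are exchanged one at a time: the two boundaries are the products of [c1 - c]
   with [c1'] and of [c] with [c1' - c'], and they telescope. *)
exists (mu n.+1 i.+1 j (tpure a c1') + (-1) ^+ i *: mu n.+1 i j.+1 (tpure c b)).
rewrite linearD linearZ_LR !pr_leib ?addSn ?addnS ?ijn // !tensor_mapE.
rewrite dc dc1' da db tpure0l tpure0r !linear0 ?scaler0 addr0 ?scaler0 add0r signrZK.
rewrite -linearD -linearB; congr (mu _ _ _ _).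
rewrite -[- c]scaleN1r -[- c']scaleN1r tpureDl tpureD tpureZ tpureZl !scaleN1r.
by rewrite addrA subrK.
Qed.

Lemma alpha_fun_linearl h' : linear (alpha_fun^~ h').
Proof.
move=> a; elim/homology_ind => x dx; elim/homology_ind => y dy.
elim/homology_ind: h' => z dz.
have dxy : chain_d C i (a *: x + y) = 0 by rewrite linearP dx dy scaler0 addr0.
rewrite -(hclass_lin _ dx dy dxy) !alpha_funE.
set u := mu_cycle ijn dx dz; set v := mu_cycle ijn dy dz.
have dd : chain_d E n (a *: mu n i j (tpure x z) + mu n i j (tpure y z)) = 0.
  by rewrite linearP u v scaler0 addr0.
rewrite -(hclass_lin _ u v dd); apply: hclass_eq; exists 0.
by rewrite linear0 tpureDl tpureZl linearP subrr.
Qed.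

Lemma alpha_fun_linearr h : linear (alpha_fun h).
Proof.
move=> a; elim/homology_ind => x dx; elim/homology_ind => y dy.
elim/homology_ind: h => z dz.
have dxy : chain_d D j (a *: x + y) = 0 by rewrite linearP dx dy scaler0 addr0.
rewrite -(hclass_lin _ dx dy dxy) !alpha_funE.
set u := mu_cycle ijn dz dx; set v := mu_cycle ijn dz dy.
have dd : chain_d E n (a *: mu n i j (tpure z x) + mu n i j (tpure z y)) = 0.
  by rewrite linearP u v scaler0 addr0.
rewrite -(hclass_lin _ u v dd); apply: hclass_eq; exists 0.
by rewrite linear0 tpureD tpureZ linearP subrr.
Qed.

Definition alpha_ : {linear tensor (chain_homology C i) (chain_homology D j) ->
    chain_homology E n} := tensor_lift alpha_fun_linearl alpha_fun_linearr.

Lemma alpha_E c c' (dc : chain_d C i c = 0) (dc' : chain_d D j c' = 0) :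
  alpha_ (tpure (hclass _ _ (cyc dc)) (hclass _ _ (cyc dc'))) =
  hclass _ _ (cyc (mu_cycle ijn dc dc')).
Proof. by rewrite tensor_liftE alpha_funE. Qed.

Definition rho_pre : {linear subm (kerp (chain_d E n)) ->
    tensor (chain_homology C i) (chain_homology D j)} :=
  tensor_map (sp_psi sC i) (sp_psi sD j) \o pi n i j \o val.

Lemma rho_preP z : z \in boundaryp (chain_d E n.+1) (chain_d E n) -> rho_pre z = 0.
Proof.
move=> /imgpP[v dv]; rewrite -[LHS]/(tensor_map _ _ (pi n i j (val z))) -dv.
rewrite pi_boundary // linearD linearZ_LR.
rewrite (tensor_map_comp (F := \0) (G := sp_psi sD j)) //; last first.
  by move=> c; rewrite sp_psi_d.
rewrite (tensor_map_comp (F := sp_psi sC i) (G := \0)) //; last first.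
  by move=> c; rewrite sp_psi_d.
by rewrite tensor_map0l // tensor_map0r // scaler0 addr0.
Qed.

Definition rho_ : {linear chain_homology E n ->
    tensor (chain_homology C i) (chain_homology D j)} := qlift rho_preP.

Lemma rho_E w (dw : chain_d E n w = 0) :
  rho_ (hclass _ _ (cyc dw)) = tensor_map (sp_psi sC i) (sp_psi sD j) (pi n i j w).
Proof. exact: qliftE. Qed.

End Alpha.

Section Beta.
Variables (n i j : nat) (ijn : (i + j).+1 = n).

Definition beta_chain :
    {linear E n -> tensor (res1 (chain_homology C i)) (chain_homology D j)} :=
  tensor_map (sp_phi sC i) (sp_psi sD j) \o pi n i.+1 j.

Definition beta_chain0 :
    {linear E n.-1 -> tensor (res0 (chain_homology C i)) (chain_homology D j)} :=
  tensor_map (sp_lam sC i) (sp_psi sD j) \o pi n.-1 i j.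

(** As [sp_phi] vanishes on cycles and [sp_psi] on boundaries, boundaries are sent to 0 on the nose,
    and the top map of the comparison can be zero. *)
Lemma beta_chain2P x : beta_chain (chain_d E n.+1 x) =
  tensor_map (res_d2 _) idfun
    ((\0 : {linear E n.+1 -> tensor (res2 (chain_homology C i)) (chain_homology D j)}) x).
Proof.
rewrite [RHS]linear0 -[LHS]/(tensor_map _ _ (pi n i.+1 j _)).
rewrite pi_boundary ?addSn // linearD linearZ_LR.
rewrite (tensor_map_comp (F := \0) (G := sp_psi sD j)) //; last first.
  by move=> c; rewrite sp_phi_cycle // chain_dd.
rewrite (tensor_map_comp (F := sp_phi sC i) (G := \0)) //; last first.
  by move=> c; rewrite sp_psi_d.
by rewrite tensor_map0l // tensor_map0r // scaler0 addr0.
Qed.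

(** The right-hand boundary dies under [sp_psi]; the left-hand one is the comparison equation
    [sp_phiP]. *)
Lemma beta_chain1P x : beta_chain0 (chain_d E n x) =
  tensor_map (res_d1 _) idfun (beta_chain x).
Proof.
rewrite -[LHS]/(tensor_map _ _ (pi n.-1 i j _)).
rewrite -[RHS]/(tensor_map _ _ (tensor_map _ _ (pi n i.+1 j _))).
rewrite (pr_pi_d pr) ?ijn // linearD linearZ_LR.
rewrite (tensor_map_comp (F := sp_lam sC i) (G := \0)) //; last first.
  by move=> c; rewrite sp_psi_d.
rewrite (@tensor_map0r _ _ _ _ _ _ \0) // scaler0 addr0.
rewrite (tensor_map_comp (F := sp_lam sC i \o chain_d C i.+1) (G := sp_psi sD j)) //.
rewrite (tensor_map_comp (F := sp_lam sC i \o chain_d C i.+1) (G := sp_psi sD j)) //.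
by move=> c; apply: sp_phiP.
Qed.

Definition beta_ : {linear chain_homology E n ->
    tor1 (chain_homology C i) (chain_homology D j)} :=
  homology_map beta_chain2P beta_chain1P.

Lemma beta_cycle w : chain_d E n w = 0 ->
  tensor_map (res_d1 _) idfun (beta_chain w) = 0.
Proof. by move=> dw; rewrite -beta_chain1P dw linear0. Qed.

Lemma beta_E w (dw : chain_d E n w = 0) :
  beta_ (hclass _ _ (cyc dw)) = hclass _ _ (cyc (beta_cycle dw)).
Proof. exact: homology_map_cyc. Qed.

End Beta.
End KuennethMaps.

(** * Comparison with the functorial resolution *)

Section Comparison.
Variable R : comNzRingType.

(** Lifting is required whenever [f] lands in the image of [g]; this avoids replacing [B'] by that
    image, as exactness of a resolution only provides preimages of cycles. *)
Definition projective (A : lmodType R) := forall (B B' : lmodType R)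
  (g : {linear B -> B'}) (f : {linear A -> B'}),
  (forall x, exists b, g b = f x) -> exists h : {linear A -> B}, forall x, g (h x) = f x.

Lemma free_projective (K : choiceType) : projective {freeg K / R}.
Proof. by move=> B B' g f gf; apply: free_lifting => k; apply: gf. Qed.

Lemma finite_retract_projective (M : lmodType R) : finite_retract M -> projective M.
Proof. by move=> fM B B' g f; apply: finite_retract_proj. Qed.

(** The first two stages of the uniqueness of comparison maps: [h] lifts [L - L'] through [res_d1],
    and [l] lifts the remaining difference through [res_d2]. *)
Lemma resolution_homotopy (M A0 A1 : lmodType R) (d : {linear A1 -> A0})
    (L L' : {linear A0 -> res0 M}) (F F' : {linear A1 -> res1 M}) :
  projective A0 -> projective A1 ->
  (forall x, res_aug M (L x) = res_aug M (L' x)) ->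
  (forall x, res_d1 M (F x) = L (d x)) -> (forall x, res_d1 M (F' x) = L' (d x)) ->
  exists (h : {linear A0 -> res1 M}) (l : {linear A1 -> res2 M}),
    forall x, F x = F' x + h (d x) + res_d2 M (l x).
Proof.
move=> pA0 pA1 LL FL FL'.
have [|h hP] := pA0 _ _ (res_d1 M) (L \- L').
  by move=> x; apply: res_aug_exact; rewrite linearB LL subrr.
pose G : {linear A1 -> res1 M} := (F \- F') \- (h \o d).
have GE x : G x = F x - F' x - h (d x) by [].
have [|l lP] := pA1 _ _ (res_d2 M) G.
  by move=> x; apply: res_d1_exact; rewrite GE !linearB hP FL FL' /= subrr.
by exists h, l => x; rewrite lP GE -[F x - _ - _]addrA -opprD [RHS]addrC subrK.
Qed.

Variables (C : chain_complex R) (sC : splitting C) (i : nat).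
Local Notation H := (chain_homology C i).

(** The comparison back from the resolution to the chains. The lift [g1] exists because the class of
    [g0 (res_d1 H x)] is the augmentation of a boundary, hence 0. *)
Lemma resolution_to_chains :
  exists (g0 : {linear res0 H -> C i}) (g1 : {linear res1 H -> C i.+1}),
  [/\ forall x, chain_d C i (g0 x) = 0, forall x, sp_psi sC i (g0 x) = res_aug H x
    & forall x, chain_d C i.+1 (g1 x) = g0 (res_d1 H x)].
Proof.
pose g0 : {linear res0 H -> C i} := free_lift (fun m : H => val (qrepr m)).
have dg0 x : chain_d C i (g0 x) = 0.
  move: x; apply: (@free_ext _ _ _ (chain_d C i \o g0) \0) => m.
  by rewrite -[LHS]/(chain_d C i (g0 _)) free_liftE qrepr_cycle.
have psig0 x : sp_psi sC i (g0 x) = res_aug H x.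
  move: x; apply: (@free_ext _ _ _ (sp_psi sC i \o g0) (res_aug H)) => m.
  rewrite -[LHS]/(sp_psi sC i (g0 _)) !free_liftE (sp_psiE sC (qrepr_cycle m)).
  by rewrite -[RHS]qreprK; congr (hclass _ _ _); apply: val_inj.
have [|g1 g1P] := @free_projective _ _ _ (chain_d C i.+1) (g0 \o res_d1 H).
  move=> x; have [|b db] := @sp_psi_eq0 _ _ sC _ (g0 (res_d1 H x)).
    by rewrite psig0 res_aug_d1.
  by exists b; rewrite db sp_q_cycle.
by exists g0, g1.
Qed.

End Comparison.

(** * Surjectivity onto Tor and exactness in the middle *)

Section KuennethExact.
Variables (R : comNzRingType) (C D E : chain_complex R).
Variables (pr : product_datum C D E) (sC : splitting C) (sD : splitting D).
Hypotheses (fC : forall i, finite_retract (C i)) (fD : forall i, finite_retract (D i)).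
Local Notation mu := (pr_mu pr).
Local Notation pi := (pr_pi pr).

Lemma beta_chain_cycle n i j i' j' (A : lmodType R) (g : {linear A -> C i})
    (t : tensor A (D j)) : (i + j)%N = n -> (i' + j').+1 = n ->
  (forall x, chain_d C i (g x) = 0) ->
  tensor_map (sp_phi sC i') (sp_psi sD j')
    (pi n i'.+1 j' (mu n i j (tensor_map g idfun t))) = 0.
Proof.
move=> ijn ijn'; have [ei|ei] := eqVneq i'.+1 i; last by rewrite pr_pi_mu0 ?linear0.
have ej : j = j' by lia.
move: ijn g t; rewrite -{}ei {}ej => ijn g t dg; rewrite pr_pi_mu //.
rewrite (tensor_map_comp (F := \0) (G := sp_psi sD j')) ?tensor_map0l //.
by move=> c; rewrite sp_phi_cycle.
Qed.

(** A Tor cycle is lifted to res1 (x) D_j and transported to the chains by [g0] and [g1]. The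
    vanishing of the other components lets preimages for different [i] be added. *)
Lemma beta_surj n i j (ijn : (i + j).+1 = n)
    (t : tor1 (chain_homology C i) (chain_homology D j)) :
  exists h, beta_ pr sC sD ijn h = t /\
    forall i' j' (e : (i' + j').+1 = n), i' != i -> beta_ pr sC sD e h = 0.
Proof.
elim/homology_ind: t => t dt.
have [g0 [g1 [dg0 psig0 dg1]]] := resolution_to_chains sC i.
have [t1 t1P] := tensor_map_surj (sp_psi_surj sD (i := j)) t.
(* The lift [t1] of the cycle [t] is a cycle only modulo boundaries of [D]; [t2] is the chain that
   accounts for the defect. *)
have [|t2 t2P] := tensor_right_exact (sp_psi_surj sD (i := j))
    (sp_psi_eq0 (s := sD) (i := j)) (x := tensor_map (res_d1 _) idfun t1).
  rewrite (tensor_map_comp (F := res_d1 _) (G := sp_psi sD j)) //.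
  rewrite -(tensor_map_comp (f := idfun) (g := sp_psi sD j) (f' := res_d1 _) (g' := idfun)) //.
  by rewrite t1P.
pose u := tensor_map g1 (sp_q sD j) t1.
pose v := tensor_map g0 (idfun : {linear D j.+1 -> D j.+1}) t2.
have du : tensor_map (chain_d C i.+1) idfun u = tensor_map idfun (chain_d D j.+1) v.
  rewrite (tensor_map_comp (F := g0 \o res_d1 _) (G := sp_q sD j)) //.
  rewrite (tensor_map_comp (F := g0) (G := chain_d D j.+1)) //.
  rewrite -(tensor_map_comp (f := idfun) (g := chain_d D j.+1) (f' := g0) (g' := idfun)) // t2P.
  rewrite (tensor_map_comp (F := res_d1 _) (G := sp_q sD j)) //.
  by rewrite (tensor_map_comp (F := g0 \o res_d1 _) (G := sp_q sD j)).
have du' : tensor_map idfun (chain_d D j) u = 0.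
  rewrite (tensor_map_comp (F := g1) (G := \0)) ?tensor_map0r //.
  exact: sp_dq.
have dv : tensor_map (chain_d C i) idfun v = 0.
  by rewrite (tensor_map_comp (F := \0) (G := idfun)) ?tensor_map0l.
(* By [du] the left boundary of [u] equals the right boundary of [v]; the sign makes them cancel in
   the Leibniz rule. *)
pose w := mu n i.+1 j u - (-1) ^+ i *: mu n i j.+1 v.
have dw : chain_d E n w = 0.
  rewrite linearB linearZ_LR !pr_leib ?addSn ?addnS // du du' dv !linear0.
  by rewrite ?scaler0 addr0 add0r -[i.+1.-1]/i -[j.+1.-1]/j signrZK subrr.
have h2 : (i + j.+1)%N = n by lia.
exists (hclass _ _ (cyc dw)); split=> [|i' j' e ii].
  rewrite beta_E; apply: hclass_eq.
  (* Going to the chains and back is homotopic to the identity of the resolution. On the cycle [t]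
     the [h] term vanishes and the [l] term is a boundary. *)
  have [|||h [l hl]] := @resolution_homotopy _ _ _ _ (res_d1 _) (sp_lam sC i \o g0) idfun
      (sp_phi sC i \o g1) idfun (@free_projective _ _) (@free_projective _ _).
  - by move=> x; rewrite -[LHS]/(res_aug _ (sp_lam sC i (g0 x))) sp_lamP psig0.
  - move=> x; rewrite -[LHS]/(res_d1 _ (sp_phi sC i (g1 x))) sp_phiP dg1 //.
  - by [].
  exists (tensor_map l idfun t).
  have -> : beta_chain pr sC sD n i j w = tensor_map (sp_phi sC i \o g1) idfun t.
    rewrite -[LHS]/(tensor_map _ _ (pi n i.+1 j w)) linearB linearZ_LR.
    rewrite pr_pi_mu ?addSn // pr_pi_mu0 ?scaler0 ?subr0 ?h2 // ?gtn_eqF //.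
    rewrite (tensor_map_comp (F := sp_phi sC i \o g1) (G := sp_psi sD j)) //.
      by rewrite -t1P (tensor_map_comp (F := sp_phi sC i \o g1) (G := sp_psi sD j)).
    exact: sp_psi_q.
  pose k : {linear res1 (chain_homology C i) -> res1 (chain_homology C i)} :=
    (h \o res_d1 _) \+ (res_d2 _ \o l).
  rewrite (tensor_mapDl (f1 := idfun) (f2 := k)); last by move=> c; rewrite hl -addrA.
  rewrite (tensor_mapDl (f := k) (f1 := h \o res_d1 _) (f2 := res_d2 _ \o l)) //.
  rewrite -(tensor_map_comp (f := res_d1 _) (g := idfun) (f' := h) (g' := idfun)
    (F := h \o res_d1 _) (G := idfun)) // dt linear0 add0r.
  rewrite (@tensor_map_id _ _ _ idfun) // addrAC subrr add0r.
  by rewrite (tensor_map_comp (F := res_d2 _ \o l) (G := idfun)).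
rewrite beta_E; apply/hclass_eq0; exists 0; rewrite linear0 /=.
rewrite -[RHS]/(tensor_map _ _ (pi n i'.+1 j' w)) linearB linearZ_LR.
rewrite [pi _ _ _ (mu n i.+1 j u)]pr_pi_mu0 ?addSn // sub0r linearN linearZ_LR.
by rewrite beta_chain_cycle ?scaler0 ?oppr0.
Qed.

(** Vanishing of the Tor class kills [(sp_e (x) sp_psi) w_(i+1,b)], after
    transport along a comparison map back from the resolution; right exactness
    of the tensor product then gives the boundary. *)
Lemma beta_cross_tail n a b (ab : (a + b)%N = n) (w : E n) (dw : chain_d E n w = 0) :
  (forall i j (e : (i + j).+1 = n), beta_ pr sC sD e (hclass _ _ (cyc dw)) = 0) ->
  exists u : tensor (C a) (D b.+1),
    tensor_map idfun (chain_d D b.+1) u = tensor_map (sp_e sC a) (sp_q sD b) (pi n a b w).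
Proof.
case: a ab => [|i] ab b0.
  by exists 0; rewrite linear0 tensor_map0l // => c; rewrite sp_e0 ?chain_d0.
have ijn : (i + b).+1 = n by rewrite -ab.
set x := pi n i.+1 b w.
have := b0 i b ijn; rewrite beta_E hclass_eq0 => -[s0 s0P].
rewrite -[RHS]/(tensor_map (sp_phi sC i) (sp_psi sD b) x) in s0P.
have [g0 [g1 [dg0 psig0 dg1]]] := resolution_to_chains sC i.
(* Going to the resolution and back preserves the class of the cycle [sp_q sC i c], so [k0] takes
   values in boundaries and lifts to the homotopy [h]. *)
pose k0 : {linear C i -> C i} := (g0 \o sp_lam sC i \o sp_q sC i) \- sp_q sC i.
have k0E c : k0 c = g0 (sp_lam sC i (sp_q sC i c)) - sp_q sC i c by [].
have [|h hP] := finite_retract_projective (fC i) (g := chain_d C i.+1) (f := k0).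
  move=> c; have dk : chain_d C i (k0 c) = 0 by rewrite k0E linearB dg0 sp_dq subrr.
  rewrite -(sp_q_cycle sC dk); apply: sp_psi_eq0.
  by rewrite k0E linearB psig0 sp_lamP subrr.
(* Since [sp_e] depends only on the boundary of its argument, it suffices that the two sides have
   arguments with equal boundary. *)
have eg c : sp_e sC i.+1 (g1 (sp_phi sC i c)) =
    sp_e sC i.+1 c + sp_e sC i.+1 (h (chain_d C i.+1 c)).
  rewrite -linearD; apply/subr0_eq; rewrite -linearB; apply: sp_e0.
  rewrite linearB linearD hP dg1 sp_phiP k0E.
  by rewrite sp_q_cycle ?chain_dd // [X in _ - X]addrC subrK subrr.
(* The vanishing Tor class is pushed forward by [sp_e \o g1], which kills the image of [res_d2]; the
   homotopy term from [eg] is removed by [pi_cycle_cross]. *)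
have ex : tensor_map (sp_e sC i.+1) (sp_psi sD b) x = 0.
  have := congr1 (tensor_map (sp_e sC i.+1 \o g1) idfun) s0P.
  rewrite (tensor_map_comp (F := \0) (G := idfun)) //; last first.
    move=> c; rewrite -[LHS]/(sp_e sC i.+1 (g1 _)) sp_e0 // dg1 res_d1_d2 linear0 //.
  rewrite tensor_map0l // => /esym.
  pose k : {linear C i.+1 -> C i.+1} :=
    sp_e sC i.+1 \+ (sp_e sC i.+1 \o h \o chain_d C i.+1).
  rewrite (tensor_map_comp (F := k) (G := sp_psi sD b)) //.
  rewrite (tensor_mapDl (f := k) (f1 := sp_e sC i.+1)
    (f2 := sp_e sC i.+1 \o h \o chain_d C i.+1)) //.
  rewrite (@pi_cycle_cross _ _ _ _ pr n i b w _ _ (sp_e sC i.+1 \o h) (sp_psi sD b)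
    (sp_e sC i.+1 \o h \o chain_d C i.+1)) ?addr0 //.
  by move=> c; apply: sp_psi_d.
have [|u uP] := tensor_right_exact (sp_psi_surj sD (i := b))
    (sp_psi_eq0 (s := sD) (i := b)) (x := tensor_map (sp_e sC i.+1) idfun x).
  by rewrite (tensor_map_comp (F := sp_e sC i.+1) (G := sp_psi sD b)) ?ex.
exists u; rewrite uP.
by rewrite (tensor_map_comp (F := sp_e sC i.+1) (G := sp_q sD b)).
Qed.

(** With [sp_e] vanishing in the left slot of every component, so does the left boundary, then by
    [pi_cycle] the right boundary, then by flatness [sp_e] in the right slot. Each slot is thus
    fixed by [sp_q]. *)
Lemma pi_cycle_qq n (w : E n) : chain_d E n w = 0 ->
  (forall a b, (a + b)%N = n -> tensor_map (sp_e sC a) idfun (pi n a b w) = 0) ->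
  forall a b, (a + b)%N = n ->
  tensor_map (sp_q sC a) (sp_q sD b) (pi n a b w) = pi n a b w.
Proof.
move=> dw ew a b ab; set x := pi n a b w.
have dx : tensor_map idfun (chain_d D b) x = 0.
  rewrite {}/x; case: b ab => [|j] ab; first by rewrite tensor_map0r // => c; rewrite chain_d0.
  have ijn : (a + j).+1 = n by lia.
  have := pi_cycle pr dw ijn.
  rewrite -(tensor_map_comp (f := sp_e sC a.+1) (g := idfun) (f' := chain_d C a.+1)
    (g' := idfun)) //.
    rewrite ew ?addSn // linear0 => /esym/eqP; rewrite oppr_eq0 => /eqP x0.
    by rewrite -[LHS](signrZK a) x0 scaler0.
  exact: sp_de.
have ex : tensor_map idfun (sp_e sD b) x = 0.
  by apply: (finite_retract_flat (g1 := chain_d D b) (fC _)) => //; apply: sp_e0.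
have qx : tensor_map (sp_q sC a) idfun x = x.
  rewrite -[RHS](@tensor_map_id _ _ _ idfun idfun) //.
  rewrite [RHS](tensor_mapDl (f := idfun) (f1 := sp_q sC a) (f2 := sp_e sC a)).
    by rewrite ew // addr0.
  by move=> c; rewrite sp_qE subrK.
have qx' : tensor_map idfun (sp_q sD b) x = x.
  rewrite -[RHS](@tensor_map_id _ _ _ idfun idfun) //.
  rewrite [RHS](tensor_mapDr idfun (g := idfun) (g1 := sp_q sD b) (g2 := sp_e sD b)).
    by rewrite ex addr0.
  by move=> c; rewrite sp_qE subrK.
rewrite -{2}qx -{2}qx'.
by rewrite (tensor_map_comp (F := sp_q sC a) (G := sp_q sD b)).
Qed.

Lemma mu_qq_cycle n i j x : (i + j)%N = n ->
  chain_d E n (mu n i j (tensor_map (sp_q sC i) (sp_q sD j) x)) = 0.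
Proof.
move=> ijn; rewrite pr_leib //.
rewrite (tensor_map_comp (F := \0) (G := sp_q sD j)) //; last exact: sp_dq.
rewrite (tensor_map_comp (F := sp_q sC i) (G := \0)) //; last exact: sp_dq.
by rewrite tensor_map0l // tensor_map0r // !linear0 addr0.
Qed.

(** An explicit cycle for values on arbitrary tensors, not only pure ones; it identifies the
    summands of a cycle treated by [pi_cycle_qq]. *)
Lemma alpha_psi n i j (ijn : (i + j)%N = n) x :
  alpha_ pr ijn (tensor_map (sp_psi sC i) (sp_psi sD j) x) =
  hclass _ _ (cyc (mu_qq_cycle x ijn)).
Proof.
elim/tensor_ind: x => [|c c'|a u v hu hv].
- rewrite !linear0; apply/esym/hclass_eq0; exists 0; rewrite linear0.
  by rewrite -[RHS]/(mu n i j (tensor_map _ _ 0)) !linear0.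
- rewrite tensor_mapE -sp_psi_q -[X in tpure _ X]sp_psi_q.
  rewrite (sp_psiE sC (sp_dq sC c)) (sp_psiE sD (sp_dq sD c')) alpha_E.
  by apply: hclass_eq; exists 0; rewrite linear0 tensor_mapE subrr.
- rewrite [in LHS]linearP [in LHS]linearP hu hv.
  set du := mu_qq_cycle u ijn; set dv := mu_qq_cycle v ijn.
  have dd : chain_d E n (a *: mu n i j (tensor_map (sp_q sC i) (sp_q sD j) u) +
      mu n i j (tensor_map (sp_q sC i) (sp_q sD j) v)) = 0.
    by rewrite linearP du dv scaler0 addr0.
  rewrite -(hclass_lin _ du dv dd); apply: hclass_eq; exists 0.
  by rewrite linear0 (linearP (tensor_map (sp_q sC i) (sp_q sD j))) linearP subrr.
Qed.
End KuennethExact.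

Section KuennethTheorem.
Variables (R : comNzRingType) (C D E : chain_complex R).
Variables (pr : product_datum C D E) (sC : splitting C) (sD : splitting D).
Hypotheses (fC : forall i, finite_retract (C i)) (fD : forall i, finite_retract (D i)).
Local Notation mu := (pr_mu pr).
Local Notation pi := (pr_pi pr).

Lemma tensor_index n (i : 'I_n.+1) : (i + (n - i))%N = n.
Proof. by rewrite subnKC // -ltnS. Qed.

Lemma tor_index n (i : 'I_n) : (i + (n - i - 1)).+1 = n.
Proof. by have := ltn_ord i; lia. Qed.

(** The left slot under [sp_e] splits into an [sp_e] and an [sp_q] part on the right. The first
    vanishes by [pi_cycle_ee]; the second bounds by [beta_cross_tail], and [U] collects the bounding
    chains. *)
Lemma beta_exact_cross n (w : E n) (dw : chain_d E n w = 0) :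
  (forall i j (e : (i + j).+1 = n), beta_ pr sC sD e (hclass _ _ (cyc dw)) = 0) ->
  exists U : E n.+1, forall a b, (a + b)%N = n ->
    tensor_map (sp_e sC a) idfun (pi n a b (w - chain_d E n.+1 U)) = 0.
Proof.
move=> b0; have uP (a : 'I_n.+1) := beta_cross_tail fC (tensor_index a) b0.
pose u a := sval (cid (uP a)).
(* The sign cancels the one that the right-hand boundary acquires in [pi_boundary]; the left-hand
   boundary of [U] is invisible to [sp_e]. *)
pose U := \sum_(a < n.+1) (-1) ^+ a *: mu n.+1 a (n - a).+1 (u a).
have piU (a : 'I_n.+1) : pi n.+1 a (n - a).+1 U = (-1) ^+ a *: u a.
  rewrite linear_sum (bigD1 a) //= linearZ_LR pr_pi_mu; last first.
    by rewrite addnS tensor_index.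
  rewrite big1 ?addr0 // => a' aa'; rewrite linearZ_LR pr_pi_mu0 ?scaler0 //.
    by rewrite addnS tensor_index.
  by rewrite eq_sym.
exists U => a b ab; have an : (a < n.+1)%N by lia.
have eb : b = (n - Ordinal an)%N by rewrite /=; lia.
rewrite [nat_of_ord _]/= in eb; subst b.
rewrite linearB linearB pi_boundary // linearD.
rewrite (tensor_map_comp (f := chain_d C a.+1) (g := idfun) (F := \0) (G := idfun)) //;
  last first.
  by move=> c; exact: (sp_ed sC (n := a.+1)).
rewrite [X in _ - (X + _)]tensor_map0l // add0r (piU (Ordinal an)).
rewrite (linearZ_LR (tensor_map idfun (chain_d D (n - a).+1))) signrZK.
rewrite (svalP (cid (uP (Ordinal an)))).
rewrite (tensor_map_comp (F := sp_e sC a) (G := sp_q sD (n - a))) //; last first.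
  by move=> c; apply: sp_e_idem.
rewrite (tensor_mapDr (sp_e sC a) (g := idfun) (g1 := sp_e sD (n - a)) (g2 := sp_q sD (n - a))).
  by rewrite (pi_cycle_ee pr sC sD fC fD dw ab) add0r subrr.
by move=> c; rewrite sp_qE addrC subrK.
Qed.

Lemma beta_exact n (h : chain_homology E n) :
  (forall i j (e : (i + j).+1 = n), beta_ pr sC sD e h = 0) ->
  h = \sum_(i < n.+1) alpha_ pr (tensor_index i) (rho_ pr sC sD (tensor_index i) h).
Proof.
elim/homology_ind: h => w dw b0; have [U eU] := beta_exact_cross b0.
have dw' : chain_d E n (w - chain_d E n.+1 U) = 0.
  by rewrite linearB dw sub0r; apply/eqP; rewrite oppr_eq0; apply/eqP/chain_dd.
have -> : hclass (chain_d E n.+1) (chain_d E n) (cyc dw) = hclass _ _ (cyc dw').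
  by apply: hclass_eq; exists U; rewrite opprB addrC subrK.
under eq_bigr => i _ do rewrite rho_E alpha_psi.
rewrite -linear_sum; congr (hclass _ _ _); apply: val_inj; rewrite raddf_sum.
rewrite -[LHS](pr_mu_pi pr); apply: eq_bigr => i _.
have E1 := pi_cycle_qq sD fC dw' eU (tensor_index i). exact: (congr1 (mu n i (n - i)) (esym E1)).
Qed.

Lemma rho_alpha n i j (ijn : (i + j)%N = n) x :
  rho_ pr sC sD ijn (alpha_ pr ijn x) = x.
Proof.
move: x; apply: (@tensor_ext _ _ _ _ (rho_ pr sC sD ijn \o alpha_ pr ijn) idfun).
elim/homology_ind => c dc; elim/homology_ind => c' dc'.
rewrite -[LHS]/(rho_ pr sC sD ijn (alpha_ pr ijn _)) alpha_E rho_E pr_pi_mu //.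
by rewrite tensor_mapE !sp_psiE.
Qed.

Lemma rho_alpha0 n i j i' j' (ijn : (i + j)%N = n) (ijn' : (i' + j')%N = n) x :
  i' != i -> rho_ pr sC sD ijn' (alpha_ pr ijn x) = 0.
Proof.
move=> ii; move: x.
apply: (@tensor_ext _ _ _ _ (rho_ pr sC sD ijn' \o alpha_ pr ijn) \0).
elim/homology_ind => c dc; elim/homology_ind => c' dc'.
rewrite -[LHS]/(rho_ pr sC sD ijn' (alpha_ pr ijn _)) alpha_E rho_E pr_pi_mu0 //.
by rewrite linear0.
Qed.

Lemma beta_alpha0 n i j i' j' (ijn : (i + j)%N = n) (ijn' : (i' + j').+1 = n) x :
  beta_ pr sC sD ijn' (alpha_ pr ijn x) = 0.
Proof.
move: x; apply: (@tensor_ext _ _ _ _ (beta_ pr sC sD ijn' \o alpha_ pr ijn) \0).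
elim/homology_ind => c dc; elim/homology_ind => c' dc'.
rewrite -[LHS]/(beta_ pr sC sD ijn' (alpha_ pr ijn _)) alpha_E beta_E.
apply/hclass_eq0; exists 0; rewrite linear0.
rewrite -[RHS]/(tensor_map (sp_phi sC i') (sp_psi sD j') (pi n i'.+1 j' (mu n i j (tpure c c')))).
have [ei|ei] := eqVneq i'.+1 i; last by rewrite pr_pi_mu0 ?linear0.
have ej : j = j' by lia.
move: ijn c dc c' dc'; rewrite -{}ei {}ej => ijn c dc c' dc'.
by rewrite pr_pi_mu // tensor_mapE sp_phi_cycle // tpure0l.
Qed.

Definition tensor_sum n := dsum (fun i : 'I_n.+1 =>
  tensor (chain_homology C i) (chain_homology D (n - i))).
Definition tor_sum n := dsum (fun i : 'I_n =>
  tor1 (chain_homology C i) (chain_homology D (n - i - 1))).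

Definition alpha_fun_sum n (t : tensor_sum n) : chain_homology E n :=
  \sum_i alpha_ pr (tensor_index i) (t i).

Lemma alpha_fun_sum_linear n : linear (@alpha_fun_sum n).
Proof.
move=> a t t'; rewrite scaler_sumr -big_split; apply: eq_bigr => i _.
by rewrite !ffunE linearP.
Qed.
HB.instance Definition _ n := GRing.isLinear.Build R (tensor_sum n) (chain_homology E n)
  *:%R (@alpha_fun_sum n) (@alpha_fun_sum_linear n).

Definition alpha_sum n : {linear tensor_sum n -> chain_homology E n} := @alpha_fun_sum n.

Definition beta_fun_sum n (h : chain_homology E n) : tor_sum n :=
  [ffun i => beta_ pr sC sD (tor_index i) h].

Lemma beta_fun_sum_linear n : linear (@beta_fun_sum n).
Proof. by move=> a t t'; apply/ffunP => i; rewrite !ffunE linearP. Qed.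
HB.instance Definition _ n := GRing.isLinear.Build R (chain_homology E n) (tor_sum n)
  *:%R (@beta_fun_sum n) (@beta_fun_sum_linear n).

Definition beta_sum n : {linear chain_homology E n -> tor_sum n} := @beta_fun_sum n.

Definition rho_fun_sum n (h : chain_homology E n) : tensor_sum n :=
  [ffun i => rho_ pr sC sD (tensor_index i) h].

Lemma rho_fun_sum_linear n : linear (@rho_fun_sum n).
Proof. by move=> a t t'; apply/ffunP => i; rewrite !ffunE linearP. Qed.
HB.instance Definition _ n := GRing.isLinear.Build R (chain_homology E n) (tensor_sum n)
  *:%R (@rho_fun_sum n) (@rho_fun_sum_linear n).

Definition rho_sum n : {linear chain_homology E n -> tensor_sum n} := @rho_fun_sum n.

Theorem kuenneth_split_exact n : split_short_exact (alpha_sum n) (beta_sum n).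
Proof.
apply: (split_short_exactP (r := rho_sum n)).
- move=> t; apply/ffunP => i; rewrite ffunE -[alpha_sum n t]/(alpha_fun_sum t).
  rewrite linear_sum (bigD1 i) // rho_alpha big1; first exact: addr0.
  by move=> i' ii; rewrite rho_alpha0 // eq_sym.
- move=> h; split=> [b0|[t <-]]; last first.
    apply/ffunP => i; rewrite !ffunE linear_sum big1 // => i' _.
    exact: beta_alpha0.
  exists (rho_sum n h); rewrite [RHS](@beta_exact n h).
    by apply: eq_bigr => i _; rewrite ffunE.
  move=> i j e; have lin : (i < n)%N by lia.
  have ej : j = (n - Ordinal lin - 1)%N by rewrite /=; lia.
  have := congr1 (fun t : tor_sum n => t (Ordinal lin)) b0; rewrite !ffunE.
  rewrite [nat_of_ord _]/= in ej; move: e; rewrite {}ej => e.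
  by rewrite (eq_irrelevance e (tor_index (Ordinal lin))).
- move=> t.
  have hP (i : 'I_n) := beta_surj pr sC sD (tor_index i) (t i).
  exists (\sum_i sval (cid (hP i))); apply/ffunP => i; rewrite ffunE linear_sum.
  rewrite (bigD1 i) // big1; first by have [bt _]
    := svalP (cid (hP i)); rewrite bt; apply: addr0.
  move=> i' ii; have [_] := svalP (cid (hP i')); apply.
  by rewrite eq_sym.
Qed.

End KuennethTheorem.

(** * Naturality for maps of product data *)

Section Naturality.
Variables (R : comNzRingType) (C D E C' D' E' : chain_complex R).
Variables (pr : product_datum C D E) (sC : splitting C) (sD : splitting D).
Variables (pr' : product_datum C' D' E') (sC' : splitting C') (sD' : splitting D').
Hypotheses (fC : forall i, finite_retract (C i)) (fD : forall i, finite_retract (D i)).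
Variables (f : chain_map C C') (g : chain_map D D') (h : chain_map E E').
Hypothesis muh : forall n i j x, (i + j)%N = n ->
  h n (pr_mu pr n i j x) = pr_mu pr' n i j (tensor_map (f i) (g j) x).

Lemma pi_natural n i j w : (i + j)%N = n ->
  pr_pi pr' n i j (h n w) = tensor_map (f i) (g j) (pr_pi pr n i j w).
Proof.
move=> ijn; move: w.
apply: (@pr_ext _ _ _ _ pr _ _ (pr_pi pr' n i j \o h n)
  (tensor_map (f i) (g j) \o pr_pi pr n i j)) => a b x abn.
rewrite -[LHS]/(pr_pi pr' n i j (h n _)) -[RHS]/(tensor_map _ _ (pr_pi pr n i j _)) muh //.
have [ia|ia] := eqVneq i a; last by rewrite !pr_pi_mu0 ?linear0.
have ej : j = b by lia.
by subst a b; rewrite !pr_pi_mu.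
Qed.

Lemma alpha_natural n i j (ijn : (i + j)%N = n) x :
  alpha_ pr' ijn (tensor_map (chain_homology_map f i) (chain_homology_map g j) x) =
  chain_homology_map h n (alpha_ pr ijn x).
Proof.
move: x; apply: (@tensor_ext _ _ _ _
  (alpha_ pr' ijn \o tensor_map (chain_homology_map f i) (chain_homology_map g j))
  (chain_homology_map h n \o alpha_ pr ijn)).
elim/homology_ind => c dc; elim/homology_ind => c' dc'.
rewrite -[LHS]/(alpha_ pr' ijn (tensor_map _ _ _)).
rewrite -[RHS]/(chain_homology_map h n (alpha_ pr ijn _)) tensor_mapE alpha_E.
have dfc : chain_d C' i (f i c) = 0 by rewrite -chain_comm dc linear0.
have dgc : chain_d D' j (g j c') = 0 by rewrite -chain_comm dc' linear0.
have dh : chain_d E' n (h n (pr_mu pr n i j (tpure c c'))) = 0.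
  by rewrite -chain_comm mu_cycle ?linear0.
rewrite (homology_map_cyc _ _ dc dfc) (homology_map_cyc _ _ dc' dgc).
rewrite (homology_map_cyc _ _ _ dh) alpha_E; apply: hclass_eq; exists 0.
by rewrite linear0 muh // tensor_mapE subrr.
Qed.

(** Restricted to cycles: elsewhere [sp_psi] depends on the chosen splitting, which a chain map need
    not respect. *)
Lemma psi_natural (K K' : chain_complex R) (s : splitting K) (s' : splitting K')
    (k : chain_map K K') i c : chain_d K i c = 0 ->
  sp_psi s' i (k i c) = chain_homology_map k i (sp_psi s i c).
Proof.
move=> dc; have dkc : chain_d K' i (k i c) = 0 by rewrite -chain_comm dc linear0.
by rewrite (sp_psiE s dc) (sp_psiE s' dkc); apply/esym/homology_map_cyc.
Qed.

(** Comparison maps are unique up to homotopy, and the homotopy terms vanish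
    on the components of a cycle. *)
Lemma beta_natural n i j (ijn : (i + j).+1 = n) x :
  beta_ pr' sC' sD' ijn (chain_homology_map h n x) =
  tor1_map (chain_homology_map f i) (chain_homology_map g j) (beta_ pr sC sD ijn x).
Proof.
elim/homology_ind: x => w dw.
have dhw : chain_d E' n (h n w) = 0 by rewrite -chain_comm dw linear0.
rewrite [X in beta_ _ _ _ _ X](homology_map_cyc _ _ dw dhw) !beta_E.
set fi := chain_homology_map f i; set gj := chain_homology_map g j.
rewrite [RHS]homology_mapE; apply/subr0_eq; rewrite -linearB; apply/hclass_eq0.
pose x := pr_pi pr n i.+1 j w.
suff [s sP] : exists s, tensor_map (res_d2 _) idfun s =
    tensor_map (sp_phi sC' i) (sp_psi sD' j) (tensor_map (f i.+1) (g j) x) -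
    tensor_map (res_map1 fi) gj (tensor_map (sp_phi sC i) (sp_psi sD j) x).
  by exists s; rewrite sP -pi_natural.
(* The two degree 0 maps have equal augmentation only on cycles, so both are precomposed with [q];
   on boundaries this changes nothing. *)
pose q := sp_q sC i.
have qd c : q (chain_d C i.+1 c) = chain_d C i.+1 c by rewrite /q sp_q_cycle ?chain_dd.
have [|||||H [l HP]] := @resolution_homotopy R _ _ _ (chain_d C i.+1)
  (sp_lam sC' i \o f i \o q) (res_map0 fi \o sp_lam sC i \o q)
  (sp_phi sC' i \o f i.+1) (res_map1 fi \o sp_phi sC i).
- exact: finite_retract_projective.
- exact: finite_retract_projective.
- move=> c; rewrite -[LHS]/(res_aug _ (sp_lam sC' i (f i (q c)))).
  rewrite -[RHS]/(res_aug _ (res_map0 fi (sp_lam sC i (q c)))).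
  by rewrite sp_lamP -res_map0P sp_lamP (psi_natural sC) ?sp_dq.
- move=> c; rewrite -[LHS]/(res_d1 _ (sp_phi sC' i (f i.+1 c))) sp_phiP.
  by rewrite -[RHS]/(sp_lam sC' i (f i (q _))) qd -[in LHS]chain_comm.
- move=> c; rewrite -[LHS]/(res_d1 _ (res_map1 fi (sp_phi sC i c))) -res_map1P.
  by rewrite sp_phiP -[RHS]/(res_map0 fi (sp_lam sC i (q _))) qd.
pose psig : {linear D j -> chain_homology D' j} := sp_psi sD' j \o g j.
exists (tensor_map l psig x).
rewrite (tensor_map_comp (f := f i.+1) (g := g j) (F := sp_phi sC' i \o f i.+1) (G := psig)) //.
rewrite (tensor_map_comp (f := l) (g := psig) (F := res_d2 _ \o l) (G := psig)) //.
pose rphi := res_map1 fi \o sp_phi sC i : {linear _ -> _}.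
pose gpsi := gj \o sp_psi sD j : {linear _ -> _}.
rewrite (tensor_map_comp (F := rphi) (G := gpsi)) //.
rewrite (tensor_mapDl (f := sp_phi sC' i \o f i.+1) (f1 := rphi \+ (H \o chain_d C i.+1))
  (f2 := res_d2 _ \o l)) //.
rewrite (tensor_mapDl (f := rphi \+ (H \o chain_d C i.+1)) (f1 := rphi)
  (f2 := H \o chain_d C i.+1)) //.
(* The homotopy term passes through the boundary on the left, and [psig] kills boundaries on the
   right. *)
rewrite [tensor_map (H \o _) _ _](@pi_cycle_cross _ _ _ _ pr n i j w _ _ H) //; last first.
  by move=> c; rewrite -[LHS]/(sp_psi sD' j (g j _)) (@chain_comm _ _ _ g j.+1) sp_psi_d.
rewrite addr0 addrAC [X in _ = X + _](_ : _ = 0) ?add0r //.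
(* The failure of naturality of [sp_psi] vanishes on cycles, so it factors through [sp_e], as does
   [rphi]; [pi_cycle_ee] then finishes. *)
pose chi : {linear D j -> chain_homology D' j} := psig \- gpsi.
have chie c : chi (sp_e sD j c) = chi c.
  apply/subr0_eq; rewrite -linearB -[LHS]/(sp_psi sD' j (g j _) - gj (sp_psi sD j _)).
  by rewrite (psi_natural sD) ?subrr // linearB sp_de subrr.
rewrite (tensor_mapDr rphi (g := psig) (g1 := chi) (g2 := gpsi)) ?addrK //; last first.
  by move=> c; rewrite -[chi c]/(psig c - gpsi c) subrK.
have ijn' : (i.+1 + j)%N = n by rewrite -ijn.
rewrite -(tensor_map_comp (f := sp_e sC i.+1) (g := sp_e sD j) (f' := rphi) (g' := chi)
  (F := rphi) (G := chi)) //.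
  by rewrite (pi_cycle_ee pr sC sD fC fD dw ijn') linear0.
by move=> c; rewrite -[LHS]/(res_map1 fi (sp_phi sC i _)) sp_phi_e.
Qed.

End Naturality.

(** * Shuffles of paths *)

Section ListChains.
Variables (R : comNzRingType) (V : choiceType).

(** All sequences of all lengths, regular or not, so that recursion on lists meets no degree or
    regularity condition; [lproj] cuts down to regular chains afterwards. *)
Definition lchain : lmodType R := {freeg (seq V) / R}.

Definition lcons (x : V) : {linear lchain -> lchain} := free_map R (cons x).

Lemma lconsE x s : lcons x (fgen s) = fgen (x :: s).
Proof. exact: free_liftE. Qed.

(** The augmented boundary: a single vertex has the empty sequence as its face. *)
Fixpoint lbd_gen (s : seq V) : lchain :=
  if s is x :: s' then fgen s' - lcons x (lbd_gen s') else 0.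

Definition lbd : {linear lchain -> lchain} := free_lift lbd_gen.

Lemma lbdE s : lbd (fgen s) = lbd_gen s.
Proof. exact: free_liftE. Qed.

Lemma lbd_gen1 x : lbd_gen [:: x] = fgen [::].
Proof. by rewrite /= linear0 subr0. Qed.

Lemma lbd_lcons x u : lbd (lcons x u) = u - lcons x (lbd u).
Proof.
move: u; apply: (@free_ext _ _ _ (lbd \o lcons x) (idfun \- (lcons x \o lbd))) => s.
rewrite -[LHS]/(lbd (lcons x _)) -[RHS]/(fgen s - lcons x (lbd (fgen s))).
by rewrite lconsE !lbdE.
Qed.

Lemma lbd_gen_sum s : lbd_gen s = \sum_(q < size s) (-1) ^+ q *: fgen (del q s).
Proof.
elim: s => [|x s IH]; first by rewrite big_ord0.
rewrite /= big_ord_recl /= expr0 scale1r del_cons0 IH linear_sum /= -sumrN.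
congr (_ + _); apply: eq_bigr => q _.
by rewrite linearZ_LR lconsE /bump add1n exprS mulN1r scaleNr del_consS.
Qed.

Lemma lbd_gen_ext (M : lmodType R) (f g : {linear lchain -> M}) s :
  (forall v, (size v).+1 = size s -> f (fgen v) = g (fgen v)) ->
  f (lbd_gen s) = g (lbd_gen s).
Proof.
move=> fg; rewrite lbd_gen_sum !linear_sum; apply: eq_bigr => q _.
rewrite !linearZ_LR; congr (_ *: _); apply: fg.
by rewrite size_del // prednK // (leq_ltn_trans _ (ltn_ord q)).
Qed.

End ListChains.

Section Shuffles.
Variables (R : comNzRingType) (X Y : choiceType).
Local Notation L := (lchain R).

(** The recursion is on the first step of the staircase. A vertical step contributes a sign for each
    horizontal step still to come, that is, for each square to its right in its row. *)
Fixpoint shuffle (s : seq X) : seq Y -> L (X * Y)%type :=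
  if s is x :: s' then fix shuffle_x t :=
    if t is y :: t' then
      if nilp s' && nilp t' then fgen [:: (x, y)] else
      lcons R (x, y) (shuffle s' t + (-1) ^+ size s' *: shuffle_x t')
    else 0
  else fun=> 0.

Lemma shuffle0s t : shuffle [::] t = 0. Proof. by []. Qed.
Lemma shuffles0 s : shuffle s [::] = 0. Proof. by case: s. Qed.
Lemma shuffle11 x y : shuffle [:: x] [:: y] = fgen [:: (x, y)].
Proof. by []. Qed.

Lemma shuffle_cons x s y t : (0 < size s + size t)%N ->
  shuffle (x :: s) (y :: t) =
  lcons R (x, y) (shuffle s (y :: t) + (-1) ^+ size s *: shuffle (x :: s) t).
Proof. by case: s => [|? ?] //; case: t. Qed.

Definition shufflel t : {linear L X -> L (X * Y)%type} := free_lift (shuffle^~ t).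
Definition shuffler s : {linear L Y -> L (X * Y)%type} := free_lift (shuffle s).

Lemma shufflelE t s : shufflel t (fgen s) = shuffle s t. Proof. exact: free_liftE. Qed.
Lemma shufflerE s t : shuffler s (fgen t) = shuffle s t. Proof. exact: free_liftE. Qed.

Lemma shufflel_lcons x y s t : (0 < size s)%N -> (2 < size s + size t + 1)%N || (0 < size t)%N ->
  shufflel (y :: t) (lcons R x (lbd_gen R s)) =
  lcons R (x, y) (shufflel (y :: t) (lbd_gen R s) +
    (-1) ^+ (size s).-1 *: shufflel t (lcons R x (lbd_gen R s))).
Proof.
move=> s0 st; apply: (@lbd_gen_ext _ _ _ (shufflel (y :: t) \o lcons R x)
  (lcons R (x, y) \o (shufflel (y :: t) \+
    ((-1) ^+ (size s).-1 \*: (shufflel t \o lcons R x))))) => v sv.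
rewrite -[LHS]/(shufflel (y :: t) (lcons R x _)).
rewrite -[RHS]/(lcons R (x, y) (shufflel (y :: t) _ + _ *: shufflel t (lcons R x _))).
rewrite lconsE !shufflelE shuffle_cons -?sv //; lia.
Qed.

Lemma shuffler_lcons x y s t : (0 < size t)%N -> (1 < size s + size t)%N ->
  shuffler (x :: s) (lcons R y (lbd_gen R t)) =
  lcons R (x, y) (shuffler s (lcons R y (lbd_gen R t)) +
    (-1) ^+ size s *: shuffler (x :: s) (lbd_gen R t)).
Proof.
move=> s0 st; apply: (@lbd_gen_ext _ _ _ (shuffler (x :: s) \o lcons R y)
  (lcons R (x, y) \o ((shuffler s \o lcons R y) \+
    ((-1) ^+ (size s) \*: shuffler (x :: s))))) => v sv.
rewrite -[LHS]/(shuffler (x :: s) (lcons R y _)).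
rewrite -[RHS]/(lcons R (x, y) (shuffler s (lcons R y _) + _ *: shuffler (x :: s) _)).
rewrite lconsE !shufflerE shuffle_cons //; lia.
Qed.

(** Peeling off the first vertex reduces to shorter sequences. Two single vertices are excluded: the
    boundary of their shuffle is the empty sequence, while shuffles with an empty sequence are 0. *)
Lemma shuffle_leibniz s t : (0 < size s)%N -> (0 < size t)%N ->
  (2 < size s + size t)%N ->
  lbd R _ (shuffle s t) = shufflel t (lbd_gen R s) +
     (-1) ^+ (size s).-1 *: shuffler s (lbd_gen R t).
Proof.
have [k] := ubnP (size s + size t); elim: k s t => // k IH [//|x s] [//|y t].
rewrite ltnS [size (x :: s)]/= [size (y :: t)]/= => stk _ _ st.
rewrite shuffle_cons; last by lia.
rewrite lbd_lcons.
rewrite -[lbd_gen R (x :: s)]/(fgen s - lcons R x (lbd_gen R s)).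
rewrite -[lbd_gen R (y :: t)]/(fgen t - lcons R y (lbd_gen R t)).
rewrite [shufflel _ (_ - _)]linearB [shuffler _ (_ - _)]linearB shufflelE shufflerE.
rewrite scalerBr addrACA -opprD [(size (x :: s)).-1]/=; congr (_ - _).
case: s stk st => [|x1 s] stk st.
  rewrite [lbd_gen R [::]]/= shuffle0s !linear0 !add0r expr0 !scale1r.
  case: t stk st => [|y1 [|y2 t]] stk st; first by [].
    by rewrite shuffle11 lbdE !lbd_gen1 !lconsE shufflerE.
  rewrite IH // lbd_gen1 shufflelE shuffle0s add0r [size _]/= expr0 scale1r.
  rewrite shuffler_lcons //.
  rewrite [shuffler [::] _](_ : _ = 0) ?add0r ?expr0 ?scale1r //.
  apply: (@lbd_gen_ext _ _ _ (shuffler [::] \o lcons R y) \0) => v _.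
  by rewrite -[LHS]/(shuffler [::] (lcons R y _)) lconsE shufflerE.
case: t stk st => [|y1 t] stk st.
  rewrite [lbd_gen R [::]]/= shuffles0 !linear0 !addr0.
  case: s stk st => [|x2 s] stk st.
    by rewrite shuffle11 lbdE !lbd_gen1 !lconsE shufflelE.
  rewrite IH //; last by rewrite /= addn1 in stk *; lia.
  rewrite lbd_gen1 shufflerE shuffles0 scaler0 addr0 shufflel_lcons //; last by rewrite /=; lia.
  rewrite [X in _ *: X](_ : _ = 0) ?scaler0 ?addr0 //.
  apply: (@lbd_gen_ext _ _ _ (shufflel [::] \o lcons R x) \0) => v _.
  by rewrite -[LHS]/(shufflel [::] (lcons R x _)) lconsE shufflelE shuffles0.
have s1_0 : (0 < size (x1 :: s))%N by []; have t1_0 : (0 < size (y1 :: t))%N by [].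
move: (x1 :: s) (y1 :: t) s1_0 t1_0 stk st => s1 t1 s1_0 t1_0 stk st.
rewrite shufflel_lcons ?t1_0 ?orbT // shuffler_lcons //; last by lia.
rewrite linearD linearZ_LR !IH //; try (rewrite /=; lia).
rewrite -[lbd_gen R (x :: s1)]/(fgen s1 - lcons R x (lbd_gen R s1)).
rewrite -[lbd_gen R (y :: t1)]/(fgen t1 - lcons R y (lbd_gen R t1)).
rewrite [shufflel _ (_ - _)]linearB [shuffler _ (_ - _)]linearB shufflelE shufflerE.
rewrite [(size (x :: s1)).-1]/= -(linearZ_LR (lcons R (x, y))).
rewrite -(linearD (lcons R (x, y))); congr (lcons _ _ _).
have -> : (size s1) = (size s1).-1.+1 by lia.
move: (size s1).-1 => a.
(* The shuffle of both tails, [F], arises twice with opposite signs: it comes from the two ways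
   round the first square, and its terms are the diagonal ones. *)
move: (shufflel _ _) (shufflel _ _) (shuffler _ _) (shuffler _ _) (shuffle _ _) => A B C D F.
rewrite [a.+1.-1]/= !exprS !mulN1r !scaleNr !scalerDr !scalerN !opprD !opprK signrZK.
rewrite -!addrA; congr (B + _); rewrite addrCA [X in _ + X = _]addrA subrr add0r.
exact: addrCA.
Qed.

(** The staircases that can occur in [shuffle], without signs or lattice coordinates. *)
Inductive is_shuffle : seq X -> seq Y -> seq (X * Y) -> Prop :=
| IsShuffle1 x y : is_shuffle [:: x] [:: y] [:: (x, y)]
| IsShuffleH x s y t z : is_shuffle s (y :: t) z ->
    is_shuffle (x :: s) (y :: t) ((x, y) :: z)
| IsShuffleV x s y t z : is_shuffle (x :: s) t z ->
    is_shuffle (x :: s) (y :: t) ((x, y) :: z).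

Lemma shuffle_sub (M : lmodType R) (W : submodClosed M)
    (f : {linear L (X * Y)%type -> M}) s t :
  (forall z, is_shuffle s t z -> f (fgen z) \in W) -> f (shuffle s t) \in W.
Proof.
have [k] := ubnP (size s + size t); elim: k s t f => // k IH [|x s] [|y t] f;
  rewrite ?shuffle0s ?shuffles0 ?linear0 ?rpred0 //.
rewrite ltnS [size (x :: s)]/= [size (y :: t)]/= => stk fW.
have [st0|st0] := posnP (size s + size t).
  have -> : s = [::] by apply/size0nil; lia.
  have -> : t = [::] by apply/size0nil; lia.
  rewrite shuffle11; apply: fW.
  have -> : s = [::] by apply/size0nil; lia.
  have -> : t = [::] by apply/size0nil; lia.
  exact: IsShuffle1.
rewrite shuffle_cons // linearD linearD !linearZ_LR rpredD ?rpredZ //.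
  apply: (IH _ _ (f \o lcons R (x, y))) => [|z sz]; first by rewrite /=; lia.
  suff: f (lcons R (x, y) (fgen z)) \in W by [].
  by rewrite lconsE; apply/fW/IsShuffleH.
apply: (IH _ _ (f \o lcons R (x, y))) => [|z sz]; first by rewrite /=; lia.
suff: f (lcons R (x, y) (fgen z)) \in W by [].
by rewrite lconsE; apply/fW/IsShuffleV.
Qed.

Lemma shuffle_ext (M : lmodType R) (f g : {linear L (X * Y)%type -> M}) s t :
  (forall z, is_shuffle s t z -> f (fgen z) = g (fgen z)) ->
  f (shuffle s t) = g (shuffle s t).
Proof.
move=> fg; apply/subr0_eq.
have := @shuffle_sub _ (kerp (idfun : {linear M -> M})) (f \- g) s t.
rewrite inE => H; apply/eqP/H => z /fg; rewrite inE /= => ->.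
by rewrite subrr.
Qed.
End Shuffles.

(** * Step-like paths, their projections and corner flips *)

Section Dedup.
Variable V : eqType.

(** Projecting a staircase to one factor repeats a vertex at each step in the other direction;
    removing consecutive repetitions recovers a regular path. *)
Fixpoint dedup (s : seq V) : seq V :=
  if s is x :: s' then
    if s' is y :: _ then if x == y then dedup s' else x :: dedup s' else [:: x]
  else [::].

Lemma dedup_cons x s : exists u, dedup (x :: s) = x :: u.
Proof.
elim: s x => [|y s IH] x; first by exists [::].
rewrite -[dedup [:: x, y & s]]/(if x == y then dedup (y :: s) else x :: dedup (y :: s)).
by case: eqVneq => [->|_]; [apply: IH|exists (dedup (y :: s))].
Qed.

Lemma regular_seq_cons x y (s : seq V) :
  regular_seq [:: x, y & s] = (x != y) && regular_seq (y :: s).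
Proof. by []. Qed.

Lemma regular_dedup s : regular_seq (dedup s).
Proof.
elim: s => [|x [|y s] IH] //.
rewrite -[dedup [:: x, y & s]]/(if x == y then dedup (y :: s) else x :: dedup (y :: s)).
case: eqVneq => // xy; have [u eu] := dedup_cons y s.
by move: IH; rewrite eu /regular_seq /= xy.
Qed.

End Dedup.

Section StepPaths.
Variables (X Y : choiceType).
Implicit Types (z : seq (X * Y)) (c p q r : X * Y).

Definition axis_step : rel (X * Y) := [rel p q | (p.1 == q.1) (+) (p.2 == q.2)].
Definition step_like z := sorted axis_step z.
Definition xproj z := dedup (map fst z).
Definition yproj z := dedup (map snd z).

Lemma xproj_cons c p z : xproj [:: c, p & z] =
  if c.1 == p.1 then xproj (p :: z) else c.1 :: xproj (p :: z).
Proof. by []. Qed.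

Lemma yproj_cons c p z : yproj [:: c, p & z] =
  if c.2 == p.2 then yproj (p :: z) else c.2 :: yproj (p :: z).
Proof. by []. Qed.

Lemma xproj_head c z : exists u, xproj (c :: z) = c.1 :: u.
Proof. exact: dedup_cons. Qed.

Lemma yproj_head c z : exists u, yproj (c :: z) = c.2 :: u.
Proof. exact: dedup_cons. Qed.

Lemma step_like_cons c p z :
  step_like [:: c, p & z] = ((c.1 == p.1) (+) (c.2 == p.2)) && step_like (p :: z).
Proof. by []. Qed.

Lemma step_like_regular z : step_like z -> regular_seq z.
Proof.
by apply: sub_sorted => p q /=; apply: contraTN => /eqP ->; rewrite /axis_step /= !eqxx.
Qed.

Lemma is_shuffle_head s t z : is_shuffle s t z -> exists x s' y t' z',
  [/\ s = x :: s', t = y :: t' & z = (x, y) :: z'].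
Proof.
case=> {s t z}[x y|x s y t z _|x s y t z _].
- by exists x, [::], y, [::], [::].
- by exists x, s, y, t, z.
- by exists x, s, y, t, z.
Qed.

Lemma is_shuffle_proj s t z : is_shuffle s t z -> regular_seq s -> regular_seq t ->
  [/\ step_like z, xproj z = s & yproj z = t].
Proof.
elim=> {s t z}[x y|x s y t z sz IH|x s y t z sz IH] rs rt //.
  move: sz IH rs => /is_shuffle_head[x1 [s' [y1 [t' [z' [-> [ey et] ->]]]]]] IH.
  subst y1 t'.
  rewrite regular_seq_cons => /andP[xx1 rs]; have [//|sl p1 p2] := IH rs.
  by rewrite step_like_cons xproj_cons yproj_cons /= (negPf xx1) eqxx p1 p2.
move: sz IH rt => /is_shuffle_head[x1 [s' [y1 [t' [z' [[ex es] -> ->]]]]]] IH.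
subst x1 s'.
rewrite regular_seq_cons => /andP[xx1 rt]; have [//|//|sl p1 p2] := IH.
by rewrite step_like_cons xproj_cons yproj_cons /= (negPf xx1) eqxx p1 p2.
Qed.

Lemma step_like_shuffle c z : step_like (c :: z) ->
  is_shuffle (xproj (c :: z)) (yproj (c :: z)) (c :: z).
Proof.
elim: z c => [|p z IH] [x y] //; first by move=> _; apply: IsShuffle1.
rewrite step_like_cons xproj_cons yproj_cons => /andP[cp /IH].
have [u ->] := xproj_head p z; have [v ->] := yproj_head p z.
case: p cp => a b /=; case: (eqVneq x a) => [<-|_] /=; last first.
  by move/eqP=> ->; rewrite eqxx => H; apply: IsShuffleH.
by move=> /negPf -> H; apply: IsShuffleV.
Qed.

(** Turns the inductive relation into a boolean test. The empty sequence passes the test with empty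
    projections but is no shuffle, hence the condition on [s]. *)
Lemma is_shuffleP s t z : s != [::] -> regular_seq s -> regular_seq t ->
  is_shuffle s t z <-> [&& step_like z, xproj z == s & yproj z == t].
Proof.
move=> s0 rs rt; split=> [/is_shuffle_proj[]// -> -> ->|]; first by rewrite !eqxx.
case: z => [|c z] /and3P[sl /eqP es /eqP et]; first by rewrite -es in s0.
by rewrite -es -et; apply: step_like_shuffle.
Qed.

Lemma size_shuffle s t z : is_shuffle s t z -> (size z).+1 = (size s + size t)%N.
Proof. by elim=> {s t z} //= x s y t z _ ->; rewrite /=; lia. Qed.

(** The number of unit squares below the lattice path. *)
Fixpoint inversions z : nat :=
  if z is c :: z' then
    if z' is p :: _ then (if c.1 == p.1 then (size (xproj z')).-1 else 0) + inversions z'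
    else 0
  else 0.

Lemma inversions_cons c p z : inversions [:: c, p & z] =
  ((if c.1 == p.1 then (size (xproj (p :: z))).-1 else 0) + inversions (p :: z))%N.
Proof. by []. Qed.

(** By regularity the second vertex tells which branch of the recursion a staircase comes from, so
    each occurs once and its signs accumulate to the inversion count. *)
Lemma shuffle_coef (R : comNzRingType) s t z : is_shuffle s t z ->
  regular_seq s -> regular_seq t ->
  fcoef z (shuffle R s t) = (-1) ^+ inversions z :> R.
Proof.
have cons_coef c (z' : seq (X * Y)) (u : lchain R (X * Y)%type) :
    fcoef (c :: z') (lcons R c u) = fcoef z' u :> R.
  move: u; apply: (@free_ext _ _ _ (fcoef (c :: z') \o lcons R c) (fcoef z')) => v.
  rewrite -[LHS]/(fcoef _ (lcons R c _)) lconsE !fcoef_gen.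
  by rewrite eqseq_cons eqxx.
have coef0 s' t' z' : ~ is_shuffle s' t' z' -> fcoef z' (shuffle R s' t') = 0 :> R.
  move=> nz; rewrite (@shuffle_ext _ _ _ _ _ \0) // => v sv; rewrite fcoef_gen.
  by case: eqVneq => // ev; rewrite ev in sv.
elim=> {s t z}[x y|x s y t z sz IH|x s y t z sz IH] rs rt.
- by rewrite shuffle11 fcoef_gen eqxx.
- have [x1 [s' [y1 [t' [z' [es [_ _] ez]]]]]] := is_shuffle_head sz.
  have st0 : (0 < size s + size t)%N by rewrite es.
  rewrite shuffle_cons // cons_coef linearD linearZ_LR [X in _ + _ *: X]coef0; last first.
    move=> /is_shuffle_head[x2 [s2 [y2 [t2 [z2 [[ex _] _ ez2]]]]]].
    move: rs; rewrite es regular_seq_cons => /andP[/eqP[]].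
    by move: ez; rewrite ez2 => -[<- _].
  move: rs; rewrite es regular_seq_cons => /andP[xx1 rs].
  rewrite scaler0 addr0 -es IH ?es //; rewrite ez inversions_cons.
  by rewrite [(x, y).1]/= [(x1, y1).1]/= (negPf xx1).
- have [x1 [s' [y1 [t' [z' [[ex es] et ez]]]]]] := is_shuffle_head sz.
  have st0 : (0 < size s + size t)%N by rewrite et addnS.
  rewrite shuffle_cons // cons_coef linearD linearZ_LR [X in X + _]coef0; last first.
    move=> /is_shuffle_head[x2 [s2 [y2 [t2 [z2 [_ [ey _] ez2]]]]]].
    move: rt; rewrite et regular_seq_cons => /andP[/eqP[]].
    by move: ez; rewrite ez2 => -[_ <-].
  have rt' : regular_seq t by move: rt; rewrite et regular_seq_cons => /andP[].
  have [_ p1 _] := is_shuffle_proj sz rs rt'.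
  rewrite add0r IH // [in RHS]ez inversions_cons -ez p1 ex eqxx exprD.
  by [].
Qed.

Fixpoint L_shaped z : bool :=
  if z is c :: z' then
    if z' is p :: _ then if c.1 == p.1 then size (xproj z') == 1%N else L_shaped z'
    else true
  else true.

Lemma L_shaped_cons c p z : L_shaped [:: c, p & z] =
  if c.1 == p.1 then size (xproj (p :: z)) == 1%N else L_shaped (p :: z).
Proof. by []. Qed.

Lemma L_shaped_vertical z : size (xproj z) = 1%N -> L_shaped z.
Proof.
elim: z => [|c [|p z] IH] //; rewrite xproj_cons L_shaped_cons.
case: eqVneq => [_ -> //|_ [/size0nil]].
by have [u ->] := xproj_head p z.
Qed.

Lemma L_shaped_inversions z : L_shaped z -> inversions z = 0%N.
Proof.
elim: z => [|c [|p z] IH] //; rewrite inversions_cons L_shaped_cons.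
by case: eqVneq => [_ /eqP s1|_ /IH]; rewrite // s1 IH // L_shaped_vertical.
Qed.

(** The first step is forced: an L-shaped path starts vertically only if its first projection is a
    single vertex. *)
Lemma L_shaped_uniq z z' : step_like z -> step_like z' -> L_shaped z -> L_shaped z' ->
  xproj z = xproj z' -> yproj z = yproj z' -> z = z'.
Proof.
elim: z z' => [|c z IH] [|c' z'] //.
- by have [u ->] := xproj_head c' z'.
- by have [u ->] := xproj_head c z.
move=> sz sz' Lz Lz' e1 e2; have ec : c = c'.
  move: e1 e2; have [? ->] := xproj_head c z; have [? ->] := yproj_head c z.
  have [? ->] := xproj_head c' z'; have [? ->] := yproj_head c' z'.
  by case: c {sz Lz} => ? ?; case: c' {sz' Lz'} => ? ? /= [-> _] [-> _].
subst c'; congr (_ :: _); case: z z' IH sz sz' Lz Lz' e1 e2 => [|p z] [|p' z'] IH //.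
- rewrite step_like_cons xproj_cons yproj_cons => _ /andP[cp _] _ _; move: cp.
  by have [? ->] := xproj_head p' z'; have [? ->] := yproj_head p' z'; do 2!case: eqVneq.
- rewrite step_like_cons xproj_cons yproj_cons => /andP[cp _] _ _ _; move: cp.
  by have [? ->] := xproj_head p z; have [? ->] := yproj_head p z; do 2!case: eqVneq.
rewrite !step_like_cons !xproj_cons !yproj_cons !L_shaped_cons.
move=> /andP[cp sz] /andP[cp' sz'].
case: (eqVneq c.1 p.1) cp => cp1; case: (eqVneq c.1 p'.1) cp' => cp1' /=.
- move=> /negPf -> /negPf -> /eqP/L_shaped_vertical Lz /eqP/L_shaped_vertical Lz' e1 [e2].
  exact: IH.
- move=> _ _ /eqP s1 _ e1; move: s1; rewrite e1 /= => -[/size0nil].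
  by have [? ->] := xproj_head p' z'.
- move=> _ _ _ /eqP s1 e1; move: s1; rewrite -e1 /= => -[/size0nil].
  by have [? ->] := xproj_head p z.
- by move=> -> -> Lz Lz' [e1] e2; apply: IH.
Qed.

(** The corner sits at the last vertical step that has a horizontal step somewhere after it: the
    path beyond is L-shaped and not purely vertical, so it begins horizontally. *)
Lemma not_L_shaped z : step_like z -> ~~ L_shaped z -> exists u a b b' a' v,
  z = u ++ [:: (a, b), (a, b'), (a', b') & v] /\ a != a' /\ b != b'.
Proof.
elim: z => [|c [|p z] IH] //; rewrite step_like_cons L_shaped_cons => /andP[cp sz].
have [cp1|cp1 Lz] := eqVneq c.1 p.1; last first.
  by have [u [a [b [b' [a' [v [-> abn]]]]]]] := IH sz Lz; exists (c :: u), a, b, b', a', v.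
case: (boolP (L_shaped (p :: z))) => [Lz s1|Lz _]; last first.
  by have [u [a [b [b' [a' [v [-> abn]]]]]]] := IH sz Lz; exists (c :: u), a, b, b', a', v.
case: z {IH} sz Lz s1 => [//|r z]; rewrite step_like_cons L_shaped_cons => /andP[pr _].
rewrite xproj_cons; case: eqVneq pr => [_ _ ->//|pr1 /= /eqP pr2 _ _].
exists [::], c.1, c.2, p.2, r.1, z; rewrite cp1 pr1; split; last first.
  by move: cp; rewrite cp1 eqxx.
by rewrite {2}pr2 -{1}cp1; case: c {cp cp1} => ? ?; case: p {pr1 pr2} => ? ?; case: r.
Qed.

Section Flip.
Variables (a a' : X) (b b' : Y) (v : seq (X * Y)).
Hypotheses (aa' : a != a') (bb' : b != b').
Local Notation up u := (u ++ [:: (a, b), (a, b'), (a', b') & v]).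
Local Notation down u := (u ++ [:: (a, b), (a', b), (a', b') & v]).

(** A flip stays among the shuffles of the same two paths and removes one square, which provides
    both the sign change and the induction measure. *)
Lemma flip_invariants u :
  [/\ step_like (up u) = step_like (down u), xproj (up u) = xproj (down u),
      yproj (up u) = yproj (down u) & inversions (up u) = (inversions (down u)).+1].
Proof.
have [ca ca'] : (a == a') = false /\ (b == b') = false.
  by split; apply: negbTE.
elim: u => [|c u [IHs IH1 IH2 IHi]].
  rewrite !cat0s !step_like_cons !xproj_cons !yproj_cons !inversions_cons /=.
  rewrite !xproj_cons !eqxx ca ca' /=; split=> //.
  have [w ->] := xproj_head (a', b') v; rewrite /= add0n; lia.
case: u IHs IH1 IH2 IHi => [|d u] IHs IH1 IH2 IHi.
  move: IHs IH1 IH2 IHi; rewrite !cat1s !cat0s => IHs IH1 IH2 IHi.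
  rewrite !(step_like_cons c) !(xproj_cons c) !(yproj_cons c) !(inversions_cons c).
  by rewrite IHs IH1 IH2 IHi; split=> //; rewrite addnS.
move: IHs IH1 IH2 IHi; rewrite !cat_cons => IHs IH1 IH2 IHi.
rewrite !(step_like_cons c) !(xproj_cons c) !(yproj_cons c) !(inversions_cons c).
by rewrite IHs IH1 IH2 IHi; split=> //; rewrite addnS.
Qed.

Local Notation diagonal u := (u ++ [:: (a, b), (a', b') & v]).

Lemma diagonal_not_step_like u : ~~ step_like (diagonal u).
Proof.
elim: u => [|c u IH]; first by rewrite step_like_cons /= (negPf aa') (negPf bb').
by apply: contra IH => /= /path_sorted.
Qed.

Lemma diagonal_regular u : step_like (down u) -> regular_seq (diagonal u).
Proof.
elim: u => [|c [|d u] IH].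
- rewrite cat0s !step_like_cons => /and3P[_ _ /step_like_regular H].
  by rewrite regular_seq_cons H andbT xpair_eqE (negPf aa').
- rewrite cat1s step_like_cons => /andP[cp /IH H].
  rewrite cat1s regular_seq_cons H andbT; apply: contraTN cp => /eqP ->.
  by rewrite !eqxx.
rewrite !cat_cons step_like_cons regular_seq_cons => /andP[cp /IH ->].
by rewrite andbT; apply: contraTN cp => /eqP ->; rewrite !eqxx.
Qed.

(** Deleting a vertex away from the diagonal step would leave that step in [z], so the deleted
    vertex lies between its ends and must be one of the two remaining corners of the square. *)
Lemma del_diagonal u z k : step_like z -> (k < size z)%N -> del k z = diagonal u ->
  k = (size u).+1 /\ (z = up u \/ z = down u).
Proof.
elim: u z k => [|c u IH] [|d z] [|k] //.
- rewrite del_cons0 => sz _ ez; move: (path_sorted sz).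
  by rewrite ez => /(negP (diagonal_not_step_like [::])).
- rewrite del_consS => sz; rewrite ltnS => kz [ed].
  subst d; case: k kz => [|k]; case: z sz => [//|m z] sz kz; last first.
    by rewrite del_consS => -[em _]; move: sz; rewrite em step_like_cons /= (negPf aa') (negPf bb').
  rewrite del_cons0 => ez; move: sz; rewrite {}ez; case: m kz => m1 m2 kz.
  rewrite !step_like_cons /= => /and3P[s1 s2 _]; split=> //; move: s1 s2.
  case: (eqVneq a m1) => [<-|am] /=.
    by rewrite (negPf aa') => _ /eqP ->; left.
  by move=> /eqP <-; rewrite (negPf bb') addbF => /eqP ->; right.
- rewrite del_cons0 => sz _ ez; move: (path_sorted sz).
  by rewrite ez => /(negP (diagonal_not_step_like (c :: u))).
rewrite del_consS => sz; rewrite ltnS => kz [-> /(IH _ _ (path_sorted sz) kz)].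
by move=> [-> [->|->]]; split=> //; [left|right].
Qed.

Lemma del_up u : del (size u).+1 (up u) = diagonal u.
Proof. by rewrite -addn1 del_catr. Qed.

Lemma del_down u : del (size u).+1 (down u) = diagonal u.
Proof. by rewrite -addn1 del_catr. Qed.

Lemma up_neq_down u : up u != down u.
Proof. by rewrite eqseq_cat // !eqxx !eqseq_cons !xpair_eqE (negPf aa') andbF. Qed.

End Flip.

End StepPaths.

(** * Stair paths are the shuffles *)

Section StairShuffles.
Variables (X Y : choiceType).

(** The starting point (a, b) is generalised to make induction along the lattice path possible. *)
Lemma stair_is_shuffle_from (x0 : X) (y0 : Y) S T sigma a b :
  (a < size S)%N -> (b < size T)%N -> path unit_step (a, b) sigma ->
  last (a, b) sigma = ((size S).-1, (size T).-1) ->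
  is_shuffle (drop a S) (drop b T)
    [seq (nth x0 S p.1, nth y0 T p.2) | p <- (a, b) :: sigma].
Proof.
elim: sigma a b => [|c sigma IH] a b aS bT.
  move=> _ [ea eb]; rewrite (drop_nth x0 aS) (drop_nth y0 bT) !drop_oversize; try lia.
  exact: IsShuffle1.
rewrite [path _ _ _]/= => /andP[cp ps] ls; have := unit_step_le ps (mem_head _ _).
rewrite [last c sigma]ls => /and4P[_ c1 _ c2]; rewrite [map _ _]/=.
rewrite {1}(drop_nth x0 aS) {1}(drop_nth y0 bT).
case/orP: cp ps ls c1 c2 => /eqP -> ps ls c1 c2.
  by apply: IsShuffleH; rewrite -(drop_nth y0 bT); apply: IH => //; move: c1 => /=; lia.
by apply: IsShuffleV; rewrite -(drop_nth x0 aS); apply: IH => //; move: c2 => /=; lia.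
Qed.

Lemma stair_is_shuffle (x : X) s (y : Y) t sigma :
  lattice_path (size s) (size t) sigma ->
  is_shuffle (x :: s) (y :: t) (stair x s y t sigma).
Proof.
move=> /andP[ps /eqP ls].
have := @stair_is_shuffle_from x y (x :: s) (y :: t) sigma 0 0.
by rewrite !drop0; apply.
Qed.

Lemma is_shuffle_stair (S : seq X) (T : seq Y) z : is_shuffle S T z ->
  forall x s y t, S = x :: s -> T = y :: t ->
  exists2 sigma, lattice_path (size s) (size t) sigma & z = stair x s y t sigma.
Proof.
elim=> {S T z}[x y|x S y T z sz IH|x S y T z sz IH] x' s y' t.
- by move=> [<- <-] [<- <-]; exists [::].
- move=> [<- <-] [<- <-] {x' s y' t}.
  have [x1 [s [y1 [t [_ [eS [ey eT] _]]]]]] := is_shuffle_head sz; subst y1 t.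
  have [sigma ls ez] := IH _ _ _ _ eS erefl; move/andP: (ls) => [ps /eqP es].
  (* The lattice path of the tail starts at the origin again; it is shifted past the new first
     horizontal step. *)
  pose g (p : nat * nat) := (p.1.+1, p.2).
  have gs : path unit_step (g (0, 0)%N) (map g sigma).
    by apply: homo_path ps => -[? ?] [? ?]; rewrite /unit_step /g /= !xpair_eqE eqSS.
  exists (g (0, 0)%N :: map g sigma).
    rewrite /lattice_path [path _ _ _]/= gs [last _ _]/= last_map es eS.
    by rewrite /g /unit_step /= !eqxx.
  rewrite ez /stair [in RHS]map_cons; congr (_ :: _).
  rewrite -[X in _ = map _ X]/(map g ((0, 0)%N :: sigma)) -map_comp.
  apply/eq_in_map => p /(unit_step_le ps) /and4P[_ p1 _ p2] /=; congr (_, _).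
  rewrite eS; apply: set_nth_default; rewrite es in p1; exact: p1.
- move=> [<- <-] [<- <-] {x' s y' t}.
  have [x1 [s [y1 [t [_ [[ex eS] eT _]]]]]] := is_shuffle_head sz; subst x1 s.
  have [sigma ls ez] := IH _ _ _ _ erefl eT; move/andP: (ls) => [ps /eqP es].
  pose g (p : nat * nat) := (p.1, p.2.+1).
  have gs : path unit_step (g (0, 0)%N) (map g sigma).
    by apply: homo_path ps => -[? ?] [? ?]; rewrite /unit_step /g /= !xpair_eqE eqSS.
  exists (g (0, 0)%N :: map g sigma).
    rewrite /lattice_path [path _ _ _]/= gs [last _ _]/= last_map es eT.
    by rewrite /g /unit_step /= !eqxx ?orbT.
  rewrite ez /stair [in RHS]map_cons; congr (_ :: _).
  rewrite -[X in _ = map _ X]/(map g ((0, 0)%N :: sigma)) -map_comp.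
  apply/eq_in_map => p /(unit_step_le ps) /and4P[_ p1 _ p2] /=; congr (_, _).
  rewrite eT; apply: set_nth_default; rewrite es in p2; exact: p2.
Qed.
End StairShuffles.

(** * The cross product of regular chains *)

Section FreeBilinear.
Variable R : comNzRingType.
Variables (K L : choiceType) (M : lmodType R) (f : K -> L -> M).

Definition free_bilin (u : {freeg K / R}) (v : {freeg L / R}) : M :=
  free_lift (fun k => free_lift (f k) v) u.

Lemma free_bilin_linearl v : linear (free_bilin^~ v).
Proof. by move=> a u u'; rewrite /free_bilin linearP. Qed.

Lemma free_bilin_linearr u : linear (free_bilin u).
Proof.
move=> a v v'; move: u; apply: (@free_ext _ _ _ (free_lift _)
  ((a \*: free_lift (fun k => free_lift (f k) v)) \+
   free_lift (fun k => free_lift (f k) v'))) => k.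
rewrite -[RHS]/(a *: free_lift _ _ + free_lift _ _).
by rewrite !free_liftE linearP.
Qed.

Definition free_tensor_lift : {linear tensor {freeg K / R} {freeg L / R} -> M} :=
  tensor_lift free_bilin_linearl free_bilin_linearr.

Lemma free_tensor_liftE k l : free_tensor_lift (tpure (fgen k) (fgen l)) = f k l.
Proof. by rewrite tensor_liftE /free_bilin !free_liftE. Qed.

Lemma free_tensor_sub (W : submodClosed M)
    (g : {linear tensor {freeg K / R} {freeg L / R} -> M}) :
  (forall k l, g (tpure (fgen k) (fgen l)) \in W) -> forall x, g x \in W.
Proof.
move=> gW; elim/tensor_ind => [|u v|a u v gu gv].
- by rewrite linear0 rpred0.
- rewrite -[u]freeg_sumE; elim: (dom u) => [|k s IH].
    by rewrite big_nil tpure0l linear0 rpred0.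
  rewrite big_cons tpureDl linearD rpredD //.
  have -> : << coeff k u *g k >> = coeff k u *: (fgen k : {freeg K / R}).
    by apply/eqP/freeg_eqP => y; rewrite coeffZ !coeffU mul1r.
  rewrite tpureZl linearZ_LR rpredZ // -[v]freeg_sumE.
  elim: (dom v) => [|l t IHt]; first by rewrite big_nil tpure0r linear0 rpred0.
  rewrite big_cons tpureD linearD rpredD //.
  have -> : << coeff l v *g l >> = coeff l v *: (fgen l : {freeg L / R}).
    by apply/eqP/freeg_eqP => y; rewrite coeffZ !coeffU mul1r.
  by rewrite tpureZ linearZ_LR rpredZ.
- by rewrite linearP rpredD ?rpredZ.
Qed.

End FreeBilinear.

Lemma free_tensor_ext (R : comNzRingType) (K L : choiceType) (M : lmodType R)
    (g h : {linear tensor {freeg K / R} {freeg L / R} -> M}) :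
  (forall k l, g (tpure (fgen k) (fgen l)) = h (tpure (fgen k) (fgen l))) -> g =1 h.
Proof.
move=> gh x; apply/subr0_eq/eqP.
have := @free_tensor_sub R K L M (kerp (idfun : {linear M -> M})) (g \- h).
rewrite -[_ - _]/((g \- h) x) => H.
by have := H _ x; rewrite inE; apply => k l; rewrite inE /= gh subrr.
Qed.

Section Projection.
Variables (R : comNzRingType) (V : finType).

(** Kills irregular sequences and those of the wrong length, in particular the empty sequence
    created by the augmentation. *)
Definition lproj n : {linear lchain R V -> rchain R V n} := free_lift (rgen R n).

Lemma lprojE n s : lproj n (fgen s) = rgen R n s.
Proof. exact: free_liftE. Qed.

Lemma rgen_size n (s : seq V) : size s != n.+1 -> rgen R n s = 0.
Proof. by move=> ss; rewrite /rgen insubF // (negPf ss). Qed.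

Lemma lproj_bd n s : size s = n.+1 -> bd R V n (rgen R n s) = lproj n.-1 (lbd_gen R s).
Proof.
move=> ss; rewrite bd_rgen // lbd_gen_sum linear_sum ss.
case: n ss => [|n] ss.
  (* In degree 0 the only face is empty, and as [0.-1] is 0 it is discarded for its length, in
     agreement with the zero boundary there. *)
  rewrite big_ord_recl big_ord0 linearZ_LR lprojE rgen_size ?scaler0 ?addr0 //.
  by rewrite size_del ss.
by apply: eq_bigr => q _; rewrite linearZ_LR lprojE.
Qed.

Definition rpath_tuple n (t : rpath V n) : n.+1.-tuple V :=
  Tuple (proj1 (andP (valP t))).

(** Regular paths are a subtype of sequences without a finite type structure, so the module is
    exhibited as a retract of the free one on tuples. *)
Lemma rchain_finite n : finite_retract (rchain R V n).
Proof.
exists (n.+1.-tuple V : finType), (free_map R (@rpath_tuple n)),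
  (free_lift (fun w : n.+1.-tuple V => rgen R n w)) => u; move: u.
apply: (@free_ext _ _ _ (free_lift _ \o free_map R (@rpath_tuple n)) idfun) => t.
by rewrite -[LHS]/(free_lift _ (free_map R _ _)) !free_liftE rgen_val.
Qed.

End Projection.

Section PureLinear.
Variables (R : comNzRingType) (M N : lmodType R).
Definition tpurel (y : N) (x : M) : tensor M N := tpure x y.
HB.instance Definition _ y := GRing.isLinear.Build R M (tensor M N) *:%R
  (tpurel y) (@tpure_linearl R M N y).
Definition tpurer (x : M) (y : N) : tensor M N := tpure x y.
HB.instance Definition _ x := GRing.isLinear.Build R N (tensor M N) *:%R
  (tpurer x) (@tpure_linearr R M N x).
End PureLinear.

Section Cross.
Variables (R : comNzRingType) (X Y : finType).
Local Notation "x (x) y" := (tpure x y) (at level 35).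

Lemma shuffle_rgen n s t : size s + size t = n.+2 ->
  ~~ regular_seq s || ~~ regular_seq t -> lproj R (X * Y)%type n (shuffle R s t) = 0.
Proof.
move=> st ir; rewrite (@shuffle_ext _ _ _ _ _ \0) // => z sz; rewrite lprojE.
apply: rgen_irregular; have [x [s' [y [t' [z' [es et _]]]]]] := is_shuffle_head sz.
have [sigma ls ->] := is_shuffle_stair sz es et.
by apply: stair_irregular; rewrite -?es -?et.
Qed.

Lemma shuffle_size n i j (s : seq X) (t : seq Y) (z : seq (X * Y)%type) :
  is_shuffle s t z -> size s = i.+1 -> size t = j.+1 -> (i + j)%N = n -> size z = n.+1.
Proof.
move=> sz ss st ijn; apply: succn_inj; rewrite [LHS](size_shuffle sz) ss st; lia.
Qed.

(** Defined for every [n], as [product_pairing] asks; [lproj] makes it 0 unless [n] is the total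
    degree. *)
Definition cross n i j : {linear tensor (rchain R X i) (rchain R Y j) ->
    rchain R (X * Y)%type n} :=
  free_tensor_lift (fun (s : rpath X i) (t : rpath Y j) =>
    lproj R _ n (shuffle R (val s) (val t))).

(** Faces of regular paths can be irregular. Then both sides vanish, since a repetition in [s] or
    [t] is inherited by every staircase. *)
Lemma cross_rgen n i j s t : size s = i.+1 -> size t = j.+1 -> (i + j)%N = n ->
  cross n i j (tpure (rgen R i s) (rgen R j t)) = lproj R _ n (shuffle R s t).
Proof.
move=> ss st ijn; have sst : (size s + size t)%N = n.+2 by rewrite ss st; lia.
have [rs|rs] := boolP (regular_seq s); last first.
  by rewrite rgen_irregular // tpure0l linear0 shuffle_rgen ?rs.
have [rt|rt] := boolP (regular_seq t); last first.
  by rewrite (rgen_irregular _ _ rt) tpure0r linear0 shuffle_rgen ?rt ?orbT.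
have ps : (size s == i.+1) && regular_seq s by rewrite ss eqxx.
have pt : (size t == j.+1) && regular_seq t by rewrite st eqxx.
rewrite (rgen_val R (exist _ s ps)) (rgen_val R (exist _ t pt)).
exact: free_tensor_liftE.
Qed.

Lemma cross_degree n i j x : (i + j)%N != n -> cross n i j x = 0.
Proof.
move=> ijn; move: x; apply: (@free_tensor_ext _ _ _ _ (cross n i j) \0) => s t.
rewrite free_tensor_liftE (@shuffle_ext _ _ _ _ _ \0) // => z sz.
rewrite lprojE rgen_size //; have /andP[/eqP ss _] := valP s; have /andP[/eqP st _] := valP t.
by have := size_shuffle sz; rewrite ss st
  => ez; apply: contra ijn => /eqP e; move: ez; rewrite e; lia.
Qed.

Lemma cross_leibniz n i j x : (i + j)%N = n ->
  bd R _ n (cross n i j x) =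
  cross n.-1 i.-1 j (tensor_map (bd R X i) idfun x) +
  (-1) ^+ i *: cross n.-1 i j.-1 (tensor_map idfun (bd R Y j) x).
Proof.
move=> ijn; move: x; apply: (@free_tensor_ext _ _ _ _ (bd R _ n \o cross n i j)
  ((cross n.-1 i.-1 j \o tensor_map (bd R X i) idfun) \+
   ((-1) ^+ i \*: (cross n.-1 i j.-1 \o tensor_map idfun (bd R Y j))))) => s t.
rewrite -[LHS]/(bd R _ n (cross n i j _)).
rewrite -[RHS]/(cross n.-1 i.-1 j (tensor_map _ _ _) +
  (-1) ^+ i *: cross n.-1 i j.-1 (tensor_map _ _ _)).
rewrite !tensor_mapE; have /andP[/eqP ss rs] := valP s; have /andP[/eqP st rt] := valP t.
rewrite -(rgen_val R s) -(rgen_val R t) cross_rgen //.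
rewrite -[X in _ = cross _ _ _ X + _]/(tpure (bd R X i (rgen R i (val s))) (rgen R j (val t))).
rewrite -[X in _ = _ + _ *: cross _ _ _ X]/(tpure (rgen R i (val s)) (bd R Y j (rgen R j (val t)))).
move: (val s) (val t) ss rs st rt => {}s {}t ss rs st rt.
(* Total degree 0 is the case that [shuffle_leibniz] excludes. *)
case: n ijn => [|n] ijn.
  have [ei ej] : i = 0%N /\ j = 0%N by lia.
  by subst i j; rewrite !bd0 tpure0l tpure0r !linear0 ?scaler0 addr0.
have bdl (u : lchain R (X * Y)%type) : u = shuffle R s t ->
    bd R _ n.+1 (lproj R _ n.+1 u) = lproj R _ n (lbd R _ u).
  move=> ->; apply: (@shuffle_ext R X Y (rchain R (X * Y)%type n) (bd R _ n.+1 \o lproj R _ n.+1)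
      (lproj R _ n \o lbd R _) s t) => z sz.
  rewrite -[LHS]/(bd R _ n.+1 (lproj R _ n.+1 _)) -[RHS]/(lproj R _ n (lbd R _ _)).
  by rewrite lprojE lbdE lproj_bd // (shuffle_size sz ss st ijn).
rewrite bdl // shuffle_leibniz ?ss ?st //; try lia; clear bdl.
rewrite linearD linearZ_LR [i.+1.-1]/= [n.+1.-1]/=; congr (_ + _ *: _).
  (* For [i = 0] the augmented boundary of the single vertex is the empty sequence, whose shuffles
     are 0, matching the zero boundary of regular chains. *)
  case: i ijn ss => [|i] ijn ss.
    rewrite bd0 tpure0l linear0; case: s ss rs => [|x [|y s]] // _ _.
    by rewrite lbd_gen1 shufflelE linear0.
  rewrite lproj_bd // [i.+1.-1]/=.
  apply: (@lbd_gen_ext R X (rchain R (X * Y)%type n) (lproj R _ n \o shufflel R X t)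
    (cross n i j \o tpurel (rgen R j t) \o lproj R X i) s) => v; rewrite ss => -[sv].
  rewrite -[LHS]/(lproj R _ n (shufflel R X t _)).
  rewrite -[RHS]/(cross n i j (tpure (lproj R X i _) _)).
  by rewrite shufflelE lprojE cross_rgen //; lia.
case: j ijn st => [|j] ijn st.
  rewrite bd0 tpure0r linear0; case: t st rt => [|x [|y t]] // _ _.
  by rewrite lbd_gen1 shufflerE shuffles0 linear0.
rewrite lproj_bd // [j.+1.-1]/=.
apply: (@lbd_gen_ext R Y (rchain R (X * Y)%type n) (lproj R _ n \o shuffler R Y s)
  (cross n i j \o tpurer (rgen R i s) \o lproj R Y j) t) => v; rewrite st => -[sv].
rewrite -[LHS]/(lproj R _ n (shuffler R Y s _)).
rewrite -[RHS]/(cross n i j (tpure _ (lproj R Y j _))).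
by rewrite shufflerE lprojE cross_rgen //; lia.
Qed.

(** Reads off the L-shaped part of a chain. A projection of the wrong length makes [rgen] zero, so
    only paths with [i] horizontal and [j] vertical steps count. *)
Definition corner_gen i j (z : seq (X * Y)) : tensor (rchain R X i) (rchain R Y j) :=
  if step_like z && L_shaped z then tpure (rgen R i (xproj z)) (rgen R j (yproj z)) else 0.

Definition corner n i j : {linear rchain R (X * Y)%type n ->
    tensor (rchain R X i) (rchain R Y j)} :=
  free_lift (fun z : rpath (X * Y)%type n => corner_gen i j (val z)).

Lemma corner_rgen n i j z : size z = n.+1 ->
  corner n i j (rgen R n z) = corner_gen i j z.
Proof.
move=> sz; have [rz|rz] := boolP (regular_seq z).
  have pz : (size z == n.+1) && regular_seq z by rewrite sz eqxx.
  by rewrite (rgen_val R (exist _ z pz)) free_liftE.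
rewrite rgen_irregular // linear0 /corner_gen; case: ifP => // /andP[].
by move=> /step_like_regular; rewrite (negPf rz).
Qed.

(** Among the shuffles of two regular paths exactly one is L-shaped. *)
Lemma L_shaped_shuffle (M : lmodType R) (f : {linear lchain R (X * Y)%type -> M}) v s t :
  (0 < size s)%N -> (0 < size t)%N -> regular_seq s -> regular_seq t ->
  (forall z, is_shuffle s t z -> f (fgen z) = if L_shaped z then v else 0) ->
  f (shuffle R s t) = v.
Proof.
have [k] := ubnP (size s + size t); elim: k s t f => // k IH [|x s] [|y t] f //.
rewrite ltnS [size (x :: s)]/= [size (y :: t)]/= => stk _ _ rs rt fv.
have vert : (0 < size s)%N -> (0 < size t)%N -> f (lcons R (x, y) (shuffle R (x :: s) t)) = 0.
  move=> s0 t0; apply: (@shuffle_ext _ _ _ _ (f \o lcons R (x, y)) \0) => z sz.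
  rewrite -[LHS]/(f (lcons R (x, y) _)) lconsE fv; last exact: IsShuffleV.
  have [x1 [s' [y1 [t' [z' [[ex es] et ez]]]]]] := is_shuffle_head sz.
  have rt' : regular_seq t by case: (t) rt => // ? ? /andP[].
  have [_ p1 _] := is_shuffle_proj sz rs rt'.
  rewrite ez L_shaped_cons -ez p1 /= -ex eqxx eqSS size_eq0.
  by case: (s) s0.
case: s stk rs fv vert => [|x1 s] stk rs fv vert.
  case: t stk rt fv vert => [|y1 t] stk rt fv vert.
    by rewrite shuffle11 fv //; apply: IsShuffle1.
  rewrite shuffle_cons // shuffle0s add0r expr0 scale1r.
  apply: (IH _ _ (f \o lcons R (x, y))) => // [|z sz]; first by case/andP: rt.
  rewrite -[LHS]/(f (lcons R (x, y) _)) lconsE fv; last exact: IsShuffleV.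
  have [x2 [s' [y2 [t' [z' [[ex es] et ez]]]]]] := is_shuffle_head sz.
  have rt' : regular_seq (y1 :: t) by case/andP: rt.
  have [_ p1 _] := is_shuffle_proj sz rs rt'.
  by rewrite (@L_shaped_vertical _ _ z) ?p1 // ez L_shaped_cons -ez p1 /= -ex eqxx.
have H : f (lcons R (x, y) (shuffle R (x1 :: s) (y :: t))) = v.
  apply: (IH _ _ (f \o lcons R (x, y))) => // [|z sz]; first by case/andP: rs.
  rewrite -[LHS]/(f (lcons R (x, y) _)) lconsE fv; last exact: IsShuffleH.
  have [x2 [s' [y2 [t' [z' [[ex es] et ez]]]]]] := is_shuffle_head sz.
  by rewrite ez L_shaped_cons /= -ex; case/andP: rs => /negPf ->.
rewrite shuffle_cons // 2!linearD H !linearZ_LR.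
case: t stk rt fv vert {H IH} => [|y1 t] stk rt fv vert.
  by rewrite shuffles0 !linear0 addr0.
by rewrite vert // scaler0 addr0.
Qed.

Lemma corner_cross n i j x : (i + j)%N = n -> corner n i j (cross n i j x) = x.
Proof.
move=> ijn; move: x; apply: (@free_tensor_ext _ _ _ _ (corner n i j \o cross n i j) idfun) => s t.
rewrite -[LHS]/(corner n i j (cross n i j _)) free_tensor_liftE -[RHS]/(tpure _ _).
have /andP[/eqP ss rs] := valP s; have /andP[/eqP st rt] := valP t.
apply: (@L_shaped_shuffle _ (corner n i j \o lproj R _ n)); rewrite ?ss ?st // => z sz.
rewrite -[LHS]/(corner n i j (lproj R _ n _)) lprojE corner_rgen; last first.
  exact: shuffle_size sz ss st _.
have [sl p1 p2] := is_shuffle_proj sz rs rt.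
by rewrite /corner_gen sl p1 p2 !rgen_val.
Qed.

Lemma corner_cross0 n i j a b x : (a + b)%N = n -> i != a ->
  corner n i j (cross n a b x) = 0.
Proof.
move=> abn ia; move: x.
apply: (@free_tensor_ext _ _ _ _ (corner n i j \o cross n a b) \0) => s t.
rewrite -[LHS]/(corner n i j (cross n a b _)) free_tensor_liftE.
have /andP[/eqP ss rs] := valP s; have /andP[/eqP st rt] := valP t.
apply: (@shuffle_ext _ _ _ _ (corner n i j \o lproj R _ n) \0) => z sz.
rewrite -[LHS]/(corner n i j (lproj R _ n _)) lprojE corner_rgen; last first.
  exact: shuffle_size sz ss st _.
have [sl p1 p2] := is_shuffle_proj sz rs rt.
rewrite /corner_gen sl p1 p2 (rgen_size R (n := i)) ?tpure0l ?if_same //.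
by rewrite ss eqSS eq_sym.
Qed.

End Cross.

(** * Invariant chains of a product *)

Section FlatPairs.
Variable R : comNzRingType.

Section Pairing.
Variables (N N1 N2 : lmodType R) (g1 : {linear N -> N1}) (g2 : {linear N -> N2}).
Definition pairing (y : N) : (N1 * N2)%type := (g1 y, g2 y).
Lemma pairing_linear : linear pairing.
Proof. by move=> a x y; rewrite /pairing !linearP. Qed.
HB.instance Definition _ := GRing.isLinear.Build R N (N1 * N2)%type *:%R pairing pairing_linear.
End Pairing.

(** Omega is cut out by two linear conditions; pairing them into one map reduces to
    [finite_retract_flat]. *)
Lemma finite_retract_flat2 (M N N1 N2 N3 : lmodType R) (g1 : {linear N -> N1})
    (g2 : {linear N -> N2}) (g3 : {linear N -> N3}) :
  finite_retract M -> (forall y, g1 y = 0 -> g2 y = 0 -> g3 y = 0) ->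
  forall x : tensor M N, tensor_map idfun g1 x = 0 -> tensor_map idfun g2 x = 0 ->
  tensor_map idfun g3 x = 0.
Proof.
move=> fM g123 x x1 x2.
apply: (finite_retract_flat (g1 := pairing g1 g2) fM) => [y [y1 y2]|].
  exact: g123.
pose i1 : {linear N1 -> (N1 * N2)%type} := pairing idfun \0.
pose i2 : {linear N2 -> (N1 * N2)%type} := pairing \0 idfun.
rewrite (tensor_mapDr idfun (g1 := i1 \o g1) (g2 := i2 \o g2)); last first.
  by move=> c; apply/pair_equal_spec; rewrite /= addr0 add0r.
rewrite -(tensor_map_comp (f := idfun) (g := g1) (f' := idfun) (g' := i1)) // x1 linear0 add0r.
by rewrite -(tensor_map_comp (f := idfun) (g := g2) (f' := idfun) (g' := i2)) // x2 linear0.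
Qed.

Lemma finite_retract_flat2_l (M N N1 N2 N3 : lmodType R) (g1 : {linear N -> N1})
    (g2 : {linear N -> N2}) (g3 : {linear N -> N3}) :
  finite_retract M -> (forall y, g1 y = 0 -> g2 y = 0 -> g3 y = 0) ->
  forall x : tensor N M, tensor_map g1 idfun x = 0 -> tensor_map g2 idfun x = 0 ->
  tensor_map g3 idfun x = 0.
Proof.
move=> fM g123 x x1 x2; rewrite -[LHS]tensor_swapK tensor_swap_map.
rewrite (finite_retract_flat2 fM g123) ?linear0 //.
  by rewrite -tensor_swap_map x1 linear0.
by rewrite -tensor_swap_map x2 linear0.
Qed.

Lemma free_sub (K : choiceType) (M : lmodType R) (W : submodClosed M)
    (g : {linear {freeg K / R} -> M}) :
  (forall k, g (fgen k) \in W) -> forall x, g x \in W.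
Proof.
move=> gW u; rewrite -[u]freeg_sumE; elim: (dom u) => [|k s IH].
  by rewrite big_nil linear0 rpred0.
rewrite big_cons linearD rpredD //.
have -> : << coeff k u *g k >> = coeff k u *: (fgen k : {freeg K / R}).
  by apply/eqP/freeg_eqP => y; rewrite coeffZ !coeffU mul1r.
by rewrite linearZ_LR rpredZ.
Qed.

End FlatPairs.

(** * Allowed and invariant chains as kernels *)

Section Allowed.
Variables (R : comNzRingType) (P : path_complex) (n : nat).

(** The projection onto the generators outside the path complex: being allowed becomes the vanishing
    of a linear map, a form that can be tensored. *)
Definition forbidden : {linear rchain R P n -> rchain R P n} :=
  free_lift (fun t : rpath P n => if `[< pc_path P (val t) >] then 0 else fgen t).

Definition permitted : {linear rchain R P n -> rchain R P n} := idfun \- forbidden.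

Lemma permittedE u : permitted u = u - forbidden u. Proof. by []. Qed.

Lemma forbidden_gen (t : rpath P n) : pc_path P (val t) -> forbidden (fgen t) = 0.
Proof. by move=> Pt; rewrite free_liftE asboolT. Qed.

Lemma permitted_gen (t : rpath P n) :
  permitted (fgen t) = if `[< pc_path P (val t) >] then fgen t else 0.
Proof. by rewrite permittedE free_liftE; case: ifP => _; rewrite ?subr0 ?subrr. Qed.

Lemma forbidden_rgen s : pc_path P s -> forbidden (rgen R n s) = 0.
Proof.
move=> Ps; have [ps|ps] := boolP ((size s == n.+1) && regular_seq s).
  by rewrite (rgen_val R (exist _ s ps)) forbidden_gen.
by rewrite /rgen insubN // linear0.
Qed.

Lemma allowedP x : x \in allowed R P n <-> forbidden x = 0.
Proof.
split; first by apply: spanp_ker => _ [t Pt <-]; apply: forbidden_gen.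
move=> x0; rewrite -[x]subr0 -x0 -permittedE; apply: free_sub => t.
rewrite permitted_gen; case: asboolP => [Pt|_]; last exact: rpred0.
by apply: mem_spanp; exists t.
Qed.

Lemma permitted_allowed x : x \in allowed R P n -> permitted x = x.
Proof. by move=> /allowedP; rewrite permittedE => ->; rewrite subr0. Qed.

End Allowed.

Lemma omegaP (R : comNzRingType) (P : path_complex) n (x : rchain R P n) :
  x \in omega R P n <-> forbidden R P n x = 0 /\ forbidden R P n.-1 (bd R P n x) = 0.
Proof.
split=> [/andP[x1 x2]|[x1 x2]]; first by split; apply/allowedP.
by apply/andP; split; apply/allowedP.
Qed.

Section OmegaRetract.
Variables (R : idomainType) (hR : principal_ideal_domain R) (P : path_complex) (n : nat).

(** The map [e] is a projection killing Omega with [u - e u] always in Omega, so Omega is a direct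
    summand. *)
Lemma omega_splitting : exists e : {linear rchain R P n -> rchain R P n},
  (forall u, forbidden R P n u = 0 -> forbidden R P n.-1 (bd R P n u) = 0 -> e u = 0) /\
  (forall u, u - e u \in omega R P n).
Proof.
have [K1 [i1 [r1 ri1]]] := rchain_finite R P n.
have [K2 [i2 [r2 ri2]]] := rchain_finite R P n.-1.
(* Both defining conditions are placed side by side in one finite free module, so that a single
   splitting handles them together. *)
pose f : {linear rchain R P n -> {freeg (K1 + K2)%type / R}} :=
  (free_map R inl \o i1 \o forbidden R P n) \+
  (free_map R inr \o i2 \o forbidden R P n.-1 \o bd R P n).
have fE u : f u = free_map R inl (i1 (forbidden R P n u)) +
  free_map R inr (i2 (forbidden R P n.-1 (bd R P n u))) by [].
pose q1 : {linear {freeg (K1 + K2)%type / R} -> {freeg K1 / R}} :=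
  free_lift (fun k => if k is inl k1 then fgen k1 else 0).
pose q2 : {linear {freeg (K1 + K2)%type / R} -> {freeg K2 / R}} :=
  free_lift (fun k => if k is inr k2 then fgen k2 else 0).
have q1l u : q1 (free_map R inl u) = u.
  move: u; apply: (@free_ext _ _ _ (q1 \o free_map R inl) idfun) => k.
  by rewrite -[LHS]/(q1 (free_map R inl _)) !free_liftE.
have q1r u : q1 (free_map R inr u) = 0.
  move: u; apply: (@free_ext _ _ _ (q1 \o free_map R inr) \0) => k.
  by rewrite -[LHS]/(q1 (free_map R inr _)) !free_liftE.
have q2l u : q2 (free_map R inl u) = 0.
  move: u; apply: (@free_ext _ _ _ (q2 \o free_map R inl) \0) => k.
  by rewrite -[LHS]/(q2 (free_map R inl _)) !free_liftE.
have q2r u : q2 (free_map R inr u) = u.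
  move: u; apply: (@free_ext _ _ _ (q2 \o free_map R inr) idfun) => k.
  by rewrite -[LHS]/(q2 (free_map R inr _)) !free_liftE.
have f1 u : r1 (q1 (f u)) = forbidden R P n u by rewrite fE linearD q1l q1r addr0 ri1.
have f2 u : r2 (q2 (f u)) = forbidden R P n.-1 (bd R P n u).
  by rewrite fE linearD q2l q2r add0r ri2.
have [e [e1 e2]] := pid_splitting hR f.
exists e; split=> [u u1 u2|u]; first by apply: e2; rewrite fE u1 u2 !linear0 addr0.
apply/omegaP; rewrite -f1 -f2 linearB e1 subrr.
by split; rewrite !linear0.
Qed.

Lemma omega_projection : exists p : {linear rchain R P n -> subm (omega R P n)},
  (forall x, p (val x) = x) /\
  (forall u, forbidden R P n u = 0 -> forbidden R P n.-1 (bd R P n u) = 0 ->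
    val (p u) = u).
Proof.
have [e [e1 e2]] := omega_splitting.
pose p_ u : subm (omega R P n) := Sub (u - e u) (e2 u).
have pL : linear p_.
  move=> a u v; apply: val_inj; rewrite /= linearP scalerBr opprD.
  by rewrite addrACA.
pose p : {linear rchain R P n -> subm (omega R P n)} :=
  HB.pack p_ (GRing.isLinear.Build R _ _ *:%R p_ pL).
exists p; split=> [x|u u1 u2]; last by rewrite /= e1 // subr0.
apply: val_inj => /=; have /omegaP[x1 x2] := valP x.
by rewrite e1 ?subr0.
Qed.

Lemma omega_finite : finite_retract (subm (omega R P n)).
Proof.
have [p [pv _]] := omega_projection; have [K [i [r ri]]] := rchain_finite R P n.
exists K, (i \o val), (p \o r) => x.
by rewrite -[LHS]/(p (r (i (val x)))) ri pv.
Qed.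

End OmegaRetract.

Section SequenceCoefficients.
Variables (R : comNzRingType) (V : finType) (n : nat).

(** Indexed by plain sequences, so that coefficients at flipped paths need no proof of regularity or
    length in the index. *)
Definition pcoef (z : seq V) : {linear rchain R V n -> R^o} :=
  free_lift (fun t : rpath V n => (val t == z)%:R : R^o).

Lemma pcoef_gen z t : pcoef z (fgen t) = (val t == z)%:R :> R.
Proof. by rewrite /pcoef free_liftE. Qed.

Lemma pcoef_rgen z s : regular_seq z -> size z = n.+1 ->
  pcoef z (rgen R n s) = (s == z)%:R :> R.
Proof.
move=> rz sz; have [ps|ps] := boolP ((size s == n.+1) && regular_seq s).
  by rewrite (rgen_val R (exist _ s ps)) pcoef_gen.
rewrite /rgen insubN // linear0; case: eqVneq => // es.
by move: ps; rewrite es rz sz eqxx.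
Qed.

Lemma pcoef_ext (u v : rchain R V n) :
  (forall t : rpath V n, pcoef (val t) u = pcoef (val t) v) -> u = v.
Proof.
move=> uv; apply: fcoef_ext => t.
have E w : fcoef t w = pcoef (val t) w.
  by move: w; apply: (@free_ext _ _ _ (fcoef t) (pcoef (val t))) => s; rewrite fcoef_gen.
by rewrite !E.
Qed.

Lemma pcoef_lproj z u : regular_seq z -> size z = n.+1 ->
  pcoef z (lproj R V n u) = fcoef z u :> R.
Proof.
move=> rz sz; move: u.
apply: (@free_ext _ _ _ (pcoef z \o lproj R V n) (fcoef z)) => s.
by rewrite -[LHS]/(pcoef z (lproj R V n _)) lprojE fcoef_gen pcoef_rgen.
Qed.

End SequenceCoefficients.

Lemma shuffle_coefE (R : comNzRingType) (X Y : choiceType) s t (z : seq (X * Y)) :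
  s != [::] -> regular_seq s -> regular_seq t ->
  fcoef z (shuffle R s t) =
  (if [&& step_like z, xproj z == s & yproj z == t] then (-1) ^+ inversions z else 0) :> R.
Proof.
move=> s0 rs rt; case: ifP => [/(is_shuffleP _ s0 rs rt) sz|sz].
  exact: shuffle_coef.
rewrite (@shuffle_ext _ _ _ _ _ \0) // => v /(is_shuffleP _ s0 rs rt) sv.
by rewrite fcoef_gen; case: eqVneq => // ev; rewrite -ev sv in sz.
Qed.

(** * Recovering a chain from its L-shaped stairs *)

Section Product.
Variables (R : comNzRingType) (P Q : path_complex).
Local Notation Z := (pc_prod P Q).

(** A stair path over an irregular path is itself irregular, so a regular path of the product arises
    from regular factors. *)
Lemma pc_prod_shuffle z : pc_path Z z -> regular_seq z ->
  exists s t, [/\ pc_path P s, pc_path Q t, regular_seq s, regular_seq t & is_shuffle s t z].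
Proof.
move=> [x [s [y [t [sigma [Ps Qt lst ->]]]]]] rz.
exists (x :: s), (y :: t); split=> //; last exact: stair_is_shuffle.
  by apply: contraLR rz => rs; apply: stair_irregular => //; rewrite rs.
by apply: contraLR rz => rt; apply: stair_irregular => //; rewrite rt orbT.
Qed.

Lemma shuffle_pc_prod s t z : pc_path P s -> pc_path Q t -> is_shuffle s t z ->
  pc_path Z z.
Proof.
move=> Ps Qt sz; have [x [s' [y [t' [z' [es et _]]]]]] := is_shuffle_head sz.
have [sigma ls ez] := is_shuffle_stair sz es et.
by exists x, s', y, t', sigma; rewrite -es -et.
Qed.

Lemma pc_prod_step_like z : pc_path Z z -> regular_seq z -> step_like z.
Proof.
move=> Zz rz; have [s [t [_ _ rs rt sz]]] := pc_prod_shuffle Zz rz.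
by have [] := is_shuffle_proj sz rs rt.
Qed.

(** Inserting [permitted] makes this a statement about all tensors of regular chains, which can be
    checked on generators. *)
Lemma cross_permitted n i j x : (i + j)%N = n ->
  cross R P Q n i j (tensor_map (permitted R P i) (permitted R Q j) x) \in allowed R Z n.
Proof.
move=> ijn; move: x; apply: (@free_tensor_sub _ _ _ _ _ (cross R P Q n i j \o
   tensor_map (permitted R P i) (permitted R Q j))) => s t.
suff: cross R P Q n i j (tensor_map (permitted R P i) (permitted R Q j)
    (tpure (fgen s) (fgen t))) \in allowed R Z n by [].
rewrite tensor_mapE !permitted_gen.
case: asboolP => [Ps|_]; last by rewrite tpure0l linear0 rpred0.
case: asboolP => [Qt|_]; last by rewrite tpure0r linear0 rpred0.
rewrite free_tensor_liftE; apply: shuffle_sub => z sz; rewrite lprojE.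
have /andP[/eqP ss rs] := valP s; have /andP[/eqP st rt] := valP t.
have [sl _ _] := is_shuffle_proj sz rs rt.
have pz : (size z == n.+1) && regular_seq z.
  by rewrite (shuffle_size sz ss st ijn) eqxx step_like_regular.
rewrite (rgen_val R (exist _ z pz)); apply: mem_spanp.
by exists (exist _ z pz) => //; apply: shuffle_pc_prod Ps Qt sz.
Qed.

(** The projections of an allowed regular path of the product are the paths it was built from, hence
    allowed. *)
Lemma corner_forbidden_l n i j w : w \in allowed R Z n ->
  tensor_map (forbidden R P i) idfun (corner R P Q n i j w) = 0.
Proof.
apply: (@spanp_ker _ _ _ (tensor_map (forbidden R P i) idfun \o corner R P Q n i j)).
move=> _ [z Zz <-]; rewrite -[LHS]/(tensor_map _ _ (corner R P Q n i j _)).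
have /andP[/eqP ss rz] := valP z.
have [s [t [Ps Qt rs rt sz]]] := pc_prod_shuffle Zz rz.
have [sl e1 e2] := is_shuffle_proj sz rs rt.
rewrite free_liftE /corner_gen e1 e2; case: ifP => _; last by rewrite linear0.
by rewrite tensor_mapE forbidden_rgen // tpure0l.
Qed.

Lemma corner_forbidden_r n i j w : w \in allowed R Z n ->
  tensor_map idfun (forbidden R Q j) (corner R P Q n i j w) = 0.
Proof.
apply: (@spanp_ker _ _ _ (tensor_map idfun (forbidden R Q j) \o corner R P Q n i j)).
move=> _ [z Zz <-]; rewrite -[LHS]/(tensor_map _ _ (corner R P Q n i j _)).
have /andP[/eqP ss rz] := valP z.
have [s [t [Ps Qt rs rt sz]]] := pc_prod_shuffle Zz rz.
have [sl e1 e2] := is_shuffle_proj sz rs rt.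
rewrite free_liftE /corner_gen e1 e2; case: ifP => _; last by rewrite linear0.
by rewrite tensor_mapE forbidden_rgen // tpure0r.
Qed.

Definition resum_fun n (w : rchain R Z n) : rchain R Z n :=
  \sum_(i < n.+1) cross R P Q n i (n - i) (corner R P Q n i (n - i) w).
Lemma resum_linear n : linear (@resum_fun n).
Proof.
move=> a u v; rewrite scaler_sumr -big_split; apply: eq_bigr => i _.
by rewrite !linearP.
Qed.
HB.instance Definition _ n := GRing.isLinear.Build R (rchain R Z n) (rchain R Z n)
  *:%R (@resum_fun n) (@resum_linear n).
Definition resum n : {linear rchain R Z n -> rchain R Z n} := @resum_fun n.

(** Only the summand indexed by the number of horizontal steps survives. *)
Lemma resum_gen n (t : rpath Z n) : resum n (fgen t) =
  if step_like (val t) && L_shaped (val t)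
  then lproj R Z n (shuffle R (xproj (val t)) (yproj (val t))) else 0.
Proof.
rewrite -[LHS]/(\sum_(i < n.+1) _); under eq_bigr => i _ do rewrite free_liftE.
rewrite /corner_gen; case: ifP => [/andP[sl _]|_]; last first.
  by rewrite big1 // => i _; rewrite linear0.
have /andP[/eqP st rt] := valP t.
case: (val t) st sl => [//|c z] st sl; have sz := step_like_shuffle sl.
have [u eu] := xproj_head c z; have [v ev] := yproj_head c z.
have suv : (size u + size v)%N = n.
  have := size_shuffle sz; rewrite eu ev => e; apply/succn_inj/succn_inj.
  by rewrite -[in RHS]st e /= addnS.
have un : (size u < n.+1)%N by lia.
rewrite eu ev (bigD1 (Ordinal un)) // big1 => [|i iu]; last first.
  by rewrite rgen_size ?tpure0l ?linear0 //= eqSS;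
    apply: contra iu => /eqP e; apply/eqP/val_inj.
rewrite cross_rgen /=; [exact: addr0|by []|by rewrite -suv addKn|by rewrite -suv addKn].
Qed.

Lemma allowed_pcoef0 n z w : w \in allowed R Z n -> ~~ step_like z -> pcoef R n z w = 0 :> R.
Proof.
move=> wA sz; move: w wA; apply: (@spanp_ker _ _ _ (pcoef R n z)) => _ [t Zt <-]; rewrite pcoef_gen.
case: eqVneq => // et; have /andP[_ rt] := valP t.
by move: sz; rewrite -et (pc_prod_step_like Zt rt).
Qed.

(** The diagonal path [z] is a face of only two step-like paths, its two
    completions around the corner, with the same sign. *)
Lemma pcoef_diagonal n (a a' : P) (b b' : Q) u v w :
  a != a' -> b != b' ->
  let up := u ++ [:: (a, b), (a, b'), (a', b') & v] in
  let down := u ++ [:: (a, b), (a', b), (a', b') & v] in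
  let z := u ++ [:: (a, b), (a', b') & v] in
  step_like down -> size down = n.+2 -> w \in allowed R Z n.+1 ->
  pcoef R n z (bd R Z n.+1 w) =
  (-1) ^+ (size u).+1 *: (pcoef R n.+1 up w + pcoef R n.+1 down w).
Proof.
move=> aa' bb' up down z sd sizd wA; apply/subr0_eq.
have szu : size up = n.+2 by rewrite -sizd !size_cat.
have szz : size z = n.+1.
  by apply: succn_inj; rewrite -sizd !size_cat /= !addnS.
have rz : regular_seq z by apply: diagonal_regular sd.
have sup : step_like up by have [->] := flip_invariants v aa' bb' u.
move: w wA; apply: (@spanp_ker _ _ _ ((pcoef R n z \o bd R Z n.+1) \-
  ((-1) ^+ (size u).+1 \*: (pcoef R n.+1 up \+ pcoef R n.+1 down)))).
move=> _ [t Zt <-]; have /andP[/eqP st rt] := valP t.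
rewrite -[LHS]/(pcoef R n z (bd R Z n.+1 (fgen t)) -
  (-1) ^+ (size u).+1 *: (pcoef R n.+1 up (fgen t) + pcoef R n.+1 down (fgen t))).
rewrite !pcoef_gen -(rgen_val R t) bd_rgen // linear_sum.
under eq_bigr => q _ do rewrite linearZ_LR pcoef_rgen //.
have slt := pc_prod_step_like Zt rt.
have delz (q : 'I_n.+2) : del q (val t) = z -> nat_of_ord q = (size u).+1 /\
    (val t = up \/ val t = down).
  by apply: (@del_diagonal _ _ _ _ _ _ _ aa' bb' u) => //; rewrite st.
have un : ((size u).+1 < n.+2)%N by rewrite -szu size_cat /= !addnS !ltnS leqW ?leq_addr.
have [etd|ntd] := eqVneq (val t) down.
  rewrite [val t == up](_ : _ = false) ?add0r; last first.
    by rewrite etd eq_sym; apply: negPf; exact: (up_neq_down _ _ _ aa').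
  rewrite (bigD1 (Ordinal un)) //= big1 => [|q qu].
    by rewrite etd del_down eqxx; apply/eqP; rewrite subr_eq0 addr0.
  case: eqVneq => [/delz[qe _]|_]; last exact: scaler0.
  by move: qu; rewrite -val_eqE /= qe eqxx.
have [etu|ntu] := eqVneq (val t) up.
  rewrite addr0 (bigD1 (Ordinal un)) //= big1 => [|q qu].
    by rewrite etu del_up eqxx; apply/eqP; rewrite subr_eq0 addr0.
  case: eqVneq => [/delz[qe _]|_]; last exact: scaler0.
  by move: qu; rewrite -val_eqE /= qe eqxx.
rewrite big1 => [|q _]; first by rewrite addr0 scaler0 subrr.
case: eqVneq => [/delz[_ [et|et]]|_]; last exact: scaler0.
  by rewrite et eqxx in ntu.
by rewrite et eqxx in ntd.
Qed.

(** For resummed chains the alternation comes from the signs of the shuffle product, with no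
    condition on [w]. *)
Lemma resum_pcoef_flip n (a a' : P) (b b' : Q) u v w :
  a != a' -> b != b' ->
  let up := u ++ [:: (a, b), (a, b'), (a', b') & v] in
  let down := u ++ [:: (a, b), (a', b), (a', b') & v] in
  step_like down -> size down = n.+1 ->
  pcoef R n up (resum n w) = - pcoef R n down (resum n w).
Proof.
move=> aa' bb' up down sd sizd.
have szu : size up = n.+1 by rewrite -sizd !size_cat.
have [ess ex ey ei] := flip_invariants v aa' bb' u.
have sup : step_like up by rewrite ess.
move: w; apply: (@free_ext _ _ _ (pcoef R n up \o resum n) (\- (pcoef R n down \o resum n))) => t.
rewrite -[LHS]/(pcoef R n up (resum n _)) -[RHS]/(- pcoef R n down (resum n _)) resum_gen.
case: ifP => [/andP[sl _]|_]; last by rewrite !linear0 ?oppr0.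
rewrite !pcoef_lproj ?step_like_regular //.
have t0 : xproj (val t) != [::].
  have /andP[/eqP st _] := valP t; case: (val t) st => // c z _.
  by have [? ->] := xproj_head c z.
rewrite !shuffle_coefE ?regular_dedup // ess ex ey ei exprS.
by case: ifP => _; rewrite ?oppr0 // mulN1r.
Qed.

Lemma resum_pcoef_L n z w : step_like z -> L_shaped z -> size z = n.+1 ->
  pcoef R n z (resum n w) = pcoef R n z w.
Proof.
move=> sl Lz szz; move: w.
apply: (@free_ext _ _ _ (pcoef R n z \o resum n) (pcoef R n z)) => t.
rewrite -[LHS]/(pcoef R n z (resum n _)) resum_gen pcoef_gen.
case: ifP => [/andP[slt Lt]|nt]; last first.
  by rewrite linear0; case: eqVneq => // et; rewrite et sl Lz in nt.
have t0 : xproj (val t) != [::].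
  have /andP[/eqP st _] := valP t; case: (val t) st => // c z' _.
  by have [? ->] := xproj_head c z'.
rewrite pcoef_lproj ?step_like_regular // shuffle_coefE ?regular_dedup // sl /=.
rewrite L_shaped_inversions // expr0; case: eqVneq => [ex|nx] /=; last first.
  by case: eqVneq => // et; rewrite et eqxx in nx.
case: eqVneq => [ey|ny]; last by case: eqVneq => // et; rewrite et eqxx in ny.
by rewrite (L_shaped_uniq sl slt Lz Lt ex ey) eqxx.
Qed.

(** Coefficients are compared by induction on [inversions]: both sides change sign under a flip,
    which lowers this number by one, and they agree on L-shaped paths. *)
Lemma resum_omega n w : w \in omega R Z n -> resum n w = w.
Proof.
move=> /andP[wA dwA]; apply: pcoef_ext => t; have /andP[/eqP st rt] := valP t.
have [sl|nsl] := boolP (step_like (val t)); last first.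
  rewrite (allowed_pcoef0 wA nsl); move: w {wA dwA}.
  apply: (@free_ext _ _ _ (pcoef R n (val t) \o resum n) \0) => s.
  rewrite -[LHS]/(pcoef R n (val t) (resum n _)) resum_gen.
  case: ifP => [/andP[sls _]|_]; last by rewrite linear0.
  rewrite pcoef_lproj // shuffle_coefE ?regular_dedup ?(negPf nsl) //.
  have /andP[/eqP ss _] := valP s; case: (val s) ss => // c z' _.
  by have [? ->] := xproj_head c z'.
move: (val t) st sl => z; clear t rt.
have [k] := ubnP (inversions z); elim: k z => // k IH z; rewrite ltnS => zk szz sl.
have [Lz|nLz] := boolP (L_shaped z); first exact: resum_pcoef_L.
have [u [a [b [b' [a' [v [ez [aa' bb']]]]]]]] := not_L_shaped sl nLz; subst z.
have [ess ex ey ei] := flip_invariants v aa' bb' u.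
have sd : step_like (u ++ [:: (a, b), (a', b), (a', b') & v]) by rewrite -ess.
have sizd : size (u ++ [:: (a, b), (a', b), (a', b') & v]) = n.+1.
  by rewrite -szz !size_cat.
rewrite (resum_pcoef_flip _ aa' bb' sd sizd) IH ?sd //; last by rewrite -ei.
(* A path with a corner has at least three vertices, so degree 0 is impossible and the boundary can
   be taken. *)
case: n w wA dwA sizd szz {IH} => [|n] w wA dwA sizd szz.
  by move: szz; rewrite size_cat /= !addnS.
have := pcoef_diagonal aa' bb' sd sizd wA.
rewrite (allowed_pcoef0 dwA (diagonal_not_step_like v aa' bb' u)).
move=> /esym/(congr1 (fun x : R^o => (-1) ^+ (size u).+1 *: x)).
by rewrite signrZK scaler0 => /eqP; rewrite addr_eq0 => /eqP ->.
Qed.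

End Product.

(** * The product datum on invariant chains *)

Definition rchain_complex (R : comNzRingType) (V : finType) : chain_complex R :=
  @ChainComplex R (fun n => rchain R V n) (@bd R V) (@bd0 R V) (@bd_bd R V).

Definition rchain_pairing (R : comNzRingType) (X Y : finType) :
  product_pairing (rchain_complex R X) (rchain_complex R Y)
    (rchain_complex R (X * Y)%type) :=
  @ProductPairing R (rchain_complex R X) (rchain_complex R Y)
    (rchain_complex R (X * Y)%type) (@cross R X Y) (@corner R X Y)
    (@cross_leibniz R X Y) (@corner_cross R X Y) (@corner_cross0 R X Y).

Section OmegaProduct.
Variables (R : idomainType) (hR : principal_ideal_domain R) (P Q : path_complex).
Local Notation Z := (pc_prod P Q).
Local Notation cross := (cross R P Q).
Local Notation corner := (corner R P Q).

(** Fails for general regular chains, already for a single diagonal edge. On Omega, [w] may be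
    replaced by its resummation, to which the Leibniz rule applies. *)
Lemma corner_bd n i j w : (i + j).+1 = n -> w \in omega R Z n ->
  corner n.-1 i j (bd R Z n w) =
  tensor_map (bd R P i.+1) idfun (corner n i.+1 j w) +
  (-1) ^+ i *: tensor_map idfun (bd R Q j.+1) (corner n i j.+1 w).
Proof.
move=> ijn /resum_omega <-; rewrite -[resum _ _ _ n w]/(resum_fun w) /resum_fun.
pose L : {linear rchain R Z n -> tensor (rchain R P i) (rchain R Q j)} :=
  (tensor_map (bd R P i.+1) idfun \o corner n i.+1 j) \+
  ((-1) ^+ i \*: (tensor_map idfun (bd R Q j.+1) \o corner n i j.+1)).
rewrite -[RHS]/(L _) !linear_sum; apply: eq_bigr => a _.
by apply: (@pr_pi_d_mu _ _ _ _ (rchain_pairing R P Q)); rewrite ?tensor_index.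
Qed.

Definition omega_proj (K : path_complex) n : {linear rchain R K n -> subm (omega R K n)} :=
  sval (cid (omega_projection hR K n)).

Lemma omega_proj_val K n (x : subm (omega R K n)) : omega_proj K n (val x) = x.
Proof. by have [] := svalP (cid (omega_projection hR K n)). Qed.

Lemma omega_proj_id K n u : forbidden R K n u = 0 ->
  forbidden R K n.-1 (bd R K n u) = 0 -> val (omega_proj K n u) = u.
Proof. by have [_] := svalP (cid (omega_projection hR K n)); apply. Qed.

Definition omega_val (K : path_complex) n : {linear subm (omega R K n) -> rchain R K n} :=
  val.

(** Applying [forbidden] in the left slot to [corner_bd] separates the two terms: it commutes with
    the right-hand boundary and already kills the neighbouring corner component. *)
Lemma corner_omega_l n i j w : (i + j)%N = n -> w \in omega R Z n ->
  tensor_map (forbidden R P i.-1 \o bd R P i) idfun (corner n i j w) = 0.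
Proof.
case: i => [|i] ijn wO; first by apply: tensor_map0l => c; rewrite /= bd0 linear0.
have /andP[wA dwA] := wO.
have := corner_forbidden_l i j dwA; rewrite corner_bd // linearD linearZ_LR.
rewrite (tensor_map_comp (F := forbidden R P i \o bd R P i.+1) (G := idfun)) //.
rewrite [tensor_map (forbidden R P i) idfun _](tensor_map_comp (F := forbidden R P i)
  (G := bd R Q j.+1)) //.
rewrite -(tensor_map_comp (f := forbidden R P i) (g := idfun) (f' := idfun)
  (g' := bd R Q j.+1)) //.
by rewrite corner_forbidden_l // linear0 scaler0 addr0.
Qed.

Lemma corner_omega_r n i j w : (i + j)%N = n -> w \in omega R Z n ->
  tensor_map idfun (forbidden R Q j.-1 \o bd R Q j) (corner n i j w) = 0.
Proof.
case: j => [|j] ijn wO; first by apply: tensor_map0r => c; rewrite /= bd0 linear0.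
have /andP[wA dwA] := wO; have ijn' : (i + j).+1 = n by rewrite -ijn addnS.
have := corner_forbidden_r i j dwA; rewrite corner_bd // linearD linearZ_LR.
rewrite [X in X + _](tensor_map_comp (F := bd R P i.+1) (G := forbidden R Q j)) //.
rewrite -(tensor_map_comp (f := idfun) (g := forbidden R Q j) (f' := bd R P i.+1)
  (g' := idfun)) //.
rewrite corner_forbidden_r // linear0 add0r.
rewrite (tensor_map_comp (F := idfun) (G := forbidden R Q j \o bd R Q j.+1)) //.
by move=> e; rewrite -[LHS](signrZK i) e scaler0.
Qed.

(** Each slot satisfies both conditions defining Omega, on whose common kernel the projection is the
    identity; flatness extends this to tensors, one slot at a time. *)
Lemma corner_omega n i j w : (i + j)%N = n -> w \in omega R Z n ->
  tensor_map (omega_val P i \o omega_proj P i) (omega_val Q j \o omega_proj Q j)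
    (corner n i j w) = corner n i j w.
Proof.
move=> ijn wO; set c := corner n i j w; have /andP[wA _] := wO.
have cl : tensor_map (omega_val P i \o omega_proj P i) idfun c = c.
  rewrite -[RHS](@tensor_map_id _ _ _ idfun idfun) //.
  pose d : {linear rchain R P i -> rchain R P i} := idfun \- (omega_val P i \o omega_proj P i).
  rewrite [RHS](tensor_mapDl (f := idfun) (f1 := omega_val P i \o omega_proj P i) (f2 := d));
    last first.
    by move=> u; rewrite /d /= addrC subrK.
  rewrite (@finite_retract_flat2_l _ _ _ _ _ _ (forbidden R P i)
    (forbidden R P i.-1 \o bd R P i) d (rchain_finite R Q j)) ?addr0 //.
  - by move=> y y1 y2; rewrite /d /= /omega_val omega_proj_id ?subrr.
  - exact: corner_forbidden_l.
  - exact: corner_omega_l.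
have cr : tensor_map idfun (omega_val Q j \o omega_proj Q j) c = c.
  rewrite -[RHS](@tensor_map_id _ _ _ idfun idfun) //.
  pose d : {linear rchain R Q j -> rchain R Q j} := idfun \- (omega_val Q j \o omega_proj Q j).
  rewrite [RHS](tensor_mapDr idfun (g := idfun) (g1 := omega_val Q j \o omega_proj Q j)
    (g2 := d)); last first.
    by move=> u; rewrite /d /= addrC subrK.
  rewrite (@finite_retract_flat2 _ _ _ _ _ _ (forbidden R Q j)
    (forbidden R Q j.-1 \o bd R Q j) d (rchain_finite R P i)) ?addr0 //.
  - by move=> y y1 y2; rewrite /d /= /omega_val omega_proj_id ?subrr.
  - exact: corner_forbidden_r.
  - exact: corner_omega_r.
rewrite -{2}cl -{2}cr; apply/esym.
exact: tensor_map_comp.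
Qed.

Lemma cross_allowed n i j (M N : lmodType R) (f : {linear M -> rchain R P i})
    (g : {linear N -> rchain R Q j}) x : (i + j)%N = n ->
  (forall y, f y \in allowed R P i) -> (forall y, g y \in allowed R Q j) ->
  cross n i j (tensor_map f g x) \in allowed R Z n.
Proof.
move=> ijn fA gA.
rewrite -(tensor_map_comp (f := f) (g := g) (f' := permitted R P i) (g' := permitted R Q j)).
- exact: cross_permitted.
- by move=> c; apply: permitted_allowed.
- by move=> c; apply: permitted_allowed.
Qed.

(** Stated for every [n], because the pairing needs a map into Omega for all index triples; off the
    total degree the product is 0. *)
Lemma cross_omega n i j (x : tensor (subm (omega R P i)) (subm (omega R Q j))) :
  cross n i j (tensor_map (omega_val P i) (omega_val Q j) x) \in omega R Z n.
Proof.
have [ijn|ijn] := eqVneq (i + j)%N n;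
  last by rewrite cross_degree //; apply: (rpred0 (omega R Z n)).
have vA (K : path_complex) k (y : subm (omega R K k)) : omega_val K k y \in allowed R K k.
  by have /andP[] := valP y.
have dA (K : path_complex) k (y : subm (omega R K k)) :
    bd R K k (omega_val K k y) \in allowed R K k.-1 by have /andP[] := valP y.
apply/andP; split; first exact: cross_allowed.
suff: bd R Z n (cross n i j (tensor_map (omega_val P i) (omega_val Q j) x))
  \in allowed R Z n.-1 by [].
rewrite cross_leibniz //; apply: rpredD; last apply: rpredZ.
  rewrite (tensor_map_comp (F := bd R P i \o omega_val P i) (G := omega_val Q j)) //.
  case: i ijn x => [|i] ijn x.
    by rewrite tensor_map0l ?linear0 ?rpred0 // => c; rewrite /= bd0.
  by apply: cross_allowed => [|y|y]; [rewrite -ijn|apply: dA|apply: vA].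
rewrite (tensor_map_comp (F := omega_val P i) (G := bd R Q j \o omega_val Q j)) //.
case: j ijn x => [|j] ijn x.
  by rewrite tensor_map0r ?linear0 ?rpred0 // => c; rewrite /= bd0.
by apply: cross_allowed => [|y|y]; [rewrite -ijn addnS|apply: vA|apply: dA].
Qed.

Definition omega_cross_fun n i j (x : tensor (subm (omega R P i)) (subm (omega R Q j))) :
  subm (omega R Z n) :=
  Sub (cross n i j (tensor_map (omega_val P i) (omega_val Q j) x)) (cross_omega n x).

Lemma omega_cross_linear n i j : linear (@omega_cross_fun n i j).
Proof.
move=> a u v; apply: val_inj.
exact: (linearP (cross n i j \o tensor_map (omega_val P i) (omega_val Q j))).
Qed.
HB.instance Definition _ n i j := GRing.isLinear.Build R _ _ *:%R
  (@omega_cross_fun n i j) (@omega_cross_linear n i j).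

Definition omega_cross n i j : {linear tensor (subm (omega R P i)) (subm (omega R Q j)) ->
  subm (omega R Z n)} := @omega_cross_fun n i j.

Definition omega_corner n i j : {linear subm (omega R Z n) ->
    tensor (subm (omega R P i)) (subm (omega R Q j))} :=
  tensor_map (omega_proj P i) (omega_proj Q j) \o corner n i j \o omega_val Z n.

Lemma omega_cross_leibniz n i j x : (i + j)%N = n ->
  omega_d n (omega_cross n i j x) =
  omega_cross n.-1 i.-1 j (tensor_map (omega_d i) idfun x) +
  (-1) ^+ i *: omega_cross n.-1 i j.-1 (tensor_map idfun (omega_d j) x).
Proof.
move=> ijn; apply: val_inj.
rewrite -[LHS]/(bd R Z n (cross n i j _)) cross_leibniz //.
rewrite -[RHS]/(cross n.-1 i.-1 j (tensor_map _ _ _) +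
  (-1) ^+ i *: cross n.-1 i j.-1 (tensor_map _ _ _)).
have e1 : tensor_map (bd R P i) idfun (tensor_map (omega_val P i) (omega_val Q j) x) =
    tensor_map (omega_val P i.-1) (omega_val Q j) (tensor_map (omega_d i) idfun x).
  rewrite (tensor_map_comp (F := bd R P i \o omega_val P i) (G := omega_val Q j)) //.
  by apply/esym/tensor_map_comp.
have e2 : tensor_map idfun (bd R Q j) (tensor_map (omega_val P i) (omega_val Q j) x) =
    tensor_map (omega_val P i) (omega_val Q j.-1) (tensor_map idfun (omega_d j) x).
  rewrite (tensor_map_comp (F := omega_val P i) (G := bd R Q j \o omega_val Q j)) //.
  by apply/esym/tensor_map_comp.
by rewrite e1 e2.
Qed.

Lemma omega_corner_cross n i j x : (i + j)%N = n ->
  omega_corner n i j (omega_cross n i j x) = x.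
Proof.
move=> ijn; rewrite -[LHS]/(tensor_map _ _ (corner n i j (cross n i j _))).
rewrite corner_cross // (tensor_map_comp (F := idfun) (G := idfun)).
- exact: tensor_map_id.
- exact: omega_proj_val.
- exact: omega_proj_val.
Qed.

Lemma omega_corner_cross0 n i j a b x : (a + b)%N = n -> i != a ->
  omega_corner n i j (omega_cross n a b x) = 0.
Proof.
move=> abn ia; rewrite -[LHS]/(tensor_map _ _ (corner n i j (cross n a b _))).
by rewrite corner_cross0 // linear0.
Qed.

Definition omega_pairing : product_pairing (omega_complex R P) (omega_complex R Q)
    (omega_complex R Z) :=
  @ProductPairing R (omega_complex R P) (omega_complex R Q) (omega_complex R Z)
    omega_cross omega_corner omega_cross_leibniz omega_corner_cross omega_corner_cross0.

Lemma omega_cross_corner n (w : subm (omega R Z n)) :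
  \sum_(i < n.+1) omega_cross n i (n - i) (omega_corner n i (n - i) w) = w.
Proof.
apply: val_inj; rewrite raddf_sum -[RHS](resum_omega (valP w)).
apply: eq_bigr => i _.
rewrite -[LHS]/(cross n i (n - i) (tensor_map _ _ (tensor_map _ _ (corner n i (n - i) (val w))))).
rewrite (tensor_map_comp (F := omega_val P i \o omega_proj P i)
  (G := omega_val Q (n - i) \o omega_proj Q (n - i))) //.
by rewrite (corner_omega (tensor_index i) (valP w)).
Qed.

Definition omega_datum : product_datum (omega_complex R P) (omega_complex R Q)
    (omega_complex R Z) := @ProductDatum _ _ _ _ omega_pairing omega_cross_corner.

Lemma omega_complex_finite (K : path_complex) i : finite_retract (omega_complex R K i).
Proof. exact: omega_finite. Qed.

End OmegaProduct.

(** * Naturality of the cross product *)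

Section OmegaNatural.
Variables (R : idomainType) (hR : principal_ideal_domain R).
Variables (P Q P' Q' : path_complex) (f : pc_morphism P P') (g : pc_morphism Q Q').

(** The recursion commutes with any relabelling of vertices, even one that creates repetitions;
    irregular images disappear only under [lproj]. *)
Lemma shuffle_map s t : free_map R (map (pc_prod_fun f g)) (shuffle R s t) =
  shuffle R (map f s) (map g t).
Proof.
have [k] := ubnP (size s + size t); elim: k s t => // k IH [|x s] [|y t];
  rewrite ?shuffle0s ?shuffles0 ?linear0 //.
rewrite ltnS => stk; have [st0|st0] := posnP (size s + size t).
  have -> : s = [::] by apply/size0nil; lia.
  have -> : t = [::] by apply/size0nil; lia.
  by rewrite !shuffle11 free_liftE.
rewrite !map_cons !shuffle_cons ?size_map //.
have consE u : free_map R (map (pc_prod_fun f g)) (lcons R (x, y) u) =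
    lcons R (f x, g y) (free_map R (map (pc_prod_fun f g)) u).
  move: u; apply: (@free_ext _ _ _ (free_map R (map (pc_prod_fun f g)) \o lcons R (x, y))
    (lcons R (f x, g y) \o free_map R (map (pc_prod_fun f g)))) => z.
  rewrite -[LHS]/(free_map R _ (lcons R _ _)) -[RHS]/(lcons R _ (free_map R _ _)).
  by rewrite lconsE !free_liftE.
rewrite consE linearD linearZ_LR !IH //; move: stk => /=; lia.
Qed.

Lemma cross_natural n i j x : (i + j)%N = n ->
  rchain_map R (pc_prod_map f g) n (cross R P Q n i j x) =
  cross R P' Q' n i j (tensor_map (rchain_map R f i) (rchain_map R g j) x).
Proof.
move=> ijn; move: x; apply: (@free_tensor_ext _ _ _ _
  (rchain_map R (pc_prod_map f g) n \o cross R P Q n i j)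
  (cross R P' Q' n i j \o tensor_map (rchain_map R f i) (rchain_map R g j))) => s t.
rewrite -[LHS]/(rchain_map R (pc_prod_map f g) n (cross R P Q n i j _)).
rewrite -[RHS]/(cross R P' Q' n i j (tensor_map _ _ _)) tensor_mapE !free_liftE.
have /andP[/eqP ss rs] := valP s; have /andP[/eqP st rt] := valP t.
rewrite cross_rgen ?size_map // -shuffle_map free_tensor_liftE.
move: (shuffle _ _ _) => u; move: u.
apply: (@free_ext _ _ _ (rchain_map R (pc_prod_map f g) n \o lproj R _ n)
  (lproj R _ n \o free_map R (map (pc_prod_fun f g)))) => z.
rewrite -[LHS]/(rchain_map R (pc_prod_map f g) n (lproj R _ n _)).
rewrite -[RHS]/(lproj R _ n (free_map R _ _)) !free_liftE.
exact: rchain_map_rgen.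
Qed.

Lemma omega_cross_natural n i j x : (i + j)%N = n ->
  omega_chain_map R (pc_prod_map f g) n (pr_mu (omega_datum hR P Q) n i j x) =
  pr_mu (omega_datum hR P' Q') n i j
    (tensor_map (omega_chain_map R f i) (omega_chain_map R g j) x).
Proof.
move=> ijn; apply: val_inj.
rewrite -[LHS]/(rchain_map R (pc_prod_map f g) n (cross R P Q n i j (tensor_map _ _ x))).
rewrite -[RHS]/(cross R P' Q' n i j (tensor_map (omega_val R P' i) (omega_val R Q' j)
  (tensor_map _ _ x))) cross_natural //.
rewrite (tensor_map_comp (F := rchain_map R f i \o omega_val R P i)
  (G := rchain_map R g j \o omega_val R Q j)) //.
by rewrite (tensor_map_comp (f := omega_chain_map R f i) (g := omega_chain_map R g j)
  (F := rchain_map R f i \o omega_val R P i) (G := rchain_map R g j \o omega_val R Q j)).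
Qed.

End OmegaNatural.

Theorem corollary5p9 (R : idomainType) (hR : principal_ideal_domain R) :
  exists (alpha : forall (X Y : path_complex) (n : nat),
            {linear kuenneth_tensor R X Y n -> path_homology R (pc_prod X Y) n})
         (beta : forall (X Y : path_complex) (n : nat),
            {linear path_homology R (pc_prod X Y) n -> kuenneth_tor R X Y n}),
  [/\ forall (X Y : path_complex) (n : nat),
        regular_complex X -> regular_complex Y ->
        split_short_exact (alpha X Y n) (beta X Y n),
      forall (X Y X' Y' : path_complex)
          (f : pc_morphism X X') (g : pc_morphism Y Y') (n : nat),
        regular_complex X -> regular_complex Y ->
        regular_complex X' -> regular_complex Y' ->
        forall t : kuenneth_tensor R X Y n,
          alpha X' Y' n (kuenneth_tensor_map R f g n t) =
          path_homology_map R (pc_prod_map f g) n (alpha X Y n t)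
    & forall (X Y X' Y' : path_complex)
          (f : pc_morphism X X') (g : pc_morphism Y Y') (n : nat),
        regular_complex X -> regular_complex Y ->
        regular_complex X' -> regular_complex Y' ->
        forall h : path_homology R (pc_prod X Y) n,
          beta X' Y' n (path_homology_map R (pc_prod_map f g) n h) =
          kuenneth_tor_map R f g n (beta X Y n h)].
Proof.
have fin := omega_complex_finite hR.
(* One splitting is fixed for each path complex, so that the map to Tor is defined uniformly;
   naturality must then compare unrelated choices. *)
pose s K := inhabited_witness (splitting_exists hR (fin K)).
exists (fun X Y n => alpha_sum (omega_datum hR X Y) n),
       (fun X Y n => beta_sum (omega_datum hR X Y) (s X) (s Y) n).
split.
- by move=> X Y n _ _; apply: kuenneth_split_exact.
- move=> X Y X' Y' f g n _ _ _ _ t.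
  rewrite -[LHS]/(\sum_i _) -[alpha_sum _ _ t]/(\sum_i _) linear_sum.
  apply: eq_bigr => i _; rewrite ffunE.
  exact: (alpha_natural (omega_cross_natural hR f g)).
- move=> X Y X' Y' f g n _ _ _ _ h.
  apply/ffunP => i; rewrite !ffunE.
  exact: (beta_natural (s X) (s Y) (s X') (s Y') (fin X) (fin Y) (omega_cross_natural hR f g)).
Qed.
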